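(* The function $\tau\mapsto p(\tau)$ is meromorphic on $\mathbb{H}$. It maps the circular arc triangle $$T_0= \{ \tau\in \mathbb{C}: 0\le \operatorname{Re}(\tau) \le 1/2,\ \operatorname{Im}(\tau)>0,\ |\tau|\ge 1\} \cup\{\infty\}$$ conformally onto the circular arc triangle $$T_1= \bigl(\{ \tau\in\mathbb{C}: 0\le \operatorname{Re}(\tau) \le 1/2\}\setminus \{ \tau\in\mathbb{C}: \operatorname{Im}(\tau)<0,\ |\tau|> 1\}\bigr) \cup\{\infty\}.$$ Here the vertices of the triangles correspond under the map $p$ in the following way: $$p(i)=-i,\qquad p\bigl(\tfrac12 (1+i\sqrt3)\bigr)=\tfrac12 (1-i\sqrt3),\qquad p(\infty)=\infty.$$
   Context: $\mathbb{H}=\{\tau\in\mathbb{C}:\operatorname{Im}(\tau)>0\}$ and $\widehat{\mathbb{C}}=\mathbb{C}\cup\{\infty\}$ is the Riemann sphere. Definition of $p$. Let $\omega_1,\omega_2\in\mathbb{C}\setminus\{0\}$ be linearly independent over $\mathbb{R}$ with $\tau=\omega_1/\omega_2\in\mathbb{H}$, and let $\Gamma=\{k\omega_1+n\omega_2: k,n\in\mathbb{Z}\}$. The Weierstrass zeta-function is $$\zeta(u)=\frac1u+\sum_{\gamma\in\Gamma\setminus\{0\}}\Bigl(\frac{1}{u-\gamma}+\frac1\gamma+\frac{u}{\gamma^2}\Bigr).$$ Its quasi-periods $\eta_1,\eta_2\in\mathbb{C}$ are the constants with $\zeta(u+\omega_k)=\zeta(u)+\eta_k$ for $k=1,2$ (equivalently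 $\eta_k=2\zeta(\omega_k/2)$). They do not both vanish, and $\eta_1/\eta_2\in\widehat{\mathbb{C}}$ depends only on $\tau$. Define $p(\tau)=\eta_1/\eta_2\in\widehat{\mathbb{C}}$; one may take $\omega_1=\tau$, $\omega_2=1$. A closed Jordan region in $\widehat{\mathbb{C}}$ is a compact set $X$ homeomorphic to a closed disk; $\partial X$ is its boundary (a Jordan curve) and $\operatorname{inte}(X)=X\setminus\partial X$. A circular arc triangle is a closed Jordan region in $\widehat{\mathbb{C}}$ whose boundary is decomposed into three non-overlapping circular arcs (arcs of circles in $\widehat{\mathbb{C}}$, where lines together with $\infty$ count as circles), called its sides; the three endpoints of these arcs are its vertices. The vertices of $T_0$ are $\infty$, $i$, $\tfrac12(1+i\sqrt3)$ and those of $T_1$ are $\infty$, $-i$, $\tfrac12(1-i\sqrt3)$. A map $f$ is a conformal map between two circular arc triangles $X$ and $Y$ if it is a homeomorphism from $X$ onto $Y$ that sends the vertices of $X$ to the vertices of $Y$ and is a biholomorphism between $\operatorname{inte}(X)$ and $\operatorname{inte}(Y)$. The value $p(\infty)=\infty$ is understood in the limiting sense: $p(\tau)\to\infty$ as $\tau\in T_0\cap\mathbb{H}$ tends to $\infty$, and $p$ is thought of as extended to the point $\infty\in T_0$ in this way. *)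

(* Defs.v *)
From HB Require Import structures.
From mathcomp Require Import all_boot all_order all_algebra.
From mathcomp Require Import complex.
From mathcomp Require Import all_classical all_reals all_analysis.
From mathcomp Require summability.
Set Implicit Arguments.
Unset Strict Implicit.
Unset Printing Implicit Defensive.
Import Order.TTheory GRing.Theory Num.Theory.
Import numFieldNormedType.Exports.
Local Open Scope classical_set_scope.
Local Open Scope ring_scope.
Local Open Scope complex_scope.

(* The usual topology on R[i], which the library only gives to R[i]^o. *)
HB.instance Definition _ (R : realType) := NormedModule.copy R[i] R[i]^o.

(* The Riemann sphere. *)
Notation Chat R := (one_point_compactification R[i]).

Definition infty (R : realType) : Chat R := None.

Definition fin (R : realType) (z : R[i]) : Chat R := Some z.

Section Weierstrass.
Variable R : realType.
Local Notation C := R[i].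

Definition lattice (w1 w2 : C) : set C :=
  [set k%:~R * w1 + n%:~R * w2 | k in [set: int] & n in [set: int]].

(* [summability.sum] is the unordered sum, i.e., the limit of the finite partial
   sums along inclusion, and [f \_ A] is [f] on [A] and [0] elsewhere. *)
Definition weierstrass_zeta (G : set C) (u : C) : C :=
  u^-1 +
  summability.sum
    ((fun g : C => (u - g)^-1 + g^-1 + u / g ^+ 2) \_ (G `\ (0 : C))).

Definition quasi_period (G : set C) (w : C) : C :=
  get [set eta : C | forall u : C, ~ G u ->
    weierstrass_zeta G (u + w) = weierstrass_zeta G u + eta].

Definition quasi_period_ratio (w1 w2 : C) : Chat R :=
  let eta1 := quasi_period (lattice w1 w2) w1 in
  let eta2 := quasi_period (lattice w1 w2) w2 in
  if eta2 == 0 then infty R else fin (eta1 / eta2).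

Definition p (tau : C) : Chat R := quasi_period_ratio tau 1.

Definition p_ext (P : Chat R) : Chat R :=
  if P is Some tau then p tau else infty R.

End Weierstrass.

Section ComplexAnalysis.
Variable R : realType.
Local Notation C := R[i].

Definition upper_half_plane : set C := [set tau | 0 < complex.Im tau].

Definition finite_holomorphic_at (f : C -> Chat R) (z : C) :=
  exists2 g : C -> C, (\forall w \near z, derivable g w 1) &
                      (\forall w \near z, f w = fin (g w)).

Definition pole_at (f : C -> Chat R) (z : C) :=
  [/\ f z = infty R,
      (\forall w \near z^', finite_holomorphic_at f w) &
      f w @[w --> z^'] --> infty R].

Definition meromorphic_on (U : set C) (f : C -> Chat R) :=
  forall z, U z -> finite_holomorphic_at f z \/ pole_at f z.

(* The charts of the sphere: [z |-> z] near a finite point, [z |-> 1/z] near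
   infinity.  [chart_param P] maps [chart_center P] to [P] and [chart_coord P]
   is its inverse near [P]; its value at the one point outside the chart is
   irrelevant, because holomorphic maps are required to be continuous. *)
Definition chart_center (P : Chat R) : C := if P is Some z then z else 0.

Definition chart_param (P : Chat R) (w : C) : Chat R :=
  if P is Some _ then fin w else if w == 0 then infty R else fin w^-1.

Definition chart_coord (P Q : Chat R) : C :=
  if P is Some _ then (if Q is Some z then z else 0)
  else (if Q is Some z then z^-1 else 0).

Definition sphere_holomorphic_at (f : Chat R -> Chat R) (P : Chat R) :=
  {for P, continuous f} /\
  \forall w \near chart_center P,
    derivable (fun z : C => chart_coord (f P) (f (chart_param P z))) w 1.

Definition biholomorphism (U V : set (Chat R)) (f : Chat R -> Chat R) :=
  [/\ set_bij U V f,
      (forall P, U P -> sphere_holomorphic_at f P) &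
      exists2 g : Chat R -> Chat R, {in U, cancel f g} &
        forall Q, V Q -> sphere_holomorphic_at g Q].

End ComplexAnalysis.

Definition homeomorphism_between (T U : topologicalType) (A : set T) (B : set U)
    (f : T -> U) :=
  [/\ set_bij A B f, {within A, continuous f} &
      exists2 g : U -> T, {in A, cancel f g} & {within B, continuous g}].

Definition boundary (T : topologicalType) (A : set T) : set T :=
  closure A `\` interior A.

Section CircularArcTriangles.
Variable R : realType.
Local Notation C := R[i].

Definition circle_in_sphere (K : set (Chat R)) :=
  (exists (c : C) (r : R), 0 < r /\ K = @fin R @` [set z | `|z - c| = r%:C]) \/
  (exists a b : C, b != 0 /\
     K = [set fin (a + t%:C * b) | t in [set: R]] `|` [set infty R]).

Definition circular_arc (A : set (Chat R)) (a b : Chat R) :=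
  exists2 K, circle_in_sphere K &
  exists gamma : R -> Chat R,
    [/\ {within `[0, 1], continuous gamma}, set_inj `[0, 1] gamma,
        gamma 0 = a /\ gamma 1 = b, gamma @` `[0, 1] = A & A `<=` K].

Definition closed_Jordan_region (X : set (Chat R)) :=
  compact X /\
  exists h : C -> Chat R, homeomorphism_between [set z : C | `|z| <= 1] X h.

Definition inte (X : set (Chat R)) : set (Chat R) := X `\` boundary X.

Definition circular_arc_triangle (X V : set (Chat R)) :=
  closed_Jordan_region X /\
  exists v1 v2 v3 : Chat R, exists A12 A23 A31 : set (Chat R),
    [/\ V = [set v1; v2; v3],
        [/\ circular_arc A12 v1 v2, circular_arc A23 v2 v3 &
            circular_arc A31 v3 v1],
        [/\ A31 `&` A12 = [set v1], A12 `&` A23 = [set v2] &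
            A23 `&` A31 = [set v3]] &
        boundary X = A12 `|` A23 `|` A31].

(* [VX] and [VY] are the vertex sets of the triangles [X] and [Y]. *)
Definition conformal_map (X VX Y VY : set (Chat R))
    (f : Chat R -> Chat R) :=
  [/\ circular_arc_triangle X VX, circular_arc_triangle Y VY,
      homeomorphism_between X Y f, f @` VX = VY &
      biholomorphism (inte X) (inte Y) f].

Definition T0 : set (Chat R) :=
  @fin R @` [set tau : C | [/\ 0 <= complex.Re tau <= 2^-1,
                               0 < complex.Im tau & 1 <= `|tau|]]
  `|` [set infty R].

Definition T1 : set (Chat R) :=
  @fin R @` ([set tau : C | 0 <= complex.Re tau <= 2^-1] `\`
             [set tau : C | complex.Im tau < 0 /\ 1 < `|tau|])
  `|` [set infty R].

(* [x +i* y] and [x -i* y] are the constructors of [R[i]]. *)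
Definition iunit : C := 0 +i* 1.
Definition rho : C := 2^-1 * (1 +i* Num.sqrt 3).
Definition rho_conj : C := 2^-1 * (1 -i* Num.sqrt 3).

Definition vertices_T0 : set (Chat R) := [set infty R; fin iunit; fin rho].
Definition vertices_T1 : set (Chat R) := [set infty R; fin (- iunit); fin rho_conj].

End CircularArcTriangles.

(* Main.v *)
Require Import Defs.
From mathcomp Require Import all_boot all_order all_algebra.
From mathcomp Require Import complex.
From mathcomp Require Import all_classical all_reals all_analysis.
From mathcomp Require Import ring lra zify.
From mathcomp Require summability finmap.
Set Implicit Arguments.
Unset Strict Implicit.
Unset Printing Implicit Defensive.
Import Order.TTheory GRing.Theory Num.Theory.
Import numFieldNormedType.Exports.
Import Normc.
Local Open Scope classical_set_scope.
Local Open Scope ring_scope.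
Local Open Scope complex_scope.

(* Summing the series of the zeta function over rows by Eisenstein summation gives
   eta_2 = G2(tau) and eta_1 = tau G2(tau) - 2 pi i, hence p(tau) = tau - 2 pi i / G2(tau),
   where G2 = (pi^2 / 3) E2 has its q-expansion.  Homogeneity of zeta makes p
   equivariant under tau -> tau + 1 and tau -> - 1 / tau, and p(- conj tau) = - conj p(tau);
   this yields the values at i and rho and sends the sides of T0 into those of T1.
   On Im tau >= sqrt 3 / 2 the nome q has |q| <= |q(rho)| <= 1/217, and comparing the
   q-expansions at q and at q(rho) = - |q(rho)|, where p' vanishes, gives Re p' > 0
   elsewhere: so p is injective there.  The image of T0 is closed, and open off the
   boundary of T1, so it is T1.  Finally p is locally injective on Im tau >= sqrt 3 / 2
   except at rho + Z, where it is not real; the modular group carries this alternative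
   to the whole half plane, which isolates the poles. *)

(** The zero of [p'] at [rho] shapes the estimates. With [E2 = 1 - 24 S] and [D2 = q dS/dq],
    Ramanujan's identity says that [E2^2 + 288 D2] is the Eisenstein series E4; so [p' = E4 / E2^2],
    and E4 vanishes at the corner [rho] of [T0]. No positive constant bounds [Re p'] from below, and
    every error must be proportional to [a = Re q + |q(rho)|]. Real parts of [q^n] differ from their
    values at [q(rho)] by O(a), but imaginary parts are only O(sqrt a), so they may enter only
    through products of two. The half plane replaces [T0] because it is convex: positivity of
    [Re p'] separates the ends of a segment, and [T0] does not contain the segments between its
    points. Neither the exponential nor contour integration is used: [q] is a quotient formed from
    the cotangent series, its laws follow from a differential equation, and the square of pi is by
    definition six times the sum of [1/n^2]. Openness comes from minimising a distance. *)

Section ComplexBasics.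
Variable R : realType.
Local Notation C := R[i].
Local Notation Re := (@complex.Re R).
Local Notation Im := (@complex.Im R).
Implicit Types (x y z w : C) (r e : R).

(** * Complex numbers: coordinates, modulus, limits, derivatives *)

Lemma ReD x y : Re (x + y) = Re x + Re y. Proof. by case: x; case: y. Qed.
Lemma ImD x y : Im (x + y) = Im x + Im y. Proof. by case: x; case: y. Qed.
Lemma ReN x : Re (- x) = - Re x. Proof. by case: x. Qed.
Lemma ImN x : Im (- x) = - Im x. Proof. by case: x. Qed.
Lemma ReM x y : Re (x * y) = Re x * Re y - Im x * Im y.
Proof. by case: x; case: y. Qed.
Lemma ImM x y : Im (x * y) = Re x * Im y + Im x * Re y.
Proof. by case: x; case: y. Qed.
Lemma ReC r : Re r%:C = r. Proof. by []. Qed.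
Lemma ImC r : Im r%:C = 0. Proof. by []. Qed.
Lemma Re0 : Re 0 = 0. Proof. by []. Qed.
Lemma Im0 : Im 0 = 0. Proof. by []. Qed.
Lemma Re1 : Re 1 = 1. Proof. by []. Qed.
Lemma Im1 : Im 1 = 0. Proof. by []. Qed.
Lemma Rei : Re 'i%C = 0. Proof. by []. Qed.
Lemma Imi : Im 'i%C = 1. Proof. by []. Qed.
Lemma Re_nat n : Re n%:R = n%:R. Proof. by rewrite -[n%:R](rmorph_nat (real_complex R)). Qed.
Lemma Im_nat n : Im n%:R = 0. Proof. by rewrite -[n%:R](rmorph_nat (real_complex R)). Qed.
Lemma Re_int (n : int) : Re n%:~R = n%:~R. Proof. by rewrite -[n%:~R](rmorph_int (real_complex R)). Qed.
Lemma Im_int (n : int) : Im n%:~R = 0. Proof. by rewrite -[n%:~R](rmorph_int (real_complex R)). Qed.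
Lemma Re_conj z : Re (conjc z) = Re z. Proof. by case: z. Qed.
Lemma Im_conj z : Im (conjc z) = - Im z. Proof. by case: z. Qed.
(* The rules for [r%:C] come last: they would also match any [Re z] that reduces. *)
Definition cplxE := (ReD, ReN, ReM, Re0, Re1, Rei, Re_nat, Re_int, Re_conj,
  ImD, ImN, ImM, Im0, Im1, Imi, Im_nat, Im_int, Im_conj, ReC, ImC).

Lemma eqC x y : Re x = Re y -> Im x = Im y -> x = y.
Proof. by case: x; case: y => /= ? ? ? ? -> ->. Qed.

Lemma normcE z : `|z| = (normc z)%:C. Proof. by case: z. Qed.

Lemma normc_sqr z : normc z ^+ 2 = Re z ^+ 2 + Im z ^+ 2.
Proof. by case: z => a b /=; rewrite sqr_sqrtr // addr_ge0 ?sqr_ge0. Qed.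

Lemma normc_ge0 z : 0 <= normc z. Proof. by case: z => a b; apply: sqrtr_ge0. Qed.

Lemma normcN z : normc (- z) = normc z.
Proof. by case: z => a b /=; rewrite !sqrrN. Qed.

Lemma normcB x y : normc (x - y) = normc (y - x).
Proof. by rewrite -normcN opprB. Qed.

Lemma normcD x y : normc (x + y) <= normc x + normc y.
Proof.
rewrite -lecR; have := ler_normD x y.
by rewrite !normcE rmorphD.
Qed.

Lemma normc_real r : normc r%:C = `|r|.
Proof. by rewrite /= expr0n addr0 sqrtr_sqr. Qed.

Lemma normc_nat n : normc (n%:R : C) = n%:R.
Proof. by rewrite -(rmorph_nat (real_complex R)) normc_real ger0_norm. Qed.

Lemma normc_int (n : int) : normc (n%:~R : C) = `|n%:~R|.
Proof. by rewrite -(rmorph_int (real_complex R)) normc_real. Qed.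

Lemma normc_eq0 z : (normc z == 0) = (z == 0).
Proof. by apply/eqP/eqP => [/eq0_normc//|->]; rewrite normc0. Qed.

Lemma normc_gt0 z : (0 < normc z) = (z != 0).
Proof. by rewrite lt_def normc_eq0 normc_ge0 andbT. Qed.

Lemma normcX z n : normc (z ^+ n) = normc z ^+ n.
Proof. by elim: n => [|n IH]; rewrite ?expr0 ?normc1 // !exprS normcM IH. Qed.

Lemma normc_conj z : normc (conjc z) = normc z.
Proof. by case: z => a b /=; rewrite sqrrN. Qed.

Lemma normci : normc ('i%C : C) = 1.
Proof. by rewrite /= expr0n expr1n add0r sqrtr1. Qed.

Lemma ler_Re_normc z : `|Re z| <= normc z.
Proof.
rewrite -(ler_pXn2r (isT : (0 < 2)%N)) ?nnegrE ?normc_ge0 // normc_sqr real_normK ?num_real //.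
by rewrite lerDl sqr_ge0.
Qed.

Lemma ler_Im_normc z : `|Im z| <= normc z.
Proof.
rewrite -(ler_pXn2r (isT : (0 < 2)%N)) ?nnegrE ?normc_ge0 // normc_sqr real_normK ?num_real //.
by rewrite lerDr sqr_ge0.
Qed.

Lemma normc_le_ReIm z : normc z <= `|Re z| + `|Im z|.
Proof.
rewrite -(ler_pXn2r (isT : (0 < 2)%N)) ?nnegrE ?normc_ge0 ?addr_ge0 // normc_sqr sqrrD !real_normK ?num_real //.
by rewrite lerD2r lerDl mulrn_wge0 // mulr_ge0.
Qed.

Lemma ler_normcB x y : normc x - normc y <= normc (x - y).
Proof. by rewrite lerBlDr -{1}(subrK y x) normcD. Qed.

Lemma ler_normcD x y : normc x - normc y <= normc (x + y).
Proof. by rewrite -(normcN y) -{2}[y]opprK ler_normcB. Qed.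

Lemma conjcM x y : conjc (x * y) = conjc x * conjc y. Proof. exact: rmorphM. Qed.
Lemma conjcD x y : conjc (x + y) = conjc x + conjc y. Proof. exact: rmorphD. Qed.
Lemma conjcB x y : conjc (x - y) = conjc x - conjc y. Proof. exact: rmorphB. Qed.
Lemma conjcV x : conjc x^-1 = (conjc x)^-1. Proof. exact: conjc_inv. Qed.
Lemma conjcX x n : conjc (x ^+ n) = conjc x ^+ n. Proof. exact: rmorphXn. Qed.
Lemma mulcJ x : x * conjc x = (normc x ^+ 2)%:C.
Proof. by apply: eqC; rewrite !cplxE ?normc_sqr; ring. Qed.

(** The norm of [R[i]] takes values in [R[i]], where positive elements are real; so real [e] and the
    real modulus [normc] suffice. *)
Lemma cvgCP (T : Type) (F : set_system T) {FF : Filter F} (f : T -> C) (l : C) :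
  f t @[t --> F] --> l <-> forall e, 0 < e -> \forall t \near F, normc (l - f t) < e.
Proof.
rewrite cvgrPdist_lt; split=> H e e0.
  have := H e%:C; rewrite ltcR => /(_ e0); apply: filterS => t.
  by rewrite normcE ltcR.
move: e0; case: e => a b; rewrite ltcE /= => /andP[/eqP -> a0].
have := H a a0; apply: filterS => t.
by rewrite normcE -[_ +i* _]/(a%:C) ltcR.
Qed.

Lemma nbhsCP (z : C) (A : set C) :
  nbhs z A <-> exists2 e, 0 < e & forall w, normc (w - z) < e -> A w.
Proof.
split.
  move=> /nbhs_ballP[[a b]]; rewrite /= ltcE /= => /andP[/eqP -> a0] H.
  exists a => // w wz; apply: H.
  by rewrite /ball /= normcE normcB -[_ +i* _]/(a%:C) ltcR.
case=> e e0 H; apply/nbhs_ballP; exists e%:C; first by rewrite /= ltcR.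
by move=> w; rewrite /ball /= normcE normcB ltcR => /H.
Qed.

Lemma cvgC_nbhs (f : C -> C) z (l : C) : f w @[w --> z] --> l <->
  forall e, 0 < e -> exists2 d, 0 < d & forall w, normc (w - z) < d -> normc (l - f w) < e.
Proof.
have E := @cvgCP _ (nbhs z) (nbhs_filter z) f l; split=> [/E H|H]; [move=> e /H|apply/E => e /H].
  by move/nbhsCP.
by move=> H'; apply/nbhsCP.
Qed.

Lemma cvg_Re (T : Type) (F : set_system T) {FF : Filter F} (f : T -> C) (l : C) :
  f t @[t --> F] --> l -> Re (f t) @[t --> F] --> Re l.
Proof.
move/cvgCP => H; apply/cvgrPdist_lt => e /H; apply: filterS => t.
by apply: le_lt_trans; rewrite -ReN -ReD ler_Re_normc.
Qed.

Lemma cvg_Im (T : Type) (F : set_system T) {FF : Filter F} (f : T -> C) (l : C) :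
  f t @[t --> F] --> l -> Im (f t) @[t --> F] --> Im l.
Proof.
move/cvgCP => H; apply/cvgrPdist_lt => e /H; apply: filterS => t.
by apply: le_lt_trans; rewrite -ImN -ImD ler_Im_normc.
Qed.

Lemma cvg_normc (T : Type) (F : set_system T) {FF : Filter F} (f : T -> C) (l : C) :
  f t @[t --> F] --> l -> normc (f t) @[t --> F] --> normc l.
Proof.
move/cvgCP => H; apply/cvgrPdist_lt => e /H; apply: filterS => t.
apply: le_lt_trans; rewrite ler_norml ler_normcB andbT.
by rewrite lerNl opprB normcB ler_normcB.
Qed.

Lemma cvg_ReIm (T : Type) (F : set_system T) {FF : Filter F} (f : T -> C) (l : C) :
  Re (f t) @[t --> F] --> Re l -> Im (f t) @[t --> F] --> Im l ->
  f t @[t --> F] --> l.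
Proof.
move=> /cvgrPdist_lt H1 /cvgrPdist_lt H2; apply/cvgCP => e e0.
have e2 : 0 < e / 2 by rewrite divr_gt0.
near=> t; apply: le_lt_trans (normc_le_ReIm _) _.
rewrite !cplxE (splitr e) ltrD //; first by near: t; exact: H1.
by near: t; exact: H2.
Unshelve. all: by end_near. Qed.

Lemma cvg_complex (T : Type) (F : set_system T) {FF : Filter F} (f g : T -> R) (a b : R) :
  f t @[t --> F] --> a -> g t @[t --> F] --> b -> (f t +i* g t) @[t --> F] --> (a +i* b : C).
Proof. by move=> Ha Hb; apply: cvg_ReIm. Qed.

Lemma cvg_conj (T : Type) (F : set_system T) {FF : Filter F} (f : T -> C) (l : C) :
  f t @[t --> F] --> l -> conjc (f t) @[t --> F] --> conjc l.
Proof.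
move=> /cvgCP H; apply/cvgCP => e /H; apply: filterS => t.
by rewrite -conjcB normc_conj.
Qed.

Lemma cvgC_squeeze (T : Type) (F : set_system T) {FF : Filter F} (f : T -> C) (l : C) (g : T -> R) :
  (\forall t \near F, normc (f t - l) <= g t) -> g t @[t --> F] --> (0:R) ->
  f t @[t --> F] --> l.
Proof.
move=> H /cvgrPdist_lt H1; apply/cvgCP => e e0; near=> t.
rewrite normcB; apply: (@le_lt_trans _ _ (g t)); first by near: t.
apply: le_lt_trans (ler_norm _) _.
by rewrite -normrN -sub0r; near: t; exact: H1.
Unshelve. all: by end_near. Qed.

Lemma cvgC_unique (T : Type) (F : set_system T) (FF : ProperFilter F) (f : T -> C) (a b : C) :
  f t @[t --> F] --> a -> f t @[t --> F] --> b -> a = b.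
Proof. by apply: cvg_unique; exact: norm_hausdorff. Qed.

Lemma cvgC_ext (T : Type) (F : set_system T) (f g : T -> C) (l : C) :
  f =1 g -> g t @[t --> F] --> l -> f t @[t --> F] --> l.
Proof. by move=> /funext ->. Qed.

Lemma cvgC_cst (T : Type) (F : set_system T) {FF : Filter F} (a : C) : (fun=> a) t @[t --> F] --> a.
Proof. exact: cvg_cst. Qed.

Lemma cvgCD (T : Type) (F : set_system T) {FF : Filter F} (f g : T -> C) (a b : C) :
  f t @[t --> F] --> a -> g t @[t --> F] --> b -> (f t + g t) @[t --> F] --> a + b.
Proof. exact: cvgD. Qed.

Lemma cvgCN (T : Type) (F : set_system T) {FF : Filter F} (f : T -> C) (a : C) :
  f t @[t --> F] --> a -> (- f t) @[t --> F] --> - a.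
Proof. exact: cvgN. Qed.

Lemma cvgCB (T : Type) (F : set_system T) {FF : Filter F} (f g : T -> C) (a b : C) :
  f t @[t --> F] --> a -> g t @[t --> F] --> b -> (f t - g t) @[t --> F] --> a - b.
Proof. exact: cvgB. Qed.

Lemma cvgCM (T : Type) (F : set_system T) {FF : Filter F} (f g : T -> C) (a b : C) :
  f t @[t --> F] --> a -> g t @[t --> F] --> b -> (f t * g t) @[t --> F] --> a * b.
Proof. exact: cvgM. Qed.

Lemma cvgCV (T : Type) (F : set_system T) {FF : Filter F} (f : T -> C) (a : C) :
  a != 0 -> f t @[t --> F] --> a -> (f t)^-1 @[t --> F] --> a^-1.
Proof. exact: cvgV. Qed.

Lemma cauchyC_cvg (T : Type) (F : set_system T) {FF : ProperFilter F} (f : T -> C) :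
  (forall e, 0 < e -> exists2 A, F A & forall s t, A s -> A t -> normc (f s - f t) < e) ->
  exists l : C, f t @[t --> F] --> l.
Proof.
move=> H.
have key (g : T -> R) : (forall s t, `|g s - g t| <= normc (f s - f t)) ->
    exists a : R, g t @[t --> F] --> a.
  move=> Hg; suff /cvg_ex[a Ha] : cvg (g t @[t --> F]) by exists a.
  apply/cauchy_cvgP/cauchyP => e e0.
  have [A FA HA] := H _ e0.
  have [t0 At0] : exists t, A t by apply: filter_ex FA.
  exists (g t0); rewrite nbhs_simpl /=; apply: filterS FA => s As.
  by rewrite /ball /=; apply: le_lt_trans (Hg _ _) _; exact: HA.
have [a Ha] := key (fun t => Re (f t)) (fun s t => ltac:(by rewrite -ReN -ReD; apply: ler_Re_normc)).
have [b Hb] := key (fun t => Im (f t)) (fun s t => ltac:(by rewrite -ImN -ImD; apply: ler_Im_normc)).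
by exists (a +i* b); apply: cvg_ReIm.
Qed.

(** The derivative as a first-order expansion, without a quotient: [h = 0] needs no exception, and
    the product, chain and inverse rules become plain estimates. *)
Definition cder (f : C -> C) z (d : C) := forall e, 0 < e ->
  exists2 r, 0 < r & forall h, normc h < r -> normc (f (z + h) - f z - d * h) <= e * normc h.

Lemma cder_is_derive f z d : cder f z d -> is_derive z 1 f d.
Proof.
move=> H.
have L : h^-1 *: ((f \o shift z) (h *: 1) - f z) @[h --> 0^'] --> d.
  apply/cvgCP => e e0; have e2 : 0 < e / 2 by rewrite divr_gt0.
  have [r r0 Hr] := H _ e2; apply/nbhsCP; exists r => //= h.
  rewrite subr0 => hr h0; rewrite normcB.
  have h0' : 0 < normc h by rewrite normc_gt0.
  have -> : h^-1 *: (f (h *: 1 + z) - f z) - d = h^-1 * (f (z + h) - f z - d * h).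
    rewrite -[h^-1 *: _]/(h^-1 * _) -[h *: 1]/(h * 1) mulr1 (addrC h).
    by rewrite [in RHS]mulrBr [d * h]mulrC mulKf.
  rewrite normcM normcV.
  apply: le_lt_trans (_ : e / 2 < e); last by lra.
  by rewrite ler_pdivrMl // [normc h * _]mulrC; exact: Hr.
by apply: DeriveDef; [apply/cvg_ex; exists d|apply/cvg_lim => //; exact: norm_hausdorff].
Qed.

Lemma cder_continuous f z d : cder f z d -> f w @[w --> z] --> f z.
Proof.
move=> H; apply/cvgC_nbhs => e e0.
have [r r0 Hr] := H 1 ltr01.
have K0 : 0 < 1 + normc d by rewrite ltr_pwDl ?normc_ge0.
exists (Num.min r (e / (1 + normc d))); first by rewrite lt_min r0 divr_gt0.
move=> w; rewrite lt_min => /andP[/Hr]; rewrite [z + _]addrC subrK => H1.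
rewrite ltr_pdivlMr // => H2; rewrite normcB.
apply: le_lt_trans H2; rewrite -(subrK (d * (w - z)) (f w - f z)).
apply: le_trans (normcD _ _) _; rewrite normcM [X in _ <= X]mulrC mulrDl.
by rewrite lerD2r.
Qed.

Lemma cder_cst a z : cder (fun=> a) z 0.
Proof. by move=> e e0; exists 1 => // h _; rewrite subrr mul0r subrr normc0 mulr_ge0 ?normc_ge0 // ltW. Qed.

Lemma cder_id z : cder id z 1.
Proof. move=> e e0; exists 1 => // h _; rewrite (_ : _ - _ - _ = 0) ?normc0 ?mulr_ge0 ?normc_ge0 ?(ltW e0) //; ring. Qed.

Lemma cderD f g z a b : cder f z a -> cder g z b -> cder (fun w => f w + g w) z (a + b).
Proof.
move=> Hf Hg e e0; have e2 : 0 < e / 2 by rewrite divr_gt0.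
have [r r0 Hr] := Hf _ e2; have [s s0 Hs] := Hg _ e2.
exists (Num.min r s); first by rewrite lt_min r0.
move=> h; rewrite lt_min => /andP[/Hr H1 /Hs H2].
have -> : f (z + h) + g (z + h) - (f z + g z) - (a + b) * h =
  (f (z + h) - f z - a * h) + (g (z + h) - g z - b * h) by ring.
apply: le_trans (normcD _ _) _; rewrite (splitr e) mulrDl.
by rewrite lerD.
Qed.

Lemma cderM f g z a b : cder f z a -> cder g z b -> cder (fun w => f w * g w) z (a * g z + f z * b).
Proof.
move=> Hf Hg e e0.
set K := 1 + normc (g z) + normc (f z) + normc a.
have K0 : 0 < K by rewrite /K; have := normc_ge0 (g z); have := normc_ge0 (f z); have := normc_ge0 a; lra.
have e2 : 0 < e / (3 * K) by rewrite divr_gt0 // mulr_gt0.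
have [r r0 Hr] := Hf _ e2; have [s s0 Hs] := Hg _ e2.
have /cvgC_nbhs/(_ (Num.min 1 (e / (3 * K)))) := cder_continuous Hg.
rewrite lt_min ltr01 e2 => /(_ isT)[t t0 Ht].
exists (Num.min r (Num.min s t)); first by rewrite !lt_min r0 s0.
move=> h; rewrite !lt_min => /and3P[/Hr H1 /Hs H2 ht].
have := Ht (z + h); rewrite addrAC subrr add0r => /(_ ht).
rewrite normcB lt_min => /andP[H3 H4].
have -> : f (z + h) * g (z + h) - f z * g z - (a * g z + f z * b) * h =
  (f (z + h) - f z - a * h) * g (z + h) + f z * (g (z + h) - g z - b * h) + a * (g (z + h) - g z) * h by ring.
have G : normc (g (z + h)) <= K.
  rewrite -(subrK (g z) (g (z + h))); apply: le_trans (normcD _ _) _.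
  by rewrite /K; have := normc_ge0 (f z); have := normc_ge0 a; move: (ltW H3); lra.
apply: le_trans (normcD _ _) _.
have F1 : normc (f z) <= K by rewrite /K; have := normc_ge0 (g z); have := normc_ge0 a; lra.
have A1 : normc a <= K by rewrite /K; have := normc_ge0 (g z); have := normc_ge0 (f z); lra.
have E : e * normc h = (e / (3 * K) * normc h) * K + K * (e / (3 * K) * normc h) + K * (e / (3 * K)) * normc h.
  by field; rewrite gt_eqF.
rewrite E; apply: lerD.
  apply: le_trans (normcD _ _) _; rewrite !normcM; apply: lerD; apply: ler_pM; rewrite ?normc_ge0 //.
rewrite !normcM ler_wpM2r ?normc_ge0 // ler_pM ?normc_ge0 // ltW //.
Qed.

Lemma cder_comp f g z a b : cder f (g z) a -> cder g z b -> cder (fun w => f (g w)) z (a * b).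
Proof.
move=> Hf Hg e e0.
have Kb : 0 < 1 + normc b by rewrite ltr_pwDl ?normc_ge0.
have Ka : 0 < 1 + normc a by rewrite ltr_pwDl ?normc_ge0.
have ef : 0 < e / (2 * (1 + normc b)) by rewrite divr_gt0 // mulr_gt0.
have eg : 0 < Num.min 1 (e / (2 * (1 + normc a))) by rewrite lt_min ltr01 divr_gt0 // mulr_gt0.
have [r r0 Hr] := Hf _ ef; have [s s0 Hs] := Hg _ eg.
exists (Num.min s (r / (1 + normc b))); first by rewrite lt_min s0 divr_gt0.
move=> h; rewrite lt_min ltr_pdivlMr // => /andP[/Hs H1 hr].
have H2 : normc (g (z + h) - g z) <= (1 + normc b) * normc h.
  rewrite -(subrK (b * h) (g (z + h) - g z)); apply: le_trans (normcD _ _) _.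
  rewrite normcM mulrDl lerD2r; apply: le_trans H1 _.
  by rewrite ler_wpM2r ?normc_ge0 // ge_min lexx.
have := Hr (g (z + h) - g z); rewrite [g z + _]addrC subrK.
move=> /(_ (le_lt_trans H2 _)); rewrite mulrC => /(_ hr) H3.
have -> : f (g (z + h)) - f (g z) - a * b * h =
  (f (g (z + h)) - f (g z) - a * (g (z + h) - g z)) + a * (g (z + h) - g z - b * h) by ring.
apply: le_trans (normcD _ _) _; rewrite (splitr e) mulrDl lerD //.
  apply: le_trans H3 _.
  apply: (@le_trans _ _ (e / (2 * (1 + normc b)) * ((1 + normc b) * normc h))).
    by rewrite ler_wpM2l // ltW.
  by rewrite le_eqVlt; apply/orP; left; apply/eqP; field; rewrite gt_eqF.
rewrite normcM; apply: (@le_trans _ _ ((1 + normc a) * (e / (2 * (1 + normc a)) * normc h))).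
  apply: ler_pM; rewrite ?normc_ge0 //; first by rewrite lerDr.
  by apply: le_trans H1 _; rewrite ler_wpM2r ?normc_ge0 // ge_min lexx orbT.
by rewrite le_eqVlt; apply/orP; left; apply/eqP; field; rewrite gt_eqF.
Qed.

Lemma cder_inv z : z != 0 -> cder (fun w => w^-1) z (- (z ^- 2)).
Proof.
move=> z0 e e0; have nz : 0 < normc z by rewrite normc_gt0.
exists (Num.min (normc z / 2) (e * normc z ^+ 3 / 2)).
  by rewrite lt_min !divr_gt0 // mulr_gt0 // exprn_gt0.
move=> h; rewrite lt_min => /andP[H1 H2].
have H3 : normc z / 2 <= normc (z + h).
  by have := ler_normcD z h; move: H1; lra.
have zh : z + h != 0 by rewrite -normc_gt0; apply: lt_le_trans H3; rewrite divr_gt0.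
have -> : (z + h)^-1 - z^-1 - - z ^- 2 * h = h * (h / (z ^+ 2 * (z + h))).
  by field; rewrite zh z0.
rewrite normcM mulrC ler_wpM2r ?normc_ge0 // normcM normcV normcM normcX.
rewrite ler_pdivrMr ?mulr_gt0 ?exprn_gt0 //; last by rewrite normc_gt0.
apply: ltW; apply: lt_le_trans H2 _.
have -> : e * normc z ^+ 3 / 2 = e * (normc z ^+ 2 * (normc z / 2)) by field.
by rewrite ler_wpM2l ?(ltW e0) // ler_wpM2l ?exprn_ge0 ?normc_ge0.
Qed.

Lemma cder_ext f g z a b : (\forall w \near z, f w = g w) -> a = b -> cder f z a -> cder g z b.
Proof.
move=> /nbhsCP[d d0 Hd] <- Hf e /Hf[r r0 Hr]; exists (Num.min d r); first by rewrite lt_min d0.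
move=> h; rewrite lt_min => /andP[hd /Hr].
rewrite !Hd //; first by rewrite subrr normc0.
by rewrite addrAC subrr add0r.
Qed.

Lemma cder_unique f z a b : cder f z a -> cder f z b -> a = b.
Proof. by move=> /cder_is_derive Ha /cder_is_derive Hb; rewrite -(@derive_val _ _ _ _ _ _ _ Ha) (@derive_val _ _ _ _ _ _ _ Hb). Qed.

(** Makes the real mean value theorem available for real parts along a segment. *)
Lemma is_derive_line f z w d (t : R) : cder f (z + t%:C * w) d ->
  is_derive t 1 (fun s : R => Re (f (z + s%:C * w))) (Re (d * w)).
Proof.
move=> H.
have L : h^-1 *: (((fun s : R => Re (f (z + s%:C * w))) \o shift t) (h *: 1) - Re (f (z + t%:C * w))) @[h --> (0:R)^'] --> Re (d * w).
  apply/cvgrPdist_lt => e e0.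
  have K0 : 0 < 1 + normc w by rewrite ltr_pwDl ?normc_ge0.
  have e2 : 0 < e / (1 + normc w) / 2 by rewrite !divr_gt0.
  have [r r0 Hr] := H _ e2; rewrite near_withinE; near=> h => h0 /=.
  have hr : normc (h%:C * w) < r.
    rewrite normcM normc_real; apply: (@le_lt_trans _ _ (`|h| * (1 + normc w))).
      by rewrite ler_wpM2l // lerDr.
    rewrite -ltr_pdivlMr // -[h]subr0 distrC; near: h.
    by apply: (@cvgr_dist_lt _ _ _ _ _ id (0:R)); [exact: cvg_id|rewrite divr_gt0].
  have E : z + t%:C * w + h%:C * w = z + (t + h)%:C * w by rewrite rmorphD mulrDl addrA.
  have := Hr _ hr; rewrite E => H1.
  rewrite -[h *: 1]/(h * 1) mulr1 (addrC h) -[_ *: _]/(_ * _).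
  have h0' : 0 < `|h| by rewrite normr_gt0.
  rewrite -(ltr_pM2l h0') -normrM mulrBr mulrA divff // mul1r.
  have -> : h * Re (d * w) - (Re (f (z + (t + h)%:C * w)) - Re (f (z + t%:C * w))) =
     - Re (f (z + (t + h)%:C * w) - f (z + t%:C * w) - d * (h%:C * w)).
    by rewrite !cplxE; ring.
  rewrite normrN; apply: le_lt_trans (ler_Re_normc _) _; apply: le_lt_trans H1 _.
  rewrite normcM normc_real mulrCA ltr_pM2l //.
  apply: (@le_lt_trans _ _ (e / (1 + normc w) / 2 * (1 + normc w))).
    by rewrite ler_wpM2l ?(ltW e2) // lerDr.
  have -> : e / (1 + normc w) / 2 * (1 + normc w) = e / 2 by field; rewrite gt_eqF.
  by lra.
by apply: DeriveDef; [apply/cvg_ex; eexists; exact: L|apply/cvg_lim].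
Unshelve. all: by end_near. Qed.

Lemma cder0_const f z w : (forall t : R, 0 < t < 1 -> cder f (z + t%:C * w) 0) ->
  forall s t : R, 0 < s < 1 -> 0 < t < 1 -> f (z + s%:C * w) = f (z + t%:C * w).
Proof.
move=> H.
(* The factor [c] lets one argument on real parts serve both coordinates: [c = 1] and [c = -i]. *)
have key (c : C) (s t : R) : 0 < s < 1 -> 0 < t < 1 -> s < t -> Re (c * f (z + s%:C * w)) = Re (c * f (z + t%:C * w)).
  move=> Hs Ht st.
  have D (x : R) : 0 < x < 1 -> is_derive x 1 (fun s : R => Re (c * f (z + s%:C * w))) 0.
    move=> /H Hx; rewrite -[X in is_derive _ _ _ X]/(Re (0 : C)) -(mul0r w).
    apply: (@is_derive_line (fun y => c * f y)).
    by apply: cder_ext (cderM (cder_cst c _) Hx); [near=> y; reflexivity|rewrite mulr0 mul0r addr0].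
  have [||x _ Hx] := @MVT R (fun s : R => Re (c * f (z + s%:C * w))) (fun=> 0) _ _ st.
  - move=> x; rewrite in_itv /= => /andP[sx xt]; apply: D; lra.
  - apply: derivable_within_continuous => x; rewrite in_itv /= => /andP[sx xt].
    by have Dx : 0 < x < 1 by [lra]; have [] := D x Dx.
  - by move: Hx; rewrite mul0r => /eqP; rewrite subr_eq0 => /eqP.
have key2 (s t : R) : 0 < s < 1 -> 0 < t < 1 -> s < t -> f (z + s%:C * w) = f (z + t%:C * w).
  move=> Hs Ht st; apply: eqC; first by have := key 1 _ _ Hs Ht st; rewrite !mul1r.
  by have := key (-'i%C) _ _ Hs Ht st; rewrite !cplxE oppr0 !mul0r !mulN1r !opprK !add0r.
move=> s t Hs Ht; have [st|ts|->//] := ltgtP s t; first exact: key2.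
by apply/esym/key2.
Unshelve. all: by end_near. Qed.

End ComplexBasics.

(** * Symmetric sums and the cotangent series *)

Section SymmetricSums.

(** The sum over [-N <= n <= N]. The symmetric truncation is what makes the conditionally convergent
    series below converge. *)
Definition zsum (V : nmodType) (F : int -> V) (N : nat) : V :=
  \sum_(i < N.*2.+1) F (i%:Z - N%:Z).

Lemma zsum0 (V : nmodType) (F : int -> V) : zsum F 0 = F 0.
Proof. by rewrite /zsum big_ord1. Qed.

Lemma zsumS (V : nmodType) (F : int -> V) N :
  zsum F N.+1 = zsum F N + (F N.+1%:Z + F (- N.+1%:Z)).
Proof.
rewrite /zsum doubleS big_ord_recl big_ord_recr /= addrC -addrA. apply: (congr2 +%R); last apply: (congr2 +%R).
- by apply: eq_bigr => i _; congr F; rewrite /bump /=; lia.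
- by congr F; rewrite /bump /=; lia.
- by congr F; lia.
Qed.

Lemma zsumE (V : nmodType) (F : int -> V) N :
  zsum F N = F 0 + \sum_(n < N) (F n.+1%:Z + F (- n.+1%:Z)).
Proof.
elim: N => [|N IH]; first by rewrite zsum0 big_ord0 addr0.
by rewrite zsumS IH big_ord_recr /= -[LHS]addrA.
Qed.

Lemma eq_zsum (V : nmodType) (F G : int -> V) N : F =1 G -> zsum F N = zsum G N.
Proof. by move=> E; apply: eq_bigr. Qed.

Lemma zsumD (V : nmodType) (F G : int -> V) N :
  zsum (fun n => F n + G n) N = zsum F N + zsum G N.
Proof. exact: big_split. Qed.

Lemma zsumN (V : zmodType) (F : int -> V) N : zsum (fun n => - F n) N = - zsum F N.
Proof. exact: sumrN. Qed.

Lemma zsumZ (K : pzRingType) (a : K) (F : int -> K) N :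
  zsum (fun n => a * F n) N = a * zsum F N.
Proof. by rewrite /zsum mulr_sumr. Qed.

Lemma zsum_opp (V : nmodType) (F : int -> V) N : zsum (fun n => F (- n)) N = zsum F N.
Proof.
elim: N => [|N IH]; first by rewrite !zsum0 oppr0.
by rewrite !zsumS IH opprK [F N.+1%:Z + _]addrC.
Qed.

(** Shifting the window costs only two end terms. Their limits give the periodicity of [ct], and the
    term [2 * iPi] in [zetatau]. *)
Lemma zsum_shift (V : zmodType) (F : int -> V) N :
  zsum (fun n => F (n + 1)) N = zsum F N + F (N%:Z + 1) - F (- N%:Z).
Proof.
elim: N => [|N IH]; first by rewrite !zsum0 oppr0 add0r addrAC subrr add0r.
rewrite !zsumS IH -!addrA; congr (_ + _).
have -> : - N.+1%:Z + 1 = - N%:Z by lia.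
have -> : N%:Z + 1 = N.+1%:Z by lia.
by rewrite !addrA [LHS]addrAC addrNK [in RHS](addrAC _ _ (F (N.+1%:Z + 1))) addrK.
Qed.

Lemma ler_zsum (K : numDomainType) (F G : int -> K) N :
  (forall n : int, (`|n| <= N)%N -> F n <= G n) -> zsum F N <= zsum G N.
Proof. by move=> H; apply: ler_sum => i _; apply: H; have := ltn_ord i; lia. Qed.

Lemma raddf_zsum (U V : nmodType) (f : {additive U -> V}) (F : int -> U) N :
  f (zsum F N) = zsum (fun n => f (F n)) N.
Proof. exact: raddf_sum. Qed.

(** The hypothesis is the partial fraction identity of [f n = 1 / (z - a n)]. Exchanging [i] and [j]
    merges the two halves of the off-diagonal sum, whence the factor 2; the term [m = n] of the
    inner sum is 0 because [0^-1 = 0]. *)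
Lemma zsum_sqr (K : fieldType) (a f : int -> K) N :
  (forall i j, i != j -> f i * f j = (f i - f j) * (a i - a j)^-1) ->
  zsum f N ^+ 2 = zsum (fun n => f n ^+ 2) N
    + 2 * zsum (fun n => f n * zsum (fun m => (a n - a m)^-1) N) N.
Proof.
move=> H.
have E i j : f i * f j = (if i == j then f i ^+ 2 else 0) + (f i - f j) * (a i - a j)^-1.
  have [->|ij] := eqVneq i j; first by rewrite !subrr mul0r addr0.
  by rewrite add0r H.
rewrite expr2 /zsum big_distrl /=.
under eq_bigr => i _ do rewrite big_distrr /=.
under eq_bigr => i _ do under eq_bigr => j _ do rewrite E mulrBl.
under eq_bigr => i _ do rewrite big_split /= sumrB.
rewrite big_split /= sumrB; congr (_ + _).
  apply: eq_bigr => i _; rewrite (bigD1 i) //= eqxx big1 ?addr0 // => j ji.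
  rewrite ifF //; apply/eqP => /addIr[] /val_inj ij.
  by rewrite ij eqxx in ji.
rewrite [X in _ - X]exchange_big /= mulr2n mulrDl !mul1r -sumrN.
congr (_ + _); apply: eq_bigr => i _; rewrite big_distrr //= -sumrN.
by apply: eq_bigr => j _; rewrite -mulrN -(invrN (a _ - a _)) opprB.
Qed.

End SymmetricSums.

Section Bounds.
Variable R : realType.

(** Telescoping, from [1 / (n + 1)^2 <= 1 / n - 1 / (n + 1)]. *)
Lemma sum_sqinv (M N : nat) : (0 < M <= N)%N ->
  \sum_(M <= n < N) (n.+1%:R ^- 2 : R) <= M%:R^-1 - N%:R^-1.
Proof.
case/andP=> M0; elim: N => [|N IH]; first by rewrite leqn0 => /eqP E; rewrite E in M0.
rewrite leq_eqVlt => /orP[/eqP ->|]; first by rewrite big_geq ?subrr.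
rewrite ltnS => MN; rewrite big_nat_recr //=.
have N0 : (0 : R) < N%:R by rewrite ltr0n (leq_trans M0).
have N1 : (N.+1%:R : R) = N%:R + 1 by rewrite -natr1.
have : (N.+1%:R ^- 2 : R) <= N%:R^-1 - N.+1%:R^-1.
  rewrite N1 -subr_ge0.
  have -> : N%:R^-1 - (N%:R + 1)^-1 - (N%:R + 1) ^- 2 = N%:R^-1 * (N%:R + 1) ^- 2 :> R.
    by field; rewrite !gt_eqF //; lra.
  by rewrite mulr_ge0 ?invr_ge0 ?exprn_ge0 //; lra.
by move=> H; apply: le_trans (lerD (IH MN) H) _; rewrite addrA subrK.
Qed.

Lemma sum_sqinv2 (N : nat) : \sum_(n < N) (n.+1%:R ^- 2 : R) <= 2.
Proof.
case: N => [|N]; first by rewrite big_ord0.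
rewrite big_ord_recl expr1n invr1.
have -> : \sum_(i < N) (lift ord0 i).+1%:R ^- 2 = \sum_(1 <= n < N.+1) (n.+1%:R ^- 2 : R).
  by rewrite big_add1 big_mkord /=; apply: eq_bigr.
have := @sum_sqinv 1 N.+1 isT; have : 0 <= (N.+1%:R^-1 : R) by rewrite invr_ge0.
by rewrite invr1; move: (\sum_(_ <= _ < _) _) (N.+1%:R^-1) => a b; lra.
Qed.

Lemma sum_sqinv_ge0 (N : nat) : 0 <= \sum_(n < N) (n.+1%:R ^- 2 : R).
Proof. by apply: sumr_ge0 => n _; rewrite invr_ge0 exprn_ge0. Qed.

Lemma cvg_invSn (a : R) : (a / n.+1%:R)@[n --> \oo] --> (0 : R).
Proof. by rewrite -(mulr0 a); apply: cvgM; [exact: cvg_cst|exact: cvg_harmonic]. Qed.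

Local Notation C := R[i].

Lemma normc_sum (I : Type) (r : seq I) (P : pred I) (f : I -> C) :
  normc (\sum_(i <- r | P i) f i) <= \sum_(i <- r | P i) normc (f i).
Proof.
elim/big_rec2: _ => [|n x y _ IH]; first by rewrite normc0.
by apply: le_trans (normcD _ _) _; rewrite lerD2l.
Qed.

Lemma cvg_sum_sqinv (f : nat -> C) (A : R) (n0 : nat) :
  (forall n, (n0 <= n)%N -> normc (f n) <= A * n.+1%:R ^- 2) ->
  exists l : C, (\sum_(n < N) f n)@[N --> \oo] --> l.
Proof.
move=> H; apply: cauchyC_cvg => e e0.
have A0 : 0 <= A.
  have := le_trans (normc_ge0 _) (H n0 (leqnn _)).
  by rewrite pmulr_lge0 // invr_gt0 exprn_gt0 // ltr0n.
move/cvgrPdist_lt: (cvg_invSn A) => /(_ _ e0)[M0 _ HM].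
have key (s t : nat) : ((maxn n0 M0).+1 <= s <= t)%N ->
    normc (\sum_(n < s) f n - \sum_(n < t) f n) < e.
  case/andP=> Ms st.
  have s0 : (0 < s)%N by apply: leq_trans Ms.
  have -> : \sum_(n < s) f n - \sum_(n < t) f n = - \sum_(s <= n < t) f n.
    by rewrite -!(big_mkord xpredT f) (@big_cat_nat _ _ _ s 0 t) //= opprD addNKr.
  rewrite normcN; apply: (@le_lt_trans _ _ (A * (s%:R^-1 - t%:R^-1))).
    apply: (@le_trans _ _ (A * \sum_(s <= n < t) n.+1%:R ^- 2)); last first.
      by rewrite ler_wpM2l // sum_sqinv // s0.
    rewrite big_distrr /=; apply: le_trans (normc_sum _ _ _) _.
    apply: ler_sum_nat => n /andP[sn _].
    by apply: H; apply: leq_trans sn; apply: leq_trans (ltnW Ms); rewrite leq_maxl.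
  have /HM : (M0 <= s.-1)%N by rewrite -ltnS prednK //; apply: leq_trans Ms; rewrite ltnS leq_maxr.
  rewrite /= sub0r normrN prednK // => /(le_lt_trans (ler_norm _)); apply: le_lt_trans.
  by rewrite ler_wpM2l // gerBl invr_ge0.
exists [set N | ((maxn n0 M0).+1 <= N)%N]; first by exists (maxn n0 M0).+1.
move=> s t /= Hs Ht; have [st|ts] := leqP s t; first by apply: key; rewrite Hs.
by rewrite normcB; apply: key; rewrite Ht ltnW.
Qed.

Lemma normc_zsum (F : int -> C) N : normc (zsum F N) <= zsum (fun n => normc (F n)) N.
Proof. exact: normc_sum. Qed.

(** The limits [ct] and [cs] are pi cot(pi z) and pi^2 / sin(pi z)^2. Since [0^-1 = 0], the singular
    term is dropped at an integer; in particular [cs 0] is twice the sum of [1/n^2], that is pi^2 /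
    3. *)
Definition ctN (z : C) N : C := zsum (fun n : int => (z - n%:~R)^-1) N.
Definition csN (z : C) N : C := zsum (fun n : int => (z - n%:~R) ^- 2) N.
Definition ct (z : C) : C := lim (ctN z @ \oo).
Definition cs (z : C) : C := lim (csN z @ \oo).

Lemma tail_bounds (z : C) (n : nat) : 2 * normc z <= n.+1%:R ->
  [/\ z - n.+1%:~R != 0, z + n.+1%:~R != 0,
      n.+1%:R / 2 <= normc (z - n.+1%:~R) & n.+1%:R / 2 <= normc (z + n.+1%:~R)].
Proof.
move=> H; have n0 : (0 : R) < n.+1%:R by rewrite ltr0n.
have A : n.+1%:R / 2 <= normc (z - n.+1%:~R).
  by rewrite normcB; have := ler_normcB (n.+1%:~R : C) z; rewrite normc_nat; lra.
have B : n.+1%:R / 2 <= normc (z + n.+1%:~R).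
  by rewrite addrC; have := ler_normcD (n.+1%:~R : C) z; rewrite normc_nat; lra.
split => //; rewrite -normc_gt0; [apply: lt_le_trans A|apply: lt_le_trans B]; lra.
Qed.

(** Only the pairs [n], [-n] are summable: they contribute [2 z / (z^2 - n^2)], of size [1/n^2].
    Both factors of the denominator have modulus at least [n / 2] in the tail, whence the constant
    8. *)
Lemma ctN_cvg z : ctN z @ \oo --> ct z.
Proof.
suff [l Hl] : exists l : C, ctN z N @[N --> \oo] --> l.
  by rewrite /ct (@cvg_lim _ _ _ _ _ _ _ Hl) //; exact: norm_hausdorff.
have [l Hl] : exists l : C, (\sum_(n < N) ((z - n.+1%:~R)^-1 + (z - (- n.+1%:Z)%:~R)^-1)) @[N --> \oo] --> l.
  apply: (@cvg_sum_sqinv (fun n => (z - n.+1%:~R)^-1 + (z - (- n.+1%:Z)%:~R)^-1) (8 * normc z) (Num.Def.archi_bound (2 * normc z))) => n Hn.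
  have H : 2 * normc z <= n.+1%:R.
    have := archi_boundP (mulr_ge0 (ler0n R 2) (normc_ge0 z)) => /ltW/le_trans; apply.
    by rewrite ler_nat (leq_trans Hn).
  have [A0 B0 A B] := tail_bounds H; have n0 : (0 : R) < n.+1%:R by rewrite ltr0n.
  rewrite mulrNz opprK.
  have -> : (z - n.+1%:~R)^-1 + (z + n.+1%:~R)^-1 = (2 * z) / ((z - n.+1%:~R) * (z + n.+1%:~R)).
    by move: (n.+1%:~R) A0 B0 => m A0 B0; field; rewrite A0 B0.
  rewrite normcM normcV !normcM normc_nat.
  rewrite ler_pdivrMr ?mulr_gt0 ?normc_gt0 //.
  have -> : 2 * normc z = 8 * normc z / n.+1%:R ^+ 2 * (n.+1%:R / 2 * (n.+1%:R / 2)).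
    by field; rewrite gt_eqF.
  apply: ler_wpM2l; first by rewrite !mulr_ge0 ?normc_ge0 ?invr_ge0 ?exprn_ge0.
  by apply: ler_pM => //; lra.
exists ((z - 0%:~R)^-1 + l).
apply: cvgC_ext (fun N => zsumE _ N) _.
by apply: cvgCD; [exact: cvgC_cst|exact: Hl].
Qed.

Lemma csN_cvg z : csN z @ \oo --> cs z.
Proof.
suff [l Hl] : exists l : C, csN z N @[N --> \oo] --> l.
  by rewrite /cs (@cvg_lim _ _ _ _ _ _ _ Hl) //; exact: norm_hausdorff.
have [l Hl] : exists l : C, (\sum_(n < N) ((z - n.+1%:~R) ^- 2 + (z - (- n.+1%:Z)%:~R) ^- 2)) @[N --> \oo] --> l.
  apply: (@cvg_sum_sqinv (fun n => (z - n.+1%:~R) ^- 2 + (z - (- n.+1%:Z)%:~R) ^- 2) 8 (Num.Def.archi_bound (2 * normc z))) => n Hn.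
  have H : 2 * normc z <= n.+1%:R.
    have := archi_boundP (mulr_ge0 (ler0n R 2) (normc_ge0 z)) => /ltW/le_trans; apply.
    by rewrite ler_nat (leq_trans Hn).
  have [A0 B0 A B] := tail_bounds H; have n0 : (0 : R) < n.+1%:R by rewrite ltr0n.
  rewrite mulrNz opprK.
  have E : 8 * n.+1%:R ^- 2 = (n.+1%:R / 2) ^- 2 + (n.+1%:R / 2) ^- 2 :> R by field; rewrite gt_eqF.
  rewrite E; apply: le_trans (normcD _ _) _; rewrite !normcV !normcX.
  by apply: lerD; rewrite lef_pV2 ?posrE ?exprn_gt0 ?normc_gt0 ?divr_gt0 // ler_pXn2r // nnegrE ?normc_ge0 ?divr_ge0 // ltW.
exists ((z - 0%:~R) ^- 2 + l).
apply: cvgC_ext (fun N => zsumE _ N) _.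
by apply: cvgCD; [exact: cvgC_cst|exact: Hl].
Qed.

Lemma ctN_opp z N : ctN (- z) N = - ctN z N.
Proof.
rewrite /ctN -zsumN -[RHS]zsum_opp; apply: eq_zsum => n.
by rewrite mulrNz opprK -invrN opprD.
Qed.

Lemma csN_opp z N : csN (- z) N = csN z N.
Proof.
rewrite /csN -[RHS]zsum_opp; apply: eq_zsum => n.
by rewrite mulrNz opprK -opprD sqrrN.
Qed.

Lemma ct_opp z : ct (- z) = - ct z.
Proof.
apply: (cvgC_unique _ (@ctN_cvg (- z))).
apply: cvgC_ext (ctN_opp z) _.
by apply: cvgCN; exact: ctN_cvg.
Qed.

Lemma cs_opp z : cs (- z) = cs z.
Proof.
apply: (cvgC_unique _ (@csN_cvg (- z))).
apply: cvgC_ext (csN_opp z) _.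
exact: csN_cvg.
Qed.

Lemma cvg_invz (z : C) : ((z + N%:R)^-1)@[N --> \oo] --> (0 : C).
Proof.
apply: (@cvgC_squeeze _ _ _ _ _ _ (fun N => 2 / N.+1%:R)); last exact: cvg_invSn.
exists (Num.Def.archi_bound (2 * normc z + 1)).+1 => // N /= HN.
have N0 : (0 : R) < N.+1%:R by rewrite ltr0n.
have H : 2 * normc z + 1 <= N%:R.
  have := @archi_boundP _ (2 * normc z + 1); rewrite addr_ge0 ?mulr_ge0 ?normc_ge0 // => /(_ isT)/ltW/le_trans; apply.
  by rewrite ler_nat ltnW.
have N1 : (N.+1%:R : R) = N%:R + 1 by rewrite -natr1.
have A : N.+1%:R / 2 <= normc (z + N%:R).
  by have := ler_normcD (N%:R : C) z; rewrite [z + _]addrC normc_nat N1; lra.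
rewrite subr0 normcV -[2 / _]invrK lef_pV2 ?posrE ?invf_div ?divr_gt0 //.
by apply: lt_le_trans A; rewrite divr_gt0.
Qed.

Lemma ctNE z N : ctN z N = zsum (fun n : int => (z + n%:~R)^-1) N.
Proof. by rewrite /ctN -zsum_opp; apply: eq_zsum => n; rewrite mulrNz opprK. Qed.

Lemma csNE z N : csN z N = zsum (fun n : int => (z + n%:~R) ^- 2) N.
Proof. by rewrite /csN -zsum_opp; apply: eq_zsum => n; rewrite mulrNz opprK. Qed.

Lemma ctN1 (z : C) N : ctN (z + 1) N = ctN z N + (z + 1 + N%:R)^-1 + (- z + N%:R)^-1.
Proof.
rewrite !ctNE; have := zsum_shift (fun n : int => (z + n%:~R)^-1) N.
have -> : zsum (fun n : int => (z + (n + 1)%:~R)^-1) N = zsum (fun n : int => (z + 1 + n%:~R)^-1) N.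
  by apply: eq_zsum => n; congr (_^-1); rewrite rmorphD /= [n%:~R + _]addrC addrA.
move=> ->; have -> : z + (N%:Z + 1)%:~R = z + 1 + N%:R by rewrite rmorphD /= addrA addrAC.
by have -> : - (z + (- N%:Z)%:~R)^-1 = (- z + N%:R)^-1 by rewrite mulrNz -invrN opprB addrC.
Qed.

Lemma ct1 z : ct (z + 1) = ct z.
Proof.
apply: (cvgC_unique _ (@ctN_cvg (z + 1))).
apply: cvgC_ext (ctN1 z) _.
rewrite -[X in _ --> X]addr0 -[X in _ --> X + _]addr0.
by apply: cvgCD; [apply: cvgCD; [exact: ctN_cvg|exact: cvg_invz]|exact: cvg_invz].
Qed.

End Bounds.

(** * Derivative of the cotangent and its quadratic relation *)

Section CotangentODE.
Variable R : realType.
Local Notation C := R[i].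
Local Notation Re := (@complex.Re R).
Local Notation Im := (@complex.Im R).

Lemma cvgC_le (T : Type) (F : set_system T) (FF : ProperFilter F) (f : T -> C) (l : C) (M : R) :
  f t @[t --> F] --> l -> (\forall t \near F, normc (f t) <= M) -> normc l <= M.
Proof. by move=> /cvg_normc; apply: cvgr_to_le. Qed.

Lemma ler_cvgn (f g : nat -> R) (a b : R) :
  f n @[n --> \oo] --> a -> g n @[n --> \oo] --> b -> (forall n, f n <= g n) -> a <= b.
Proof. by move=> Hf Hg H; apply: (ler_cvg_to Hf Hg); apply: nearW. Qed.

Lemma cder_quad (f : C -> C) (z d : C) (r0 K : R) : 0 < r0 ->
  (forall h, normc h < r0 -> normc (f (z + h) - f z - d * h) <= K * normc h ^+ 2) ->
  cder f z d.
Proof.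
move=> r00 H e e0.
have K0 : 0 < 1 + `|K| by rewrite ltr_pwDl.
exists (Num.min r0 (e / (1 + `|K|))); first by rewrite lt_min r00 divr_gt0.
move=> h; rewrite lt_min ltr_pdivlMr // => /andP[/H H1 H2]; apply: le_trans H1 _.
rewrite expr2 mulrA ler_wpM2r ?normc_ge0 //.
apply: le_trans (ltW H2); rewrite mulrC ler_wpM2l ?normc_ge0 //.
by apply: le_trans (ler_norm _) _; rewrite lerDr.
Qed.

Lemma Im_subz (z : C) (n : int) : Im (z - n%:~R) = Im z.
Proof. by rewrite !cplxE oppr0 addr0. Qed.

Lemma Im_le_normc (z : C) (n : int) : Im z <= normc (z - n%:~R).
Proof. by rewrite -(Im_subz z n); apply: le_trans (ler_norm _) (ler_Im_normc _). Qed.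

Lemma subz_neq0 (z : C) (n : int) : 0 < Im z -> z - n%:~R != 0.
Proof. by move=> H; rewrite -normc_gt0; apply: lt_le_trans H (Im_le_normc _ _). Qed.

Lemma int_dist_bound (z : C) : 0 < Im z -> exists2 B : R, 0 < B &
  forall n : int, (normc (z - n%:~R))^-1 <= B / (1 + `|n%:~R|).
Proof.
move=> z0; have K0 : 0 < 1 + normc z by rewrite ltr_pwDl ?normc_ge0.
(* [1 + |n| <= (1 + |z|) + |z - n|], and [1 + |z| <= |z - n| (1 + |z|) / Im z]. *)
exists ((1 + normc z) / Im z + 1) => [|n]; first by rewrite addr_gt0 ?divr_gt0.
have n0 : 0 < 1 + `|n%:~R : R| by rewrite ltr_pwDl.
have d0 : 0 < normc (z - n%:~R) by rewrite normc_gt0 subz_neq0.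
rewrite ler_pdivlMr // ler_pdivrMl // mulrDr mulr1.
have : (1 + normc z) <= normc (z - n%:~R) * ((1 + normc z) / Im z).
  rewrite mulrCA -{1}[1 + normc z]mulr1 ler_wpM2l // ?(ltW K0) // ler_pdivlMr // mul1r.
  exact: Im_le_normc.
have : `|n%:~R : R| - normc z <= normc (z - n%:~R).
  by rewrite normcB -normc_int ler_normcB.
by lra.
Qed.

Lemma zsum_sqinv N : zsum (fun n : int => (1 + `|n%:~R : R|) ^- 2) N <= 5.
Proof.
rewrite zsumE normr0 addr0 expr1n invr1.
have : \sum_(n < N) ((1 + `|n.+1%:~R : R|) ^- 2 + (1 + `|(- n.+1%:Z)%:~R : R|) ^- 2)
   <= 2 * \sum_(n < N) (n.+1%:R ^- 2 : R).
  rewrite big_distrr /=; apply: ler_sum => n _; rewrite mulrNz normrN.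
  have E : (1 + `|n.+1%:~R : R|) ^- 2 <= n.+1%:R ^- 2.
    rewrite lef_pV2 ?posrE ?exprn_gt0 ?ltr_pwDl // ?ltr0n //.
    by rewrite ler_pXn2r ?nnegrE ?addr_ge0 // ger0_norm ?ler0n // lerDr.
  by rewrite mulr_natl mulr2n lerD.
have := sum_sqinv2 R N.
move: (\sum_(n < N) _) (\sum_(n < N) _) => a b; lra.
Qed.

Lemma csN_abs_bound (z : C) : 0 < Im z -> exists2 K : R, 0 < K &
  forall N, zsum (fun n : int => (normc (z - n%:~R)) ^- 2) N <= K.
Proof.
move=> /int_dist_bound[B B0 HB]; exists (B ^+ 2 * 5); first by rewrite mulr_gt0 ?exprn_gt0.
move=> N; apply: (@le_trans _ _ (zsum (fun n : int => B ^+ 2 * (1 + `|n%:~R : R|) ^- 2) N)).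
  apply: ler_zsum => n _; rewrite -!exprVn -exprMn ler_pXn2r ?nnegrE ?invr_ge0 ?normc_ge0 //.
  by rewrite mulr_ge0 ?(ltW B0) ?invr_ge0 ?addr_ge0.
by rewrite zsumZ ler_wpM2l ?exprn_ge0 ?(ltW B0) ?zsum_sqinv.
Qed.

Lemma Im_inv (z : C) : Im z^-1 = - Im z / normc z ^+ 2.
Proof. by rewrite normc_sqr; case: z => a b /=; rewrite mulNr. Qed.

(** All the terms [1 / (z - n)] have negative imaginary part; only [n = 0] is kept. *)
Lemma Im_ct_le (z : C) : 0 < Im z -> Im (ct z) <= Im z^-1.
Proof.
move=> z0; have L := @ctN_cvg R z.
have L2 : Im (ctN z N) @[N --> \oo] --> Im (ct z) by exact: (cvg_Im L).
apply: (cvgr_to_le L2); apply: nearW => N.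
rewrite /ctN zsumE ImD subr0 gerDl.
elim/big_ind: _ => //= [x y|n _]; first by rewrite ImD => ? ?; lra.
rewrite ImD !Im_inv !Im_subz; set a := normc _; set b := normc _.
by rewrite !mulNr -opprD oppr_le0 addr_ge0 // divr_ge0 ?(ltW z0) // exprn_ge0 // normc_ge0.
Qed.

Lemma Im_ct_lt0 (z : C) : 0 < Im z -> Im (ct z) < 0.
Proof.
move=> z0; apply: le_lt_trans (Im_ct_le z0) _.
by rewrite Im_inv mulNr oppr_lt0 divr_gt0 // exprn_gt0 // normc_gt0 -(subr0 z) (subz_neq0 0).
Qed.

(** The remainder of each term is exactly [h^2 / ((z - n)^2 (z + h - n))]. Summing absolute values
    gives a bound [O(|h|^2)] uniform in [N], which survives the limit; no theorem on differentiating
    limits is involved. *)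
Lemma cder_ct (z : C) : 0 < Im z -> cder (@ct R) z (- cs z).
Proof.
move=> z0; have [K K0 HK] := csN_abs_bound z0.
have y2 : 0 < Im z / 2 by rewrite divr_gt0.
apply: (@cder_quad _ _ _ (Im z / 2) (K * (Im z / 2)^-1)) => // h hz.
have zh : Im z / 2 <= Im (z + h).
  by rewrite ImD; have := ler_Im_normc h; rewrite ler_norml => /andP[]; lra.
have zh0 : 0 < Im (z + h) by apply: lt_le_trans zh.
have L : (ctN (z + h) N - ctN z N - (- csN z N) * h) @[N --> \oo] --> ct (z + h) - ct z - (- cs z) * h.
  apply: cvgCB; first by apply: cvgCB; exact: ctN_cvg.
  by apply: cvgCM; [apply: cvgCN; exact: csN_cvg|exact: cvgC_cst].
apply: (cvgC_le _ L); apply: nearW => N.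
have -> : ctN (z + h) N - ctN z N - - csN z N * h =
   zsum (fun n : int => h ^+ 2 * ((z - n%:~R) ^- 2 * (z + h - n%:~R)^-1)) N.
  rewrite mulNr opprK [csN _ _ * h]mulrC /ctN /csN -zsumZ -zsumN -!zsumD; apply: eq_zsum => n.
  have := subz_neq0 n z0; have := subz_neq0 n zh0.
  by move: (n%:~R) => m A B; field; rewrite A B.
apply: le_trans (normc_zsum _ _) _.
apply: (@le_trans _ _ (zsum (fun n : int => (normc h ^+ 2 / (Im z / 2)) * normc (z - n%:~R) ^- 2) N)).
  apply: ler_zsum => n _.
  rewrite !normcM !normcV !normcX -[X in _ <= X]mulrA ler_wpM2l ?mulr_ge0 ?normc_ge0 // [X in _ <= X]mulrC.
  rewrite ler_wpM2l ?invr_ge0 ?exprn_ge0 ?normc_ge0 // lef_pV2 ?posrE //.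
    by apply: le_trans zh _; exact: Im_le_normc.
  by rewrite normc_gt0 subz_neq0.
rewrite zsumZ; apply: le_trans (ler_wpM2l _ (HK N)) _; first by rewrite mulr_ge0 ?exprn_ge0 ?normc_ge0 ?invr_ge0 ?(ltW y2).
by rewrite le_eqVlt; apply/orP; left; apply/eqP; ring.
Qed.

(** [ctN 0 N] vanishes by oddness, and each unit shift adds two end terms of size at most
    [1 / (N - n)]. *)
Lemma ctN_nat_bound (n N : nat) : (n <= N)%N ->
  normc (ctN (n%:R : C) N) <= 2 * n%:R / (N.+1 - n)%N%:R.
Proof.
elim: n => [|n IH] nN.
  rewrite mulr0 mul0r -[0%:R]oppr0 ctN_opp.
  have := ctN_opp (0 : C) N; rewrite oppr0 => E.
  have : ctN (0 : C) N *+ 2 = 0 by rewrite mulr2n {1}E addNr.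
  by move/eqP; rewrite mulrn_eq0 /= => /eqP ->; rewrite oppr0 normc0.
have Nn : (0 : R) < (N - n)%N%:R by rewrite ltr0n subn_gt0.
have E1 : (N.+1 - n)%N = (N - n)%N.+1 by lia.
rewrite -natr1 ctN1 subSS.
have H1 : normc ((n%:R + 1 + N%:R : C)^-1) <= (N - n)%N%:R^-1.
  rewrite normcV natr1 -natrD normc_nat lef_pV2 ?posrE ?ltr0n //; last by lia.
  by rewrite ler_nat; lia.
have H2 : normc ((- n%:R + N%:R : C)^-1) <= (N - n)%N%:R^-1.
  by rewrite addrC -natrB ?(ltnW nN) // normcV normc_nat.
have H3 : 2 * n%:R / (N.+1 - n)%N%:R <= 2 * n%:R / (N - n)%N%:R :> R.
  by rewrite ler_wpM2l ?mulr_ge0 // E1 lef_pV2 ?posrE ?ltr0n // ?ler_nat; lia.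
apply: le_trans (normcD _ _) _; apply: le_trans (lerD (normcD _ _) H2) _.
apply: le_trans (lerD (lerD (le_trans (IH (ltnW nN)) H3) H1) (lexx _)) _.
rewrite -natr1 le_eqVlt; apply/orP; left; apply/eqP; field.
by rewrite gt_eqF.
Qed.

Lemma ctN_int_bound (n : int) N : (`|n| <= N)%N ->
  normc (ctN (n%:~R : C) N) <= 2 * `|n%:~R| / (N.+1%:R - `|n%:~R|).
Proof.
move=> nN; have := ctN_nat_bound nN.
have -> : `|n%:~R : R| = `|n|%N%:R by rewrite -intr_norm natr_absz.
rewrite (natrB _ (leqW nN)) => H; apply: le_trans H.
have [E|E] : n = `|n|%N \/ n = - `|n|%N%:Z by lia.
  by rewrite {1}E -pmulrn.
by rewrite {1}E mulrNz -pmulrn ctN_opp normcN.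
Qed.

Lemma zsum_harmonic N :
  zsum (fun n : int => (1 + `|n%:~R : R|)^-1 + (N.+1%:R - `|n%:~R|)^-1) N <= 4 * series harmonic N.+1.
Proof.
rewrite zsumD !zsumE normr0 addr0 subr0 invr1.
have E1 : \sum_(n < N) ((1 + `|n.+1%:~R : R|)^-1 + (1 + `|(- n.+1%:Z)%:~R : R|)^-1) = 2 * \sum_(n < N) (n.+2%:R)^-1.
  rewrite big_distrr /=; apply: eq_bigr => n _; rewrite mulrNz normrN ger0_norm ?ler0n //.
  by rewrite -mulr2n mulr_natl -[n.+2%:R]natr1 addrC.
have E2 : \sum_(n < N) ((N.+1%:R - `|n.+1%:~R : R|)^-1 + (N.+1%:R - `|(- n.+1%:Z)%:~R : R|)^-1) = 2 * \sum_(n < N) (n.+1%:R)^-1.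
  rewrite [in RHS](reindex_inj rev_ord_inj) big_distrr /=; apply: eq_bigr => n _.
  rewrite mulrNz normrN ger0_norm ?ler0n // -mulr2n mulr_natl -natrB ?ltnS //; last exact: ltnW.
  by congr (_%:R^-1 *+ 2); have := ltn_ord n; lia.
rewrite E1 E2 /series /= big_mkord.
have E3 : \sum_(i < N.+1) (i.+1%:R)^-1 = 1 + \sum_(i < N) (i.+2%:R)^-1 :> R.
  by rewrite big_ord_recl invr1.
have E4 : \sum_(i < N.+1) (i.+1%:R)^-1 = \sum_(i < N) (i.+1%:R)^-1 + N.+1%:R^-1 :> R.
  by rewrite big_ord_recr.
have : 0 <= N.+1%:R^-1 :> R by rewrite invr_ge0.
move: E3 E4; move: (\sum_(i < N.+1) _) (\sum_(i < N) _) (\sum_(i < N) _) (N.+1%:R^-1) => a b c d; lra.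
Qed.

Lemma cvg_harmonic_mean : (series harmonic N.+1 / N.+2%:R)@[N --> \oo] --> (0 : R).
Proof.
apply: (@squeeze_cvgr _ _ _ _ (fun=> 0) (arithmetic_mean (@harmonic R))); first last.
- exact/cesaro/cvg_harmonic.
- exact: cvg_cst.
apply: nearW => N; apply/andP; split.
  by apply: mulr_ge0; [apply: sumr_ge0 => i _|]; rewrite invr_ge0.
rewrite /arithmetic_mean /= mulrC ler_wpM2r //; first by apply: sumr_ge0 => i _; rewrite invr_ge0.
by rewrite lef_pV2 ?posrE ?ltr0n // ler_nat.
Qed.

(* Eisenstein: expand the square of the partial sums by partial fractions; the
   cross terms are small because their weights [ctN n] are small for [n] far
   below [N]. *)
Lemma ct_sqr_cs_const (z z' : C) : 0 < Im z -> 0 < Im z' ->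
  ct z ^+ 2 - cs z = ct z' ^+ 2 - cs z'.
Proof.
move=> z0 z0'; have [B B0 HB] := int_dist_bound z0; have [B' B0' HB'] := int_dist_bound z0'.
apply/eqP; rewrite -subr_eq0; apply/eqP.
pose D x N := ctN x N ^+ 2 - csN x N : C.
have L : (D z N - D z' N)@[N --> \oo] --> ct z ^+ 2 - cs z - (ct z' ^+ 2 - cs z').
  by apply: cvgCB; apply: cvgCB; (try exact: csN_cvg); rewrite ?expr2; apply: cvgCM; exact: ctN_cvg.
apply: (cvgC_unique _ L).
have DE x N : 0 < Im x -> D x N = 2 * zsum (fun n : int => (x - n%:~R)^-1 * ctN n%:~R N) N.
  move=> x0; rewrite /D.
  have -> : csN x N = zsum (fun n : int => (x - n%:~R)^-1 ^+ 2) N.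
    by apply: eq_zsum => n; rewrite exprVn.
  rewrite /ctN (@zsum_sqr _ (fun n : int => n%:~R)); first by rewrite addrAC subrr add0r.
  move=> i j ij; have ij0 : (i%:~R - j%:~R : C) != 0 by rewrite -rmorphB /= intr_eq0 subr_eq0.
  have := subz_neq0 i x0; have := subz_neq0 j x0; move: ij0.
  move: (i%:~R : C) (j%:~R : C) => a b ab xb xa; field; rewrite xa xb.
  by rewrite ab.
set K := 2 * (normc (z' - z) * (B * B') * 2).
apply: (@cvgC_squeeze _ _ _ _ _ _ (fun N => K * 4 * (series harmonic N.+1 / N.+2%:R))); last first.
  by rewrite -(mulr0 (K * 4)); apply: cvgM; [exact: cvg_cst|exact: cvg_harmonic_mean].
apply: nearW => N; rewrite subr0 !DE // -mulrBr normcM normc_nat.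
rewrite -zsumN -zsumD.
apply: (@le_trans _ _ (2 * zsum (fun n : int => (normc (z' - z) * (B * B') * 2 / N.+2%:R) * ((1 + `|n%:~R : R|)^-1 + (N.+1%:R - `|n%:~R|)^-1)) N)); last first.
  rewrite zsumZ; apply: (@le_trans _ _ (2 * ((normc (z' - z) * (B * B') * 2 / N.+2%:R) * (4 * series harmonic N.+1)))).
    rewrite ler_wpM2l // ler_wpM2l ?zsum_harmonic // !mulr_ge0 ?normc_ge0 ?ltW // invr_gt0 ltr0n //.
  by rewrite le_eqVlt; apply/orP; left; apply/eqP; rewrite /K; ring.
rewrite ler_wpM2l //; apply: le_trans (normc_zsum _ _) _; apply: ler_zsum => n nN.
have -> : (z - n%:~R)^-1 * ctN n%:~R N - (z' - n%:~R)^-1 * ctN n%:~R N =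
   (z' - z) * ((z - n%:~R)^-1 * (z' - n%:~R)^-1) * ctN n%:~R N.
  rewrite -mulrBl; congr (_ * _).
  have := subz_neq0 n z0; have := subz_neq0 n z0'; move: (n%:~R : C) => m A A'.
  by field; rewrite A A'.
rewrite !normcM !normcV.
have En : `|n%:~R : R| = `|n|%N%:R by rewrite -intr_norm natr_absz.
set m := `|n%:~R : R|; have m0 : 0 <= m by exact: normr_ge0.
have mN : m <= N%:R by rewrite /m En ler_nat.
have N1 : N.+1%:R = N%:R + 1 :> R by rewrite -natr1.
have N2 : N.+2%:R = N%:R + 2 :> R by rewrite -natr1 N1; ring.
apply: (@le_trans _ _ (normc (z' - z) * (B / (1 + m) * (B' / (1 + m))) * (2 * m / (N.+1%:R - m)))).
  apply: ler_pM; rewrite ?mulr_ge0 ?invr_ge0 ?normc_ge0 ?ctN_int_bound //.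
  by rewrite ler_wpM2l ?normc_ge0 // ler_pM ?invr_ge0 ?normc_ge0.
(* The factors [1 + m] and [N + 1 - m] add up to [N + 2]: partial fractions turn the sum over [n]
   into harmonic sums divided by [N + 2], which tend to 0 by a Cesaro argument. *)
have -> : (1 + m)^-1 + (N.+1%:R - m)^-1 = N.+2%:R / ((1 + m) * (N.+1%:R - m)).
  by rewrite N1 N2; field; rewrite !gt_eqF //; lra.
have -> : normc (z' - z) * (B / (1 + m) * (B' / (1 + m))) * (2 * m / (N.+1%:R - m)) =
   normc (z' - z) * (B * B') * 2 / ((1 + m) * (N.+1%:R - m)) * (m / (1 + m)).
  by rewrite N1; field; rewrite !gt_eqF //; lra.
have -> : normc (z' - z) * (B * B') * 2 / N.+2%:R * (N.+2%:R / ((1 + m) * (N.+1%:R - m))) =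
   normc (z' - z) * (B * B') * 2 / ((1 + m) * (N.+1%:R - m)).
  by rewrite N1 N2; field; rewrite !gt_eqF //; lra.
rewrite ler_piMr //.
  by rewrite !mulr_ge0 ?normc_ge0 ?invr_ge0 ?mulr_ge0 ?(ltW B0) ?(ltW B0') //; rewrite ?N1; lra.
by rewrite ler_pdivrMr; lra.
Qed.

End CotangentODE.

(** * The constant value of [ct^2 - cs], read off on the imaginary axis *)

Section CotangentConstant.
Variable R : realType.
Local Notation C := R[i].
Local Notation Re := (@complex.Re R).
Local Notation Im := (@complex.Im R).

Definition sqinv_sum N : R := \sum_(n < N) n.+1%:R ^- 2.

Lemma csN0 N : csN 0 N = (2 * sqinv_sum N)%:C :> C.
Proof.
rewrite /csN zsumE subrr expr0n invr0 add0r /sqinv_sum big_distrr /= rmorph_sum /=.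
apply: eq_bigr => n _; rewrite mulrNz opprK sub0r sqrrN add0r -mulr2n.
by rewrite mulr_natl rmorphMn fmorphV rmorphXn /= rmorph_nat.
Qed.

Lemma cs0_cvgC : ((2 * sqinv_sum N)%:C : C)@[N --> \oo] --> cs 0.
Proof. by apply: cvgC_ext (fun N => esym (csN0 N)) _; exact: csN_cvg. Qed.

Lemma cs0_cvg : (2 * sqinv_sum N)@[N --> \oo] --> Re (cs 0).
Proof. exact: (cvg_Re cs0_cvgC). Qed.

Lemma Im_cs0 : Im (cs 0) = 0.
Proof.
have L : (fun=> 0) N @[N --> \oo] --> Im (cs 0) by exact: (cvg_Im cs0_cvgC).
by rewrite -(cvg_lim _ L) // lim_cst.
Qed.

Lemma Re_inv (z : C) : Re z^-1 = Re z / normc z ^+ 2.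
Proof. by rewrite normc_sqr; case: z. Qed.

Variable t : R.
Hypothesis t0 : 0 < t.
(** For [z = i t] the terms [n] and [-n] of [ctN] and [csN] add up to [-2 i t / (n^2 + t^2)] and
    [2 (n^2 - t^2) / (n^2 + t^2)^2]. *)
Let A N : R := \sum_(n < N) (n.+1%:R ^+ 2 + t ^+ 2)^-1.
Let B N : R := \sum_(n < N) (n.+1%:R ^+ 2 - t ^+ 2) / (n.+1%:R ^+ 2 + t ^+ 2) ^+ 2.

Variable z : C.
Hypotheses (Rez : Re z = 0) (Imz : Im z = t).

Let den n : n.+1%:R ^+ 2 + t ^+ 2 != 0.
Proof. by rewrite gt_eqF // ltr_wpDl ?sqr_ge0 // exprn_gt0. Qed.

Lemma ctN_imag N : ctN z N = 0 -i* (t^-1 + 2 * t * A N).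
Proof.
rewrite /ctN zsumE (_ : z - 0%:~R = z) ?subr0 //; apply: eqC.
  rewrite ReD Re_inv Rez mul0r add0r raddf_sum big1 // => n _ /=.
  rewrite ReD mulrNz opprK !Re_inv !normc_sqr !cplxE Rez Imz.
  by rewrite -?pmulrn; move: (n.+1%:R : R) (den n) => m H; field; rewrite ?H //; move: H; congr (_ != _); ring.
rewrite ImD Im_inv normc_sqr Rez Imz -[RHS]/(- _) opprD; congr (_ + _).
  by field; rewrite gt_eqF.
rewrite raddf_sum /A big_distrr -sumrN /=; apply: eq_bigr => n _ /=.
rewrite ImD mulrNz opprK !Im_inv !normc_sqr !cplxE Rez Imz.
by rewrite -?pmulrn; move: (n.+1%:R : R) (den n) => m H; field; rewrite ?H //; move: H; congr (_ != _); ring.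
Qed.

Lemma csN_imag N : csN z N = (- t ^- 2 + 2 * B N)%:C.
Proof.
rewrite /csN zsumE (_ : z - 0%:~R = z) ?subr0 // -exprVn; apply: eqC.
  rewrite [RHS]ReC ReD [_^-1 ^+ 2]expr2 ReM Re_inv Im_inv normc_sqr Rez Imz; congr (_ + _).
    by field; rewrite gt_eqF.
  rewrite raddf_sum /B big_distrr /=; apply: eq_bigr => n _ /=.
  rewrite ReD mulrNz opprK -!exprVn !(expr2 (_^-1)) !ReM !Re_inv !Im_inv !normc_sqr !cplxE Rez Imz.
  by rewrite -?pmulrn; move: (n.+1%:R : R) (den n) => m H; field; rewrite ?H //; move: H; congr (_ != _); ring.
rewrite [RHS]ImC ImD [_^-1 ^+ 2]expr2 ImM Re_inv Im_inv normc_sqr Rez Imz.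
rewrite mul0r mul0r mulr0 !add0r raddf_sum big1 // => n _ /=.
rewrite ImD mulrNz opprK -!exprVn !(expr2 (_^-1)) !ImM !Re_inv !Im_inv !normc_sqr !cplxE Rez Imz.
by rewrite -?pmulrn; move: (n.+1%:R : R) (den n) => m H; field; rewrite ?H //; move: H; congr (_ != _); ring.
Qed.

Lemma A_bounds N : sqinv_sum N - t ^+ 2 * sqinv_sum N <= A N <= sqinv_sum N.
Proof.
rewrite /sqinv_sum /A big_distrr -sumrB /=.
have t20 : 0 < t ^+ 2 by rewrite exprn_gt0.
apply/andP; split; apply: ler_sum => n _;
  have : 1 <= n.+1%:R ^+ 2 :> R by [rewrite exprn_ege1 // ler1n];
  move: (n.+1%:R ^+ 2) (t ^+ 2) t20 => m s s0 m1; rewrite -subr_ge0.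
  have -> : (m + s)^-1 - (m^-1 - s * m^-1) = s * (m - 1 + s) / (m * (m + s)).
    by field; rewrite !gt_eqF //; lra.
  by apply: divr_ge0; apply: mulr_ge0; lra.
have -> : m^-1 - (m + s)^-1 = s / (m * (m + s)) by field; rewrite !gt_eqF //; lra.
by apply: divr_ge0; [|apply: mulr_ge0]; lra.
Qed.

Lemma B_bounds N : sqinv_sum N - 3 * t ^+ 2 * sqinv_sum N <= B N <= sqinv_sum N.
Proof.
rewrite /sqinv_sum /B big_distrr -sumrB /=.
have t20 : 0 < t ^+ 2 by rewrite exprn_gt0.
apply/andP; split; apply: ler_sum => n _;
  have : 1 <= n.+1%:R ^+ 2 :> R by [rewrite exprn_ege1 // ler1n];
  move: (n.+1%:R ^+ 2) (t ^+ 2) t20 => m s s0 m1; rewrite -subr_ge0.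
  have -> : (m - s) / (m + s) ^+ 2 - (m^-1 - 3 * s * m^-1) =
     s * (3 * (m + s) ^+ 2 - 3 * m - s) / (m * (m + s) ^+ 2) by field; rewrite !gt_eqF //; lra.
  apply: divr_ge0; apply: mulr_ge0; rewrite ?sqr_ge0 //; first lra; last lra.
  by nra.
have -> : m^-1 - (m - s) / (m + s) ^+ 2 = s * (3 * m + s) / (m * (m + s) ^+ 2).
  by field; rewrite !gt_eqF //; lra.
by apply: divr_ge0; apply: mulr_ge0; rewrite ?sqr_ge0 //; lra.
Qed.

(** The poles of [ctN^2] and [csN] cancel, leaving [6 s - 4 A - 2 B - 4 t^2 A^2] with [s] the
    partial sum of [1/n^2]; [A] and [B] are within O(t^2) of [s]. The constant is 36 = 8 + 12 + 16,
    and its independence of [N] allows [N -> oo] before [t -> 0]. *)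
Lemma ctN_csN_imag_bound N : t <= 1 ->
  normc (ctN z N ^+ 2 - csN z N + 3 * csN 0 N) <= 36 * t ^+ 2.
Proof.
move=> t1; have t20 : 0 <= t ^+ 2 by rewrite sqr_ge0.
rewrite ctN_imag csN_imag csN0.
have -> : (0 -i* (t^-1 + 2 * t * A N)) ^+ 2 - (- t ^- 2 + 2 * B N)%:C + 3 * (2 * sqinv_sum N)%:C
  = (6 * sqinv_sum N - 4 * A N - 2 * B N - 4 * t ^+ 2 * A N ^+ 2)%:C.
  have E (a b c : R) : (0 -i* a) ^+ 2 - b%:C + 3 * c%:C = (- a ^+ 2 - b + 3 * c)%:C :> C.
    by rewrite expr2; simpc.
  by rewrite E; congr (_%:C); field; rewrite gt_eqF.
rewrite normc_real.
have := A_bounds N; have := B_bounds N; have : sqinv_sum N <= 2 by exact: sum_sqinv2.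
have S0 : 0 <= sqinv_sum N by exact: sum_sqinv_ge0.
have A0 : 0 <= A N by apply: sumr_ge0 => n _; rewrite invr_ge0 addr_ge0 ?sqr_ge0.
move: (sqinv_sum N) (A N) (B N) S0 A0 => s a b s0 a0 s2 /andP[b1 b2] /andP[a1 a2].
have : 0 <= t ^+ 2 * s <= 2 * t ^+ 2 by apply/andP; split; nra.
have : 0 <= a ^+ 2 <= 4 by apply/andP; split; nra.
case/andP=> c1 c2 /andP[d1 d2].
have : 0 <= t ^+ 2 * a ^+ 2 <= 4 * t ^+ 2 by apply/andP; split; nra.
case/andP=> e1 e2; rewrite ler_norml; apply/andP; split; nra.
Qed.

Lemma Im_ct_imag_ge : - (t^-1 + t * Re (cs 0)) <= Im (ct z).
Proof.
have L := @ctN_cvg R z.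
have L2 : Im (ctN z N) @[N --> \oo] --> Im (ct z) by exact: (cvg_Im L).
have L3 : (- (t^-1 + t * (2 * sqinv_sum N)))@[N --> \oo] --> - (t^-1 + t * Re (cs 0)).
  apply: cvgN; apply: cvgD; first exact: cvg_cst.
  by apply: cvgM; [exact: cvg_cst|exact: cs0_cvg].
apply: (ler_cvgn L3 L2) => N; rewrite ctN_imag -[Im _]/(- (t^-1 + 2 * t * A N)) lerN2 lerD2l mulrA [t * 2]mulrC.
by rewrite ler_wpM2l ?mulr_ge0 ?(ltW t0) //; have /andP[] := A_bounds N.
Qed.

End CotangentConstant.

(** * The nome *)

Section Nome.
Variable R : realType.
Local Notation C := R[i].
Local Notation Re := (@complex.Re R).
Local Notation Im := (@complex.Im R).
Implicit Types (z a b : C).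

(* This constant is pi, but only the bounds below are ever needed. *)
Definition Pi : R := Num.sqrt (3 * Re (cs 0)).

(** [sqinv_sum N + 1 / (N + 1)] increases to the full sum of [1/n^2], so its value at [N = 7] is a
    lower bound, much sharper than the partial sum alone. *)
Lemma Re_cs0_ge : 3273 / 1000 <= Re (cs 0).
Proof.
have L : (2 * sqinv_sum R N + 2 / N.+1%:R)@[N --> \oo] --> Re (cs 0) + 0.
  by apply: cvgD; [exact: cs0_cvg|exact: cvg_invSn].
rewrite addr0 in L; apply: (cvgr_to_ge L); exists 7%N => // N /= N4.
have N1 : (0 : R) < N.+1%:R by rewrite ltr0n.
have -> : 2 * sqinv_sum R N + 2 / N.+1%:R = 2 * (sqinv_sum R N + N.+1%:R^-1) by rewrite mulrDr.
suff : 8^-1 + sqinv_sum R 7 <= sqinv_sum R N + N.+1%:R^-1.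
  have : 16367 / 10000 - 8^-1 <= sqinv_sum R 7 by rewrite /sqinv_sum !big_ord_recr big_ord0 /=; lra.
  by move: (sqinv_sum R N) (sqinv_sum R 7) (N.+1%:R^-1) => a b c; lra.
elim: N N4 {N1} => // N IH; rewrite leq_eqVlt => /orP[/eqP <-|]; first by rewrite addrC.
rewrite ltnS => /IH H; apply: le_trans H _; rewrite /sqinv_sum big_ord_recr /= -addrA lerD2l.
have N1 : (0 : R) < N.+1%:R by rewrite ltr0n.
have N2 : N.+2%:R = N.+1%:R + 1 :> R by rewrite -natr1.
rewrite N2 -subr_ge0; move: (N.+1%:R : R) N1 => m m0.
have -> : m ^- 2 + (m + 1)^-1 - m^-1 = (m ^+ 2 * (m + 1))^-1 by field; rewrite !gt_eqF //; lra.
by rewrite invr_ge0 mulr_ge0 ?sqr_ge0 //; lra.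
Qed.

Lemma Re_cs0_le : Re (cs 0) <= 4.
Proof.
apply: (cvgr_to_le (cs0_cvg (R := R))); apply: nearW => N.
by have := sum_sqinv2 R N; rewrite /sqinv_sum; lra.
Qed.

Lemma Pi_sqr : Pi ^+ 2 = 3 * Re (cs 0).
Proof. by rewrite sqr_sqrtr //; have := Re_cs0_ge; lra. Qed.

Lemma Pi_gt0 : 0 < Pi.
Proof. by rewrite sqrtr_gt0; have := Re_cs0_ge; lra. Qed.

Lemma Pi_ge : 3133 / 1000 <= Pi.
Proof. by have := Pi_gt0; have := Pi_sqr; have := Re_cs0_ge; nra. Qed.

Lemma Pi_le : Pi <= 7 / 2.
Proof. by have := Pi_gt0; have := Pi_sqr; have := Re_cs0_le; nra. Qed.

Lemma cs0E : cs 0 = (Pi ^+ 2 / 3)%:C.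
Proof. by apply: eqC; rewrite ?Im_cs0 // Pi_sqr ReC; field. Qed.

(** This is cot^2 + 1 = 1 / sin^2. As [ct' = - cs], it is a differential equation for [ct], and it
    makes [nome] behave as an exponential. *)
Lemma ct_sqr z : 0 < Im z -> ct z ^+ 2 + (Pi ^+ 2)%:C = cs z.
Proof.
move=> z0; suff H : ct z ^+ 2 - cs z + 3 * cs 0 = 0.
  apply/eqP; rewrite -subr_eq0 -[X in _ == X]H cs0E; apply/eqP.
  have -> : (Pi ^+ 2)%:C = 3 * (Pi ^+ 2 / 3)%:C :> C.
    by rewrite -[3](rmorph_nat (real_complex R)) -rmorphM /=; congr (_%:C); field.
  by rewrite addrAC.
apply/eqP; rewrite -normc_eq0 eq_le normc_ge0 andbT.
have key t : 0 < t -> t <= 1 -> normc (ct z ^+ 2 - cs z + 3 * cs 0) <= 36 * t ^+ 2.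
  move=> t0 t1; rewrite (@ct_sqr_cs_const _ z (0 +i* t)) //.
  have L : (ctN (0 +i* t) N ^+ 2 - csN (0 +i* t) N + 3 * csN 0 N)@[N --> \oo] --> ct (0 +i* t) ^+ 2 - cs (0 +i* t) + 3 * cs 0.
    apply: cvgCD; first apply: cvgCB; rewrite ?expr2.
    - by apply: cvgCM; exact: ctN_cvg.
    - exact: csN_cvg.
    - by apply: cvgCM; [exact: cvgC_cst|exact: csN_cvg].
  by apply: (cvgC_le _ L); apply: nearW => N; exact: ctN_csN_imag_bound.
apply/ler_addgt0Pr => e e0; rewrite add0r.
(* With [t <= 1] and [t <= e / 36], [36 t^2 <= 36 t <= e]. *)
have t0 : 0 < Num.min 1 (e / 36) by rewrite lt_min ltr01 divr_gt0.
have t1 : Num.min 1 (e / 36) <= 1 by rewrite ge_min lexx.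
have t2 : Num.min 1 (e / 36) <= e / 36 by rewrite ge_min lexx orbT.
apply: le_trans (key _ t0 t1) _; move: (Num.min _ _) t0 t1 t2 => t t0 t1 t2; nra.
Qed.

Definition iPi : C := 0 +i* Pi.
Lemma Re_iPi : Re iPi = 0. Proof. by []. Qed.
Lemma Im_iPi : Im iPi = Pi. Proof. by []. Qed.
Lemma iPi_sqr : iPi ^+ 2 = - (Pi ^+ 2)%:C.
Proof. by apply: eqC; rewrite [iPi ^+ 2]expr2 ?(ReM, ImM) ?(Re_iPi, Im_iPi) !cplxE; ring. Qed.

(** This is [q = exp (2 pi i z)], obtained by solving pi cot(pi z) = pi i (q + 1) / (q - 1) for
    [q]. *)
Definition nome z : C := (ct z + iPi) / (ct z - iPi).

Lemma nome_den z : 0 < Im z -> ct z - iPi != 0.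
Proof.
move=> /Im_ct_lt0 H; apply/eqP => /(congr1 Im).
by rewrite ImD ImN Im_iPi Im0; have := Pi_gt0; lra.
Qed.

Lemma normc_nome_lt1 z : 0 < Im z -> normc (nome z) < 1.
Proof.
move=> z0; rewrite normcM normcV ltr_pdivrMr ?normc_gt0 ?nome_den // mul1r.
rewrite -(ltr_pXn2r (isT : (0 < 2)%N)) ?nnegrE ?normc_ge0 // !normc_sqr !ReD !ImD ReN ImN Re_iPi Im_iPi.
have : 0 < Pi * - Im (ct z) by rewrite mulr_gt0 ?Pi_gt0 ?oppr_gt0 ?Im_ct_lt0.
by nra.
Qed.

Lemma nome_neq1 z : 0 < Im z -> 1 - nome z != 0.
Proof.
move=> /normc_nome_lt1 H; apply/eqP => /eqP; rewrite subr_eq0 => /eqP E.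
by rewrite -E normc1 ltxx in H.
Qed.

Lemma ct_nome z : 0 < Im z -> ct z = - iPi * (1 + nome z) / (1 - nome z).
Proof.
move=> z0; have := nome_neq1 z0; rewrite /nome; have := nome_den z0.
move: iPi (ct z) => P c d e; apply: (mulIf e); rewrite divfK //.
by field.
Qed.

(** [q / (1 - q)^2] is the sum of [k q^k]; this is how a row of the lattice sum becomes a power
    series in [q]. *)
Lemma cs_nome z : 0 < Im z -> cs z = - (4 * (Pi ^+ 2)%:C) * (nome z / (1 - nome z) ^+ 2).
Proof.
move=> z0; rewrite -ct_sqr // ct_nome // !exprMn exprVn sqrrN iPi_sqr.
by have := nome_neq1 z0; move: (nome z) (Pi ^+ 2)%:C => q P H; field.
Qed.

Lemma cder_nome z : 0 < Im z -> cder nome z (2 * iPi * nome z).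
Proof.
move=> z0; have d0 := nome_den z0; have Hc := cder_ct z0.
have Hn := cderD Hc (cder_cst iPi z); have Hd := cderD Hc (cder_cst (- iPi) z).
have Hq := cderM Hn (@cder_comp R (fun w => w^-1) (fun w => ct w - iPi) z _ _ (cder_inv d0) Hd).
apply: cder_ext Hq; first by near=> w.
rewrite -(ct_sqr z0) /nome (_ : (Pi ^+ 2)%:C = - iPi ^+ 2); last by rewrite iPi_sqr opprK.
by move: d0; move: iPi (ct z) => P c d0; field.
Unshelve. all: by end_near. Qed.

Lemma nome1 z : nome (z + 1) = nome z. Proof. by rewrite /nome ct1. Qed.

Lemma ct_conj z : ct (conjc z) = conjc (ct z).
Proof.
apply: (cvgC_unique _ (@ctN_cvg R (conjc z))).
apply: (@cvgC_ext _ _ _ _ (fun N => conjc (ctN z N))).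
  move=> N; rewrite /ctN (raddf_zsum (@conjc R)); apply: eq_zsum => n /=.
  by rewrite conjc_inv conjcB (rmorph_int (@conjc R)).
by apply: cvg_conj; exact: ctN_cvg.
Qed.

Lemma nome_conj z : nome (- conjc z) = conjc (nome z).
Proof.
rewrite /nome ct_opp ct_conj (conjcM (ct z + iPi)) conjcV conjcB conjcD.
have -> : conjc iPi = - iPi by rewrite /iPi; simpc.
move: (conjc (ct z)) iPi => c P.
have -> : - c + P = - (c - P) by ring.
have -> : - c - P = - (c - - P) by ring.
by rewrite invrN mulrNN.
Qed.

(** The initial value of the exponential: [1 - nome z = - 2 iPi / (ct z - iPi)], and the pole of
    [ct] makes the denominator large, since [- Im (ct z) >= Im z / |z|^2]. *)
Lemma nome_at0 b (r : R) : 0 < Im b -> 0 < r ->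
  normc (1 - nome (r%:C * b)) <= r * (2 * Pi * normc b ^+ 2 / Im b).
Proof.
move=> b0 r0; set z := r%:C * b.
have Imz : Im z = r * Im b by rewrite /z !cplxE; ring.
have z0 : 0 < Im z by rewrite Imz mulr_gt0.
have d0 := nome_den z0.
have -> : 1 - nome z = - (2 * iPi) / (ct z - iPi) by rewrite /nome; field.
have nb : 0 < normc b by rewrite normc_gt0; apply: contraTneq b0 => ->; rewrite ltxx.
have H : Im b / (r * normc b ^+ 2) <= normc (ct z - iPi).
  rewrite -(normcN (ct z - iPi)); apply: le_trans (ler_Im_normc _); apply: le_trans (ler_norm _).
  rewrite ImN ImD ImN Im_iPi.
  suff : Im (ct z) <= - (Im b / (r * normc b ^+ 2)) by have := Pi_gt0; lra.
  have := Im_ct_le z0; rewrite Im_inv Imz /z normcM normc_real gtr0_norm // => /le_trans; apply.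
  by rewrite le_eqVlt; apply/orP; left; apply/eqP; field; rewrite !gt_eqF.
rewrite normcM normcV normcN normcM normc_nat.
have -> : normc iPi = Pi by rewrite /iPi /normc expr0n add0r sqrtr_sqr gtr0_norm ?Pi_gt0.
rewrite ler_pdivrMr ?normc_gt0 //.
have E : 2 * Pi = r * (2 * Pi * normc b ^+ 2 / Im b) * (Im b / (r * normc b ^+ 2)).
  by field; rewrite !gt_eqF.
rewrite {1}E ler_wpM2l // mulr_ge0 ?(ltW r0) // mulr_ge0 ?invr_ge0 ?(ltW b0) // mulr_ge0 ?sqr_ge0 //.
by rewrite mulr_ge0 // ltW // Pi_gt0.
Qed.

(* [nome (a + t b) * nome ((1 - t) b)] has derivative [0] in [t]. *)
Lemma nomeD a b : 0 < Im a -> 0 < Im b -> nome (a + b) = nome a * nome b.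
Proof.
move=> a0 b0.
pose F (w : C) := nome (a + w * b) * nome ((1 - w) * b).
have DF (t : R) : - (Im a / Im b) < t -> t < 1 -> cder F t%:C 0.
  move=> ta t1.
  have I1 : 0 < Im (a + t%:C * b).
    by rewrite !cplxE mul0r addr0 -(ltrBlDl) sub0r -ltr_pdivrMr // mulNr.
  have I2 : 0 < Im ((1 - t%:C) * b).
    by rewrite !cplxE oppr0 addr0 mul0r addr0 mulr_gt0 // subr_gt0.
  have D1 : cder (fun w => a + w * b) t%:C b.
    apply: cder_ext (cderD (cder_cst a _) (cderM (cder_id _) (cder_cst b _))); first by near=> w.
    by rewrite /= mulr0 addr0 mul1r add0r.
  have D2 : cder (fun w => (1 - w) * b) t%:C (- b).
    apply: cder_ext (cderM (cderD (cder_cst 1 _) (cderM (cder_cst (-1) _) (cder_id _))) (cder_cst b _)).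
      by near=> w; rewrite mulN1r.
    by rewrite /= mul0r !add0r mulr1 mulr0 addr0 mulN1r.
  have D3 := cderM (@cder_comp R nome (fun w => a + w * b) _ _ _ (cder_nome I1) D1)
    (@cder_comp R nome (fun w => (1 - w) * b) _ _ _ (cder_nome I2) D2).
  apply: cder_ext D3; first by near=> w.
  by ring.
have ab0 : 0 < Im a / Im b by rewrite divr_gt0.
(* [cder0_const] concerns open segments. Starting at [- c] makes [t = 0] an inner point; the other
   end [t = 1] is reached by a limit, where [nome_at0] applies. *)
pose c := Im a / Im b / 2.
have c0 : 0 < c by rewrite divr_gt0.
have Fc (t : R) : 0 <= t < 1 -> F t%:C = F 0.
  case/andP=> t0 t1.
  have H (s : R) : 0 < s < 1 -> cder F ((- c)%:C + s%:C * (1 + c)%:C) 0.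
    case/andP=> s0 s1; rewrite -rmorphM -rmorphD; apply: DF.
      by have : 0 < s * (1 + c) by [rewrite mulr_gt0 //; lra]; rewrite /c in c0 *; lra.
    by have : 0 < (1 - s) * (1 + c) by [rewrite mulr_gt0 //; lra]; lra.
  have E (s : R) : s%:C = (- c)%:C + ((s + c) / (1 + c))%:C * (1 + c)%:C.
    by rewrite -rmorphM -rmorphD /=; congr (_%:C); field; rewrite gt_eqF //; lra.
  rewrite -[0]/(0%:C) (E t) (E 0); apply: (cder0_const H).
    by rewrite divr_gt0 ?ltr_pdivrMr /=; lra.
  by rewrite divr_gt0 ?ltr_pdivrMr /=; lra.
have F0 : F 0 = nome a * nome b by rewrite /F mul0r addr0 subr0 mul1r.
rewrite -F0.
have L1 : (F (1 - N.+2%:R^-1)%:C)@[N --> \oo] --> F 0.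
  apply: (@cvgC_ext _ _ _ _ (fun=> F 0)) => [N|]; last exact: cvgC_cst.
  have N2 : (0 : R) < N.+2%:R by rewrite ltr0n.
  apply: Fc; rewrite subr_ge0; apply/andP; split; last by rewrite ltrBlDr ltrDl invr_gt0.
  by rewrite invf_le1 // ler1n.
apply: (cvgC_unique _ _ L1).
have lim0 : (N.+2%:R^-1)@[N --> \oo] --> (0 : R).
  by have := @cvg_harmonic R; rewrite -cvg_shiftS.
rewrite -[nome (a + b)]mulr1; apply: cvgCM.
  have ab : 0 < Im (a + b) by rewrite ImD addr_gt0.
  have H : (a + (1 - N.+2%:R^-1)%:C * b)@[N --> \oo] --> a + 1%:C * b.
    apply: cvgCD; first exact: cvgC_cst.
    apply: cvgCM; last exact: cvgC_cst.
    have : (1 - N.+2%:R^-1)@[N --> \oo] --> (1 - 0 : R) by apply: cvgB; [exact: cvg_cst|].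
    rewrite subr0 => H; apply: cvg_complex; first exact: H.
    exact: cvg_cst.
  rewrite mul1r in H.
  exact: (cvg_comp _ _ H (cder_continuous (cder_nome ab))).
apply: (@cvgC_squeeze _ _ _ _ _ _ (fun N : nat => N.+2%:R^-1 * (2 * Pi * normc b ^+ 2 / Im b))).
  apply: nearW => N; rewrite normcB.
  have -> : (1 - (1 - N.+2%:R^-1 : R)%:C) = (N.+2%:R^-1 : R)%:C.
    by move: (N.+2%:R^-1 : R) => x; apply: eqC; rewrite !cplxE; ring.
  by apply: nome_at0; rewrite // invr_gt0 ltr0n.
by rewrite -(mul0r (2 * Pi * normc b ^+ 2 / Im b)); apply: cvgM; [|exact: cvg_cst].
Unshelve. all: by end_near. Qed.

End Nome.

(** * The modulus of the nome *)

Section NomeFacts.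
Variable R : realType.
Local Notation C := R[i].
Local Notation Re := (@complex.Re R).
Local Notation Im := (@complex.Im R).
Implicit Types (z a b : C).

Lemma nomeM n z : 0 < Im z -> nome (n.+1%:R * z) = nome z ^+ n.+1.
Proof.
move=> z0; elim: n => [|n IH]; first by rewrite mul1r expr1.
have n0 : 0 < Im (n.+1%:R * z) by rewrite ImM Re_nat Im_nat mul0r addr0 mulr_gt0.
by rewrite -[n.+2%:R]natr1 mulrDl mul1r nomeD // IH [RHS]exprSr.
Qed.

(** Since [z - conjc z = 2 i Im z], the modulus depends on [Im z] only, and by [nomeD] it decreases
    with [Im z]. *)
Lemma normc_nome_sqr z : 0 < Im z -> nome (z - conjc z) = (normc (nome z) ^+ 2)%:C.
Proof. by move=> z0; rewrite nomeD // ?nome_conj ?mulcJ // ImN Im_conj opprK. Qed.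

Lemma subJ z : z - conjc z = 0 +i* (Im z *+ 2).
Proof. by case: z => x y; simpc; rewrite mulr2n. Qed.

Lemma normc_nome_eq z z' : 0 < Im z -> Im z = Im z' -> normc (nome z) = normc (nome z').
Proof.
move=> z0 E; have z0' : 0 < Im z' by rewrite -E.
apply/eqP; rewrite -(eqrXn2 (isT : (0 < 2)%N)) ?normc_ge0 //; apply/eqP.
by apply: (@complexI R); rewrite -!normc_nome_sqr // !subJ E.
Qed.

Lemma normc_nome_lt z z' : 0 < Im z -> Im z < Im z' -> nome z != 0 ->
  normc (nome z') < normc (nome z).
Proof.
move=> z0 zz' q0; have z0' : 0 < Im z' by apply: lt_trans zz'.
rewrite -(ltr_pXn2r (isT : (0 < 2)%N)) ?nnegrE ?normc_ge0 //.
have D0 : 0 < Im ((z' - conjc z') - (z - conjc z)) by rewrite !cplxE !opprK; lra.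
have S0 : 0 < Im (z - conjc z) by rewrite !cplxE opprK; lra.
have H := normc_nome_sqr z0'.
rewrite -[z' - _](subrK (z - conjc z)) nomeD // normc_nome_sqr // in H.
have := congr1 (@normc R) H; rewrite normcM !normc_real !ger0_norm ?sqr_ge0 // => <-.
by rewrite gtr_pMl ?normc_nome_lt1 // exprn_gt0 // normc_gt0.
Qed.

Lemma normc_nome_le z z' : 0 < Im z -> Im z <= Im z' -> normc (nome z') <= normc (nome z).
Proof.
move=> z0; rewrite le_eqVlt => /orP[/eqP E|H]; first by rewrite (normc_nome_eq z0 E).
have z0' : 0 < Im z' by apply: lt_trans H.
have [q0|q0] := eqVneq (nome z) 0; last exact/ltW/normc_nome_lt.
rewrite -(ler_pXn2r (isT : (0 < 2)%N)) ?nnegrE ?normc_ge0 //.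
have D0 : 0 < Im ((z' - conjc z') - (z - conjc z)) by rewrite !cplxE !opprK; lra.
have S0 : 0 < Im (z - conjc z) by rewrite !cplxE opprK; lra.
have K := normc_nome_sqr z0'.
rewrite -[z' - _](subrK (z - conjc z)) nomeD // normc_nome_sqr // in K.
have -> : normc (nome z') ^+ 2 = 0 by apply: (@complexI R); rewrite -K q0 normc0 expr0n rmorph0 mulr0.
exact: sqr_ge0.
Qed.

(* The [2,2] Pade approximant of [exp (- 2 Pi t)]. *)
Lemma normc_nome_pade z : Re z = 0 -> 0 < Im z -> Im z * Pi R <= 1 ->
  normc (nome z) <= (1 - Im z * Pi R + (Im z * Pi R) ^+ 2 / 3) /
                    (1 + Im z * Pi R + (Im z * Pi R) ^+ 2 / 3).
Proof.
move=> z0 t0 tP; have P0 := Pi_gt0 R.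
have Rec : Re (ct z) = 0.
  have L : Re (ctN z N) @[N --> \oo] --> Re (ct z) by have L := @ctN_cvg R z; exact: (cvg_Re L).
  have L0 : Re (ctN z N) @[N --> \oo] --> (0 : R).
    rewrite (_ : (fun N => _) = fun=> 0); first exact: cvg_cst.
    by apply/funext => N; rewrite (ctN_imag t0 z0 erefl).
  exact: (cvg_unique _ L L0).
have H1 := Im_ct_le t0; rewrite Im_inv normc_sqr z0 expr0n add0r in H1.
have H2 := Im_ct_imag_ge t0 z0 erefl.
set c := - Im (ct z).
have c1 : (Im z)^-1 <= c.
  rewrite /c lerNr; apply: le_trans H1 _.
  by rewrite le_eqVlt; apply/orP; left; apply/eqP; field; rewrite gt_eqF.
have c2 : c <= (Im z)^-1 + Im z * (Pi R ^+ 2 / 3).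
  by move: H2; rewrite Pi_sqr /c; have -> : 3 * Re (cs 0) / 3 = Re (cs 0) by [field]; lra.
have cP : Pi R <= c by apply: le_trans c1; rewrite -[X in _ <= X]mul1r ler_pdivlMr // mulrC.
have En : normc (ct z + iPi R) = c - Pi R.
  apply/eqP; rewrite -(eqrXn2 (isT : (0 < 2)%N)) ?normc_ge0 ?subr_ge0 //.
  by rewrite normc_sqr ReD ImD Rec Re_iPi Im_iPi /c; apply/eqP; ring.
have Ed : normc (ct z - iPi R) = c + Pi R.
  apply/eqP; rewrite -(eqrXn2 (isT : (0 < 2)%N)) ?normc_ge0 ?addr_ge0 ?(le_trans _ cP) ?(ltW P0) //.
  by rewrite normc_sqr ReD ImD ReN ImN Rec Re_iPi Im_iPi /c; apply/eqP; ring.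
rewrite /nome normcM normcV En Ed ler_pdivrMr; last by lra.
set u := Im z * Pi R; have u0 : 0 < u by rewrite mulr_gt0.
have den0 : 0 < 1 + u + u ^+ 2 / 3 by rewrite !addr_gt0 // divr_gt0 // exprn_gt0.
rewrite mulrAC ler_pdivlMr //.
have c2' : Im z * c <= 1 + u ^+ 2 / 3.
  have -> : 1 + u ^+ 2 / 3 = Im z * ((Im z)^-1 + Im z * (Pi R ^+ 2 / 3)).
    by rewrite /u; field; rewrite gt_eqF.
  by rewrite ler_pM2l.
rewrite -subr_ge0 -(pmulr_rge0 _ t0).
have -> : Im z * ((1 - u + u ^+ 2 / 3) * (c + Pi R) - (c - Pi R) * (1 + u + u ^+ 2 / 3)) =
   2 * u * (1 + u ^+ 2 / 3 - Im z * c) by rewrite /u; ring.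
by rewrite mulr_ge0 ?subr_ge0 // mulr_ge0 // ltW.
Qed.

Lemma sqrt3_gt : 1732 / 1000 < Num.sqrt 3 :> R.
Proof.
by have := sqrtr_ge0 (3 : R); have := sqr_sqrtr (ler0n R 3); move: (Num.sqrt 3) => s; nra.
Qed.

Lemma sqrt3_lt : Num.sqrt 3 < 1733 / 1000 :> R.
Proof.
by have := sqrtr_ge0 (3 : R); have := sqr_sqrtr (ler0n R 3); move: (Num.sqrt 3) => s; nra.
Qed.

(** At height [sqrt 3 / 2] the modulus is exp(- pi sqrt 3), about 1/231. The Pade bound requires
    [Im z * Pi <= 1], so it is applied at height [sqrt 3 / 8] and raised to the fourth power:
    [(13/50)^4 < 1/217]. *)
Lemma normc_nome_small z : Num.sqrt 3 / 2 <= Im z -> normc (nome z) <= 217^-1.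
Proof.
move=> zs; have s1 := sqrt3_gt; have s2 := sqrt3_lt.
have P1 := Pi_ge R; have P2 := Pi_le R.
set w : C := 0 +i* (Num.sqrt 3 / 16); have Iw : Im w = Num.sqrt 3 / 16 by [].
have w0 : 0 < Im w by rewrite Iw; lra.
have I8 : Im (8%:R * w) = Num.sqrt 3 / 2 by rewrite ImM Re_nat Im_nat Iw; field.
apply: le_trans (_ : normc (nome (8%:R * w)) <= _).
  by apply: normc_nome_le; rewrite I8 //; lra.
rewrite nomeM // normcX (exprM _ 2 4).
have -> : normc (nome w) ^+ 2 = normc (nome (w - conjc w)).
  by rewrite normc_nome_sqr // normc_real ger0_norm // sqr_ge0.
have Iv : Im (w - conjc w) = Num.sqrt 3 / 8 by rewrite !cplxE opprK Iw; field.
have Rv : Re (w - conjc w) = 0 by rewrite !cplxE subrr.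
have u1 : 678 / 1000 <= Num.sqrt 3 / 8 * Pi R by nra.
have u2 : Num.sqrt 3 / 8 * Pi R <= 76 / 100 by nra.
have : normc (nome (w - conjc w)) <= 13 / 50.
  apply: le_trans (normc_nome_pade Rv _ _) _; rewrite ?Iv; [lra|lra|].
  move: (_ * Pi R) u1 u2 => u u1 u2.
  by rewrite ler_pdivrMr; nra.
move=> H; apply: le_trans (_ : (13 / 50) ^+ 4 <= _); last by lra.
have c0 : 0 <= 13 / 50 :> R by lra.
by apply: lerXn2r => //; rewrite nnegrE ?normc_ge0.
Qed.

End NomeFacts.

(** * The Weierstrass zeta function and its quasi-periods *)

Section UnorderedSums.
Variable R : realType.
Local Notation C := R[i].

Definition uconv (T : choiceType) (f : T -> C) (L : C) := forall e : R, 0 < e ->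
  exists s0 : seq T, forall s : seq T, uniq s -> {subset s0 <= s} ->
    normc (\sum_(x <- s) f x - L) <= e.

Lemma uconv_sum (T : choiceType) (f : T -> C) (L : C) : uconv f L -> summability.sum f = L.
Proof.
move=> H; have PF := @summability.totally_filter T.
suff Hc : summability.partial_sum f A @[A --> summability.totally] --> L.
  by rewrite /summability.sum; apply: (cvg_lim _ Hc); exact: norm_hausdorff.
apply/cvgCP => e e0.
have e2 : 0 < e / 2 by rewrite divr_gt0.
have [s0 Hs] := H _ e2.
exists (finmap.seq_fset tt s0) => // B /= HB.
rewrite normcB /summability.partial_sum -(finmap.big_seq_fsetE _ _ xpredT f) /=.
apply: le_lt_trans (Hs _ (finmap.fset_uniq B) _) _; last by lra.
by move=> x xs; apply: (finmap.fsubsetP HB); have := finmap.seq_fsetE tt s0 x; rewrite xs.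
Qed.

Lemma uconv_scale (f : C -> C) (L c : C) : c != 0 -> uconv f L ->
  uconv (fun x => c^-1 * f (c^-1 * x)) (c^-1 * L).
Proof.
move=> c0 H e e0.
have nc : 0 < normc c by rewrite normc_gt0.
have [s0 Hs] := H _ (mulr_gt0 e0 nc); exists [seq c * x | x <- s0] => s us sub.
have -> : \sum_(x <- s) c^-1 * f (c^-1 * x) = c^-1 * \sum_(y <- [seq c^-1 * x | x <- s]) f y.
  by rewrite big_map big_distrr.
rewrite -mulrBr normcM normcV ler_pdivrMl // mulrC; apply: Hs.
  by rewrite map_inj_uniq //; apply: mulfI; rewrite invr_eq0.
move=> x xs; apply/mapP; exists (c * x); last by rewrite mulKf.
by apply: sub; apply/mapP; exists x.
Qed.

Lemma big_subset (T : eqType) (V : nmodType) (f : T -> V) (s t : seq T) :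
  uniq s -> uniq t -> {subset s <= t} ->
  \sum_(x <- t) f x = \sum_(x <- s) f x + \sum_(x <- t | x \notin s) f x.
Proof.
move=> us ut st; rewrite (bigID (mem s)) /=; congr (_ + _).
rewrite -big_filter; apply: perm_big; apply: uniq_perm => //; first exact: filter_uniq.
by move=> x; rewrite mem_filter andb_idr // => /st.
Qed.

Lemma cover_seq (T : eqType) (f : T -> C) (b : nat -> seq T) :
  (forall N N', (N <= N')%N -> {subset b N <= b N'}) ->
  (forall x, f x != 0 -> exists N, x \in b N) ->
  forall N (s : seq T), exists2 N', (N <= N')%N & forall x, x \in s -> f x != 0 -> x \in b N'.
Proof.
move=> mb cb N; elim=> [|y s [N1 NN1 H1]]; first by exists N.
have [fy|fy] := eqVneq (f y) 0.
  by exists N1 => // x; rewrite in_cons => /orP[/eqP ->|/H1//]; rewrite fy eqxx.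
have [N2 H2] := cb _ fy; exists (maxn N1 N2); first by rewrite (leq_trans NN1) // leq_maxl.
move=> x; rewrite in_cons => /orP[/eqP -> _|xs fx].
  by apply: mb H2; rewrite leq_maxr.
by apply: (mb N1); [rewrite leq_maxl|exact: H1].
Qed.

(** Absolute summability along one exhaustion gives unordered convergence: a finite set containing
    [b N] adds to it only terms of some [b N'], of total modulus at most [lim t - t N]. *)
Lemma uconv_abs (T : choiceType) (f : T -> C) (b : nat -> seq T) (M : R) :
  (forall N, uniq (b N)) -> (forall N N', (N <= N')%N -> {subset b N <= b N'}) ->
  (forall x, f x != 0 -> exists N, x \in b N) ->
  (forall N, \sum_(x <- b N) normc (f x) <= M) ->
  exists2 L, uconv f L & (\sum_(x <- b N) f x)@[N --> \oo] --> L.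
Proof.
move=> ub mb cb HM; pose t N := \sum_(x <- b N) normc (f x).
have tE N N' : (N <= N')%N -> t N' = t N + \sum_(x <- b N' | x \notin b N) normc (f x).
  by move=> NN'; apply: big_subset => //; exact: mb.
have tmono : nondecreasing_seq t.
  by move=> N N' NN'; rewrite (tE _ _ NN') lerDl sumr_ge0 // => x _; exact: normc_ge0.
have tcvg : cvgn t.
  by apply: nondecreasing_is_cvgn tmono _; exists M => _ [N _ <-]; exact: HM.
have key N (s : seq T) : uniq s -> {subset b N <= s} ->
    normc (\sum_(x <- s) f x - \sum_(x <- b N) f x) <= lim (t @ \oo) - t N.
  move=> us bs; rewrite (big_subset _ (ub N) us bs) [_ + _ - _]addrAC subrr add0r.
  have [N' NN' HN'] := cover_seq mb cb N s.
  apply: (@le_trans _ _ (t N' - t N)); last first.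
    by rewrite lerB // (nondecreasing_cvgn_le tmono tcvg).
  apply: le_trans (normc_sum _ _ _) _; rewrite (tE _ _ NN') [t N + _]addrC addrK.
  rewrite (bigID (fun x => f x == 0)) /= big1 ?add0r => [|x /andP[_ /eqP ->]]; last by rewrite normc0.
  rewrite -big_filter -[X in _ <= X]big_filter.
  set s1 := seq.filter _ s; set s2 := seq.filter _ (b N').
  rewrite (@big_subset _ _ _ s1 s2) ?filter_uniq //.
    by rewrite lerDl sumr_ge0 // => x _; exact: normc_ge0.
  move=> x; rewrite !mem_filter => /andP[/andP[-> fx] xs] /=; exact: HN'.
have small e : 0 < e -> exists2 N, True & forall N', (N <= N')%N -> lim (t @ \oo) - t N' < e.
  move=> e0; have /cvgrPdist_lt/(_ _ e0)[N _ HN] := tcvg.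
  by exists N => // N' /HN; apply: le_lt_trans; exact: ler_norm.
have [L HL] : exists L : C, (\sum_(x <- b N) f x)@[N --> \oo] --> L.
  apply: cauchyC_cvg => e e0; have [N _ HN] := small _ e0.
  exists [set N' | (N <= N')%N]; first by exists N.
  have aux s u : (N <= s)%N -> (s <= u)%N -> normc (\sum_(x <- b s) f x - \sum_(x <- b u) f x) < e.
    by move=> Ns su; rewrite normcB; apply: le_lt_trans (key _ _ (ub u) (mb _ _ su)) _; exact: HN.
  move=> s u /= Hs Hu; have [su|us] := leqP s u; first exact: aux.
  by rewrite normcB; apply: aux => //; exact: ltnW.
exists L => // e e0; have e2 : 0 < e / 2 by rewrite divr_gt0.
have [N _ HN] := small _ e2; have /cvgCP/(_ _ e2)[N1 _ HN1] := HL.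
exists (b (maxn N N1)) => s us bs.
rewrite -(subrK (\sum_(x <- b (maxn N N1)) f x) (\sum_(x <- s) f x)) -addrA.
apply: le_trans (normcD _ _) _; rewrite (splitr e) lerD //.
  by apply: le_trans (key _ _ us bs) _; apply/ltW/HN; rewrite leq_maxl.
by rewrite normcB; apply/ltW/HN1; rewrite /= leq_maxr.
Qed.

End UnorderedSums.

Section WeierstrassZeta.
Variable R : realType.
Local Notation C := R[i].
Local Notation Re := (@complex.Re R).
Local Notation Im := (@complex.Im R).

Definition zs (N : nat) : seq int := [seq i%:Z - N%:Z | i <- iota 0 N.*2.+1].

Lemma mem_zs (k : int) N : (k \in zs N) = (`|k| <= N)%N.
Proof.
apply/mapP/idP => [[j]|kN]; first by rewrite mem_iota; lia.
by exists (absz (k + N%:Z)); [rewrite mem_iota|]; lia.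
Qed.

Lemma zs_uniq N : uniq (zs N).
Proof. by rewrite map_inj_uniq ?iota_uniq // => i j; lia. Qed.

Lemma big_zs (V : nmodType) (F : int -> V) N : \sum_(k <- zs N) F k = zsum F N.
Proof. by rewrite /zs /zsum big_map -(big_mkord xpredT (fun i : nat => F (i%:Z - N%:Z))) /index_iota subn0. Qed.

Definition lpt (tau : C) (k n : int) : C := k%:~R * tau + n%:~R.
Definition rect (tau : C) (M N : nat) : seq C := [seq lpt tau k n | k <- zs M, n <- zs N].

Lemma big_rect (V : nmodType) (tau : C) (F : C -> V) M N :
  \sum_(x <- rect tau M N) F x = zsum (fun k => zsum (fun n => F (lpt tau k n)) N) M.
Proof. by rewrite /rect big_allpairs_dep big_zs; apply: eq_zsum => k; rewrite big_zs. Qed.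

Variable tau : C.
Hypothesis tau0 : 0 < Im tau.
Let G := lattice tau 1.

Lemma lpt_inj k n k' n' : lpt tau k n = lpt tau k' n' -> k = k' /\ n = n'.
Proof.
move=> E; have := congr1 Im E; rewrite !cplxE !mul0r !addr0 => /(mulIf (lt0r_neq0 tau0)) /intr_inj Ek.
by move: E; rewrite /lpt Ek => /addrI /intr_inj ->.
Qed.

Lemma rect_uniq M N : uniq (rect tau M N).
Proof.
apply: allpairs_uniq; try exact: zs_uniq.
by move=> [k n] [k' n'] /= _ _ /lpt_inj[-> ->].
Qed.

Lemma latticeP x : G x <-> exists k n, x = lpt tau k n.
Proof.
split; first by case=> k _ [n _ <-]; exists k, n; rewrite /lpt mulr1.
by case=> k [n ->]; exists k => //; exists n => //; rewrite /lpt mulr1.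
Qed.

Lemma mem_rect k n M N : (lpt tau k n \in rect tau M N) = (`|k| <= M)%N && (`|n| <= N)%N.
Proof.
apply/allpairsP/andP => [[[k' n'] /= []]|[kM nN]].
  by rewrite !mem_zs => ? ? /lpt_inj[-> ->].
by exists (k, n); rewrite !mem_zs.
Qed.

Lemma rect_sub M N M' N' : (M <= M')%N -> (N <= N')%N -> {subset rect tau M N <= rect tau M' N'}.
Proof.
move=> MM NN x /allpairsP[[k n] /= []]; rewrite !mem_zs => kM nN ->.
by rewrite mem_rect (leq_trans kM) // (leq_trans nN).
Qed.

Lemma lpt_lower : exists2 D : R, 0 < D & forall k n : int,
  `|k%:~R| + `|n%:~R| <= D * normc (lpt tau k n).
Proof.
have T0 := normc_ge0 tau.
(* From [|k| Im tau <= |g|] and [|n| <= |g| + |k| |tau|]. *)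
exists (1 + (1 + normc tau) / Im tau) => [|k n]; first by rewrite addr_gt0 // divr_gt0 //; lra.
set g := lpt tau k n.
have H1 : `|k%:~R : R| * Im tau <= normc g.
  rewrite -[X in _ * X]gtr0_norm // -normrM.
  have -> : k%:~R * Im tau = Im g by rewrite /g /lpt !cplxE mul0r !addr0.
  exact: ler_Im_normc.
have H2 : `|n%:~R : R| <= normc g + `|k%:~R| * normc tau.
  rewrite -(normc_int R n) (_ : n%:~R = g - k%:~R * tau); last by rewrite /g /lpt addrAC subrr add0r.
  by apply: le_trans (normcD _ _) _; rewrite normcN normcM normc_int.
rewrite mulrDl mul1r mulrAC -addrC.
have : (`|k%:~R : R| * (1 + normc tau)) <= (1 + normc tau) * normc g / Im tau.
  by rewrite ler_pdivlMr // mulrC mulrA [Im tau * _]mulrC mulrC ler_wpM2l //; lra.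
by rewrite mulrDr mulr1; lra.
Qed.

(** Telescoping, from [1 / (m + 1)^3 <= 1 / m^2 - 1 / (m + 1)^2]. *)
Lemma sum_cube (x : R) N : 1 <= x ->
  \sum_(n < N) (x + 1 + n%:R) ^- 3 <= x ^- 2 - (x + N%:R) ^- 2.
Proof.
move=> x1; elim: N => [|N IH]; first by rewrite big_ord0 addr0 subrr.
rewrite big_ord_recr /=; apply: le_trans (lerD IH (lexx _)) _.
have N0 : 0 <= N%:R :> R by [].
have -> : x + N.+1%:R = x + N%:R + 1 by rewrite -natr1 addrA.
have -> : x + 1 + N%:R = x + N%:R + 1 by rewrite addrAC.
have : 1 <= x + N%:R by lra.
move: (x + N%:R) => m m1.
rewrite -subr_ge0.
have -> : x ^- 2 - (m + 1) ^- 2 - (x ^- 2 - m ^- 2 + (m + 1) ^- 3) = (m ^+ 2 + 3 * m + 1) / (m ^+ 2 * (m + 1) ^+ 3).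
  by field; rewrite !gt_eqF //; lra.
have m0 : 0 <= m by lra.
by rewrite divr_ge0 ?mulr_ge0 ?exprn_ge0 //; nra.
Qed.

Lemma zsum_cube (x : R) N : 1 <= x ->
  zsum (fun n : int => (x + 1 + `|n%:~R|) ^- 3) N <= 2 * x ^- 2.
Proof.
move=> x1; rewrite zsumE normr0 addr0.
have -> : \sum_(n < N) ((x + 1 + `|n.+1%:~R|) ^- 3 + (x + 1 + `|(- n.+1%:Z)%:~R|) ^- 3) =
   2 * \sum_(n < N) (x + 1 + n.+1%:R) ^- 3 :> R.
  by rewrite big_distrr; apply: eq_bigr => n _ /=; rewrite mulrNz normrN ger0_norm ?ler0n // mulr_natl mulr2n.
have := @sum_cube x N.+1 x1; rewrite big_ord_recl addr0.
have : 0 <= (x + N.+1%:R) ^- 2 by rewrite invr_ge0 sqr_ge0.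
have : 0 <= (x + 1) ^- 3 by rewrite invr_ge0 exprn_ge0 //; lra.
move: (_ ^- 2) (_ ^- 2) (_ ^- 3) (\sum_(i < N) _) => a b c d; lra.
Qed.

Lemma zsum2_cube M N :
  zsum (fun k : int => zsum (fun n : int => (2 + `|k%:~R| + `|n%:~R| : R) ^- 3) N) M <= 10.
Proof.
apply: (@le_trans _ _ (zsum (fun k : int => 2 * (1 + `|k%:~R : R|) ^- 2) M)).
  apply: ler_zsum => k _; apply: le_trans (_ : zsum (fun n : int => (1 + `|k%:~R| + 1 + `|n%:~R| : R) ^- 3) N <= _).
    by apply: ler_zsum => n _; rewrite (_ : 2 + _ = 1 + `|k%:~R| + 1) //; ring.
  by apply: zsum_cube; rewrite lerDl.
by rewrite zsumZ; have := zsum_sqinv R M; lra.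
Qed.

Variable u : C.
Hypothesis Gu : ~ G u.

Definition zterm : C -> C := (fun g : C => (u - g)^-1 + g^-1 + u / g ^+ 2) \_ (G `\ (0 : C)).

Lemma sub_lattice_neq0 g : G g -> u - g != 0.
Proof. by move=> Gg; rewrite subr_eq0; apply/eqP => E; apply: Gu; rewrite E. Qed.

(** The lattice points at distance less than 1 from [u] lie in a fixed rectangle; on it the sum of
    the finitely many values serves as a crude maximum. *)
Lemma lattice_dist : exists S : R, forall g, G g -> (normc (u - g))^-1 <= S.
Proof.
have [D D0 HD] := lpt_lower.
have [N HN] : exists N : nat, D * (normc u + 1) <= N%:R.
  exists (Num.Def.archi_bound (D * (normc u + 1))); apply/ltW/archi_boundP.
  by rewrite mulr_ge0 ?(ltW D0) // addr_ge0 // normc_ge0.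
pose S : R := \sum_(x <- rect tau N N) (normc (u - x))^-1.
have S0 : 0 <= S by apply: sumr_ge0 => x _; rewrite invr_ge0 normc_ge0.
exists (1 + S) => _ /latticeP[k [n ->]]; set g := lpt tau k n.
have gn0 : 0 < normc (u - g) by rewrite normc_gt0 sub_lattice_neq0 //; apply/latticeP; exists k, n.
have [gN|gN] := boolP (g \in rect tau N N).
  rewrite /S (big_rem g) //= addrCA lerDl addr_ge0 // sumr_ge0 // => x _.
  by rewrite invr_ge0 normc_ge0.
suff H : 1 <= normc (u - g).
  by apply: (@le_trans _ _ 1); [rewrite invf_le1|rewrite lerDl].
rewrite leNgt; apply: contra gN => H; rewrite mem_rect.
have : `|k%:~R : R| + `|n%:~R| <= N%:R.
  apply: le_trans (HD k n) _; apply: le_trans HN; rewrite ler_pM2l //.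
  rewrite -/g (_ : g = u - (u - g)); last by rewrite opprB addrC subrK.
  by apply: le_trans (normcD _ _) _; rewrite normcN lerD2l ltW.
rewrite -!intr_norm -!natr_absz -natrD ler_nat => E.
by rewrite !(leq_trans _ E) ?leq_addr ?leq_addl.
Qed.

(** The three parts of a term combine to [u^2 / (g^2 (u - g))], of size [|g|^-3]; the exponent 3
    makes the double sum converge absolutely. *)
Lemma zterm_bound : exists2 K : R, 0 <= K &
  forall k n, normc (zterm (lpt tau k n)) <= K * (2 + `|k%:~R| + `|n%:~R|) ^- 3.
Proof.
have [D D0 HD] := lpt_lower; have [S HS] := lattice_dist.
have S0 : 0 <= S.
  have G0 : G 0 by apply/latticeP; exists 0, 0; rewrite /lpt mul0r addr0.
  by apply: le_trans (HS _ G0); rewrite invr_ge0 normc_ge0.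
pose E := normc u * S + 1; have E0 : 0 < E by rewrite /E ltr_wpDl ?mulr_ge0 ?normc_ge0.
exists (normc u ^+ 2 * E * (3 * D) ^+ 3) => [|k n].
  by rewrite !mulr_ge0 ?exprn_ge0 ?normc_ge0 ?(ltW E0) ?mulr_ge0 ?(ltW D0).
set g := lpt tau k n; set w := 2 + _ + _.
have w0 : 0 < w by rewrite /w -addrA ltr_wpDr ?addr_ge0.
have K0 : 0 <= normc u ^+ 2 * E * (3 * D) ^+ 3 / w ^+ 3.
  by rewrite !mulr_ge0 ?invr_ge0 ?exprn_ge0 ?normc_ge0 ?(ltW E0) ?mulr_ge0 ?(ltW D0) ?(ltW w0).
have Gg : G g by apply/latticeP; exists k, n.
rewrite /zterm /patch; case: ifPn => [|_]; last by rewrite normc0.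
rewrite inE => -[_ /= /eqP g0].
have ng : 0 < normc g by rewrite normc_gt0.
have ug := sub_lattice_neq0 Gg; have nug : 0 < normc (u - g) by rewrite normc_gt0.
have -> : (u - g)^-1 + g^-1 + u / g ^+ 2 = u * (u * (g^-1 * (g^-1 * (u - g)^-1))).
  by field; rewrite g0 ug.
rewrite !normcM !normcV.
have H1 : (normc g)^-1 <= 3 * D / w.
  rewrite ler_pdivlMr // ler_pdivrMl //.
  have kn1 : 1 <= `|k%:~R : R| + `|n%:~R|.
    rewrite -!intr_norm -!natr_absz -natrD ler1n.
    rewrite lt0n addn_eq0 !absz_eq0; apply: contra g0 => /andP[/eqP k0 /eqP n0].
    by rewrite /g k0 n0 /lpt mul0r addr0.
  by have := HD k n; rewrite -/g /w; lra.
have H2 : (normc (u - g))^-1 <= E / normc g.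
  rewrite ler_pdivlMr // ler_pdivrMl //.
  apply: le_trans (_ : normc u + normc (u - g) <= _).
    by rewrite -normcB -{1}(subrK u g) addrC normcD.
  rewrite /E mulrDr mulr1 lerD2r mulrCA ler_peMr ?normc_ge0 //.
  by have := HS _ Gg; rewrite -[X in X <= _]mul1r ler_pdivrMr // mulrC.
rewrite [X in _ <= X](_ : _ = normc u * (normc u * (E * (3 * D) ^+ 3 / w ^+ 3))); last by ring.
do 2! (apply: ler_pM; rewrite ?mulr_ge0 ?invr_ge0 ?normc_ge0 //).
have i0 : 0 <= (normc g)^-1 by rewrite invr_ge0 normc_ge0.
have j0 : 0 <= (normc (u - g))^-1 by rewrite invr_ge0 normc_ge0.
apply: le_trans (_ : (3 * D / w) * ((3 * D / w) * (E * (3 * D / w))) <= _).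
  apply: ler_pM => //; first by rewrite mulr_ge0.
  apply: ler_pM => //; apply: le_trans H2 _; rewrite ler_pM2l //.
by rewrite le_eqVlt; apply/orP; left; apply/eqP; field; rewrite gt_eqF.
Qed.

Lemma rect_mono N N' : (N <= N')%N -> {subset rect tau N N <= rect tau N' N'}.
Proof. by move=> NN; exact: rect_sub. Qed.

Lemma zterm_cover x : zterm x != 0 -> exists N, x \in rect tau N N.
Proof.
rewrite /zterm /patch; case: ifPn => [|_]; last by rewrite eqxx.
rewrite inE => -[/latticeP[k [n ->]] _] _; exists (maxn `|k| `|n|).
by rewrite mem_rect leq_maxl leq_maxr.
Qed.

Lemma cvg_zsum (f : int -> nat -> C) (l : int -> C) M :
  (forall k, f k N @[N --> \oo] --> l k) -> zsum (fun k => f k N) M @[N --> \oo] --> zsum l M.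
Proof.
move=> H; elim: M => [|M IH].
  by rewrite zsum0; apply: (@cvgC_ext _ _ _ _ (f 0)) => [N|]; [exact: zsum0|exact: H].
rewrite zsumS; apply: cvgC_ext (fun N => zsumS _ M) _.
by apply: cvgCD; [exact: IH|apply: cvgCD; exact: H].
Qed.

Lemma zterm_uconv : exists2 L, uconv zterm L &
   weierstrass_zeta G u = u^-1 + L.
Proof.
have [K K0 HK] := zterm_bound.
have [|L HL _] := uconv_abs (fun N => rect_uniq N N) rect_mono zterm_cover (M := K * 10).
  move=> N; rewrite big_rect; apply: le_trans (_ : K * zsum (fun k : int => zsum (fun n : int => (2 + `|k%:~R| + `|n%:~R| : R) ^- 3) N) N <= _).
    by rewrite -zsumZ; apply: ler_zsum => k _; rewrite -zsumZ; apply: ler_zsum => n _; exact: HK.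
  by rewrite ler_wpM2l // zsum2_cube.
by exists L => //; rewrite /weierstrass_zeta (uconv_sum HL).
Qed.

(** The zeta series with each row [k] summed to the end. The parts [1/g] of the rows form
    [ct (k tau)], which is odd in [k] and cancels; [1/u] is the term [n = 0] of [ct u]. *)
Definition zetaN M : C := zsum (fun k : int => ct (u - k%:~R * tau)) M + u * zsum (fun k : int => cs (k%:~R * tau)) M.

Lemma zetaN_cvg : zetaN M @[M --> \oo] --> weierstrass_zeta G u.
Proof.
have [L HL ->] := zterm_uconv.
have u0 : u != 0.
  by apply/eqP => u0; apply: Gu; apply/latticeP; exists 0, 0; rewrite u0 /lpt mul0r addr0.
(* Row 0 omits the lattice point 0. [ct 0] and [cs 0] already do so because [0^-1 = 0], but [ct u]
   contains [1/u], which must be removed. *)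
pose row (k : int) : C := ct (u - k%:~R * tau) + ct (k%:~R * tau) + u * cs (k%:~R * tau)
   - (if k == 0 then u^-1 else 0).
have rowE (k : int) : zsum (fun n => zterm (lpt tau k n)) N @[N --> \oo] --> row k.
  pose d N := zsum (fun n : int => if (k == 0) && (n == 0) then u^-1 else 0) N.
  have Ed N : d N = if k == 0 then u^-1 else 0.
    rewrite /d zsumE andbT big1 ?addr0 // => n _.
    by rewrite !andbF addr0.
  apply: (@cvgC_ext _ _ _ _ (fun N => ctN (u - k%:~R * tau) N + ctN (k%:~R * tau) N + u * csN (k%:~R * tau) N - d N)).
    move=> N; rewrite [ctN (k%:~R * tau) N]ctNE csNE /ctN /d -zsumZ -zsumN -!zsumD.
    apply: eq_zsum => n; rewrite /zterm /patch.
    have Gg : G (lpt tau k n) by apply/latticeP; exists k, n.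
    case: ifPn => [|].
      rewrite inE => -[_ /= /eqP g0]; rewrite ifF ?subr0 /lpt ?opprD ?addrA //.
      by apply: contraNF g0 => /andP[/eqP -> /eqP ->]; rewrite /lpt mul0r addr0.
    rewrite notin_setE /= => Hn.
    have g0 : lpt tau k n = lpt tau 0 0.
      by apply: contra_notP Hn => g0; split=> //= g00; apply: g0; rewrite g00 /lpt mul0r addr0.
    have [-> ->] := lpt_inj g0.
    by rewrite !eqxx /= mul0r add0r !subr0 expr0n invr0 mulr0 !addr0 subrr.
  apply: cvgCB; last by under eq_fun do rewrite Ed; exact: cvgC_cst.
  apply: cvgCD; first by apply: cvgCD; exact: ctN_cvg.
  by apply: cvgCM; [exact: cvgC_cst|exact: csN_cvg].
have rows : zsum row M @[M --> \oo] --> L.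
  apply/cvgCP => e e0; have e2 : 0 < e / 2 by rewrite divr_gt0.
  have [s0 Hs] := HL _ e2.
  have [N0 _ HN0] := cover_seq rect_mono zterm_cover 0 s0.
  exists N0 => // M /= NM; rewrite normcB; apply: le_lt_trans (_ : e / 2 < e); last by lra.
  have L1 : (zsum (fun k => zsum (fun n => zterm (lpt tau k n)) N) M - L) @[N --> \oo] --> zsum row M - L.
    by apply: cvgCB; [exact: cvg_zsum|exact: cvgC_cst].
  apply: (cvgC_le _ L1); exists N0 => // N /= NN.
  (* Unordered convergence needs a superset of [s0]. The points of [s0] outside the rectangle are
     added at no cost, since their terms vanish; so [M] can stay fixed while [N] grows. *)
  rewrite -big_rect; pose s := rect tau M N ++ [seq x <- undup s0 | x \notin rect tau M N].
  have us : uniq s.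
    rewrite cat_uniq rect_uniq filter_uniq ?undup_uniq // andbT.
    by apply/hasPn => x; rewrite mem_filter => /andP[].
  have sub : {subset s0 <= s}.
    by move=> x xs; rewrite mem_cat mem_filter mem_undup xs andbT orbN.
  suff <- : \sum_(x <- s) zterm x = \sum_(x <- rect tau M N) zterm x by exact: Hs.
  rewrite big_cat /= [X in _ + X = _]big1_seq ?addr0 // => x /=.
  rewrite mem_filter mem_undup => /andP[xr xs]; apply/eqP; apply: contraNT xr => fx.
  by apply: (rect_sub NM NN); exact: HN0.
have E M : zetaN M = u^-1 + zsum row M.
  rewrite /zetaN /row zsumD zsumN zsumD zsumD zsumZ.
  have -> : zsum (fun k : int => if k == 0 then u^-1 else 0) M = u^-1.
    rewrite zsumE eqxx big1 ?addr0 // => n _.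
    by rewrite addr0.
  have -> : zsum (fun k : int => ct (k%:~R * tau)) M = 0.
    have : zsum (fun k : int => ct (k%:~R * tau)) M = - zsum (fun k : int => ct (k%:~R * tau)) M.
      rewrite -[LHS]zsum_opp -zsumN; apply: eq_zsum => k.
      by rewrite mulrNz mulNr ct_opp.
    by move/eqP; rewrite -addr_eq0 -mulr2n mulrn_eq0 /= => /eqP.
  by rewrite addr0; ring.
by apply: cvgC_ext E _; apply: cvgCD; [exact: cvgC_cst|].
Qed.

End WeierstrassZeta.

Section QuasiPeriods.
Variable R : realType.
Local Notation C := R[i].
Local Notation Re := (@complex.Re R).
Local Notation Im := (@complex.Im R).

(** Eisenstein's conditionally convergent sum of [(k tau + n)^-2], inner sum over [n]; the origin is
    omitted because [0^-1 = 0]. *)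
Definition G2 (tau : C) : C := lim (zsum (fun k : int => cs (k%:~R * tau)) M @[M --> \oo]).

Lemma cvg_exprC (q : C) : normc q < 1 -> q ^+ n @[n --> \oo] --> (0 : C).
Proof.
move=> q1; apply: (@cvgC_squeeze _ _ _ _ _ _ (fun n => normc q ^+ n)).
  by apply: nearW => n; rewrite subr0 normcX.
by apply: cvg_expr; rewrite ger0_norm ?normc_ge0.
Qed.

(** The cotangent tends to [-i] high in the upper half plane, because [q -> 0] there; [u] itself may
    be anywhere, so a first translate is chosen with positive imaginary part. *)
Lemma ct_cvg_up (tau u : C) : 0 < Im tau ->
  ct (u + M%:R * tau) @[M --> \oo] --> - iPi R.
Proof.
move=> t0; have [N HN] : exists N : nat, 0 < Im (u + N%:R * tau).
  exists (Num.Def.archi_bound (`|Im u| / Im tau)).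
  rewrite !cplxE mul0r addr0.
  have : `|Im u| / Im tau < (Num.Def.archi_bound (`|Im u| / Im tau))%:R.
    by apply: archi_boundP; rewrite divr_ge0 // ltW.
  rewrite ltr_pdivrMr // => H; have := ler_norm (- Im u); rewrite normrN; lra.
rewrite -(cvg_shiftn N.+1) /=; set w := u + N%:R * tau in HN.
pose f m := - iPi R * (1 + nome w * (nome tau * nome tau ^+ m)) / (1 - nome w * (nome tau * nome tau ^+ m)).
apply: (@cvgC_ext _ _ _ _ f).
  move=> m; have m0 : 0 < Im (m.+1%:R * tau) by rewrite !cplxE mul0r addr0 mulr_gt0.
  have -> : u + (m + N.+1)%:R * tau = w + m.+1%:R * tau.
    by rewrite /w addnS -addSn addnC natrD mulrDl addrA.
  have s0 : 0 < Im (w + m.+1%:R * tau) by rewrite ImD addr_gt0.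
  by rewrite (ct_nome s0) (nomeD HN m0) (nomeM m t0) exprS.
have H0 : (nome w * (nome tau * nome tau ^+ m)) @[m --> \oo] --> nome w * (nome tau * 0).
  by apply: cvgCM; [exact: cvgC_cst|apply: cvgCM; [exact: cvgC_cst|exact/cvg_exprC/normc_nome_lt1]].
rewrite !mulr0 in H0.
suff H : f m @[m --> \oo] --> - iPi R * (1 + 0) * (1 - 0)^-1.
  by rewrite addr0 subr0 invr1 !mulr1 in H.
apply: cvgCM; first apply: cvgCM; first exact: cvgC_cst.
- by apply: cvgCD; [exact: cvgC_cst|exact: H0].
- apply: cvgCV; first by rewrite subr0 oner_eq0.
  by apply: cvgCB; [exact: cvgC_cst|exact: H0].
Qed.

Section Lattice.
Variable tau : C.
Hypothesis tau0 : 0 < Im tau.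
Let G := lattice tau 1.

Lemma lattice_half : ~ G (2^-1 * tau).
Proof.
move=> /(latticeP tau)[k [n E]]; have := congr1 Im E.
have -> : (2^-1 : C) = (2^-1 : R)%:C by rewrite fmorphV rmorph_nat.
rewrite /lpt !cplxE !mul0r !addr0 => /(mulIf (lt0r_neq0 tau0)) H.
have : (2 * k)%:~R = 1%:~R :> R by rewrite rmorphM /= -H divff.
by move/intr_inj; lia.
Qed.

Lemma latticeD1 u : ~ G u -> ~ G (u + 1).
Proof.
move=> H /(latticeP tau)[k [n E]]; apply: H; apply/latticeP; exists k, (n - 1).
by rewrite -(addrK 1 u) E /lpt rmorphB /= addrA.
Qed.

Lemma latticeDtau u : ~ G u -> ~ G (u + tau).
Proof.
move=> H /(latticeP tau)[k [n E]]; apply: H; apply/latticeP; exists (k - 1), n.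
by rewrite -(addrK tau u) E /lpt rmorphB /= mulrBl mul1r addrAC.
Qed.

Lemma zetaN1 u M : zetaN tau (u + 1) M = zetaN tau u M + zsum (fun k : int => cs (k%:~R * tau)) M.
Proof.
rewrite /zetaN mulrDl mul1r addrA; congr (_ + _ + _); apply: eq_zsum => k.
by rewrite addrAC ct1.
Qed.

(** No separate estimate is required: by the period 1 of [ct], the partial sum is the difference of
    [zetaN] at two points, and [zetaN] converges at both. *)
Lemma G2_cvg : zsum (fun k : int => cs (k%:~R * tau)) M @[M --> \oo] --> G2 tau.
Proof.
have H := lattice_half; have H1 := latticeD1 H.
suff [l Hl] : exists l : C, zsum (fun k : int => cs (k%:~R * tau)) M @[M --> \oo] --> l.
  by rewrite /G2 (@cvg_lim _ _ _ _ _ _ _ Hl) //; exact: norm_hausdorff.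
exists (weierstrass_zeta G (2^-1 * tau + 1) - weierstrass_zeta G (2^-1 * tau)).
apply: (@cvgC_ext _ _ _ _ (fun M => zetaN tau (2^-1 * tau + 1) M - zetaN tau (2^-1 * tau) M)).
  by move=> M; rewrite zetaN1 addrAC subrr add0r.
by apply: cvgCB; exact: zetaN_cvg.
Qed.

Lemma zeta1 u : ~ G u -> weierstrass_zeta G (u + 1) = weierstrass_zeta G u + G2 tau.
Proof.
move=> H; have H1 := latticeD1 H.
apply: (cvgC_unique _ (@zetaN_cvg R tau tau0 _ H1)).
apply: cvgC_ext (zetaN1 u) _.
by apply: cvgCD; [exact: zetaN_cvg|exact: G2_cvg].
Qed.

(** Translation by [tau] shifts the rows by one. The two end terms each tend to [- iPi], which is
    the source of Legendre's relation between the quasi-periods. *)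
Lemma zetatau u : ~ G u ->
  weierstrass_zeta G (u + tau) = weierstrass_zeta G u + (tau * G2 tau - 2 * iPi R).
Proof.
move=> H; have H1 := latticeDtau H.
apply: (cvgC_unique _ (@zetaN_cvg R tau tau0 _ H1)).
have E M : zetaN tau (u + tau) M = zetaN tau u M +
    (tau * zsum (fun k : int => cs (k%:~R * tau)) M + (ct (u + tau + M%:R * tau) + ct (- u + M%:R * tau))).
  rewrite /zetaN mulrDl.
  have S v : zsum (fun k : int => ct (v - k%:~R * tau)) M = zsum (fun k : int => ct (v + k%:~R * tau)) M.
    by rewrite -zsum_opp; apply: eq_zsum => k; rewrite mulrNz mulNr opprK.
  rewrite (S (u + tau)) (S u).
  have -> : zsum (fun k : int => ct (u + tau + k%:~R * tau)) M = zsum (fun k : int => ct (u + (k + 1)%:~R * tau)) M.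
    by apply: eq_zsum => k; rewrite rmorphD /= mulrDl mul1r addrA addrAC.
  rewrite (zsum_shift (fun k : int => ct (u + k%:~R * tau))).
  have -> : u + (M%:Z + 1)%:~R * tau = u + tau + M%:R * tau by rewrite rmorphD /= mulrDl mul1r addrA addrAC.
  have -> : ct (- u + M%:R * tau) = - ct (u + (- M%:Z)%:~R * tau) by rewrite -ct_opp mulrNz mulNr opprB addrC.
  by ring.
apply: cvgC_ext E _; apply: cvgCD; first exact: zetaN_cvg.
apply: cvgCD; first by apply: cvgCM; [exact: cvgC_cst|exact: G2_cvg].
rewrite mulr_natl mulr2n opprD.
by apply: cvgCD; exact: ct_cvg_up.
Qed.

End Lattice.

(** A point off the lattice makes the constant chosen by [get] unique; [lattice_half] supplies
    one. *)
Lemma quasi_periodP (G : set C) (w eta : C) : (exists u, ~ G u) ->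
  (forall u, ~ G u -> weierstrass_zeta G (u + w) = weierstrass_zeta G u + eta) ->
  quasi_period G w = eta.
Proof.
move=> [u Gu] H; have := @getPex _ [set eta : C | forall u : C, ~ G u -> weierstrass_zeta G (u + w) = weierstrass_zeta G u + eta].
by move=> /(_ (ex_intro _ _ H)) /(_ u Gu); rewrite H // => /addrI ->.
Qed.

Lemma pE (tau : C) : 0 < Im tau ->
  p tau = if G2 tau == 0 then infty R else fin (tau - 2 * iPi R / G2 tau).
Proof.
move=> t0; rewrite /p /quasi_period_ratio.
have ex : exists u, ~ lattice tau 1 u by exists (2^-1 * tau); exact: lattice_half.
rewrite (quasi_periodP ex (zeta1 t0)) (quasi_periodP ex (zetatau t0)).
by case: eqVneq => // g0; rewrite mulrBl mulfK.
Qed.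

Lemma lattice_inv (tau : C) : tau != 0 ->
  lattice (- tau^-1) 1 = [set tau^-1 * x | x in lattice tau 1].
Proof.
move=> t0; apply/seteqP; split=> x.
  case=> k _ [n _ <-]; exists (n%:~R * tau + (- k)%:~R * 1); first by exists n => //; exists (- k).
  by rewrite mulrNz; field.
case=> _ [k _ [n _ <-]] <-; exists (- n) => //; exists k => //.
by rewrite mulrNz; field.
Qed.

(** Scaling by [tau^-1] maps one lattice onto the other but turns rows into columns, so the
    comparison has to be made on the unordered sums; the row sums would not allow it. *)
Lemma zeta_scale (tau u : C) : 0 < Im tau -> ~ lattice tau 1 u ->
  weierstrass_zeta (lattice (- tau^-1) 1) (tau^-1 * u) = tau * weierstrass_zeta (lattice tau 1) u.
Proof.
move=> t0 Gu.
have tn0 : tau != 0 by apply: contraTneq t0 => ->; rewrite ltxx.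
have [L HL ->] := zterm_uconv t0 Gu.
have := uconv_scale _ HL; move=> /(_ tau^-1); rewrite invr_eq0 tn0 invrK => /(_ isT) H.
rewrite /weierstrass_zeta invfM invrK mulrDr; congr (_ + _); rewrite -(uconv_sum H).
congr (summability.sum _); apply/funext => x; rewrite /zterm /patch.
have E : (x \in lattice (- tau^-1) 1 `\ (0 : C)) = (tau * x \in lattice tau 1 `\ (0 : C)).
  apply/idP/idP; rewrite !inE lattice_inv // => -[].
    by case=> y Gy <- /eqP; rewrite mulf_eq0 negb_or => /andP[_ y0]; rewrite mulVKf //; split=> //; apply/eqP.
  move=> Gx x0; split; first by exists (tau * x) => //; rewrite mulKf.
  by move=> /= x00; apply: x0; rewrite /= x00 mulr0.
rewrite E; case: ifPn => [|_]; last by rewrite mulr0.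
rewrite inE => -[Gx /= /eqP]; rewrite mulf_eq0 negb_or => /andP[_ x0].
have := sub_lattice_neq0 Gu Gx => ux.
have ux' : tau^-1 * u - x != 0.
  by apply: contra ux => /eqP /(congr1 (fun v => tau * v)); rewrite mulrBr mulVKf // mulr0 => ->.
by field; rewrite x0 tn0 ux.
Qed.

Lemma Im_invN (tau : C) : 0 < Im tau -> 0 < Im (- tau^-1).
Proof.
move=> t0; rewrite ImN Im_inv mulNr opprK divr_gt0 // exprn_gt0 // normc_gt0.
by apply: contraTneq t0 => ->; rewrite ltxx.
Qed.

(** The period 1 of the scaled lattice is [tau^-1 * tau], so its quasi-period is [tau] times that of
    the period [tau]. *)
Lemma G2_inv (tau : C) : 0 < Im tau -> G2 (- tau^-1) = tau * (tau * G2 tau - 2 * iPi R).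
Proof.
move=> t0; have t0' := Im_invN t0.
have tn0 : tau != 0 by apply: contraTneq t0 => ->; rewrite ltxx.
have Gh := lattice_half t0.
have Gh' : ~ lattice (- tau^-1) 1 (tau^-1 * (2^-1 * tau)).
  by rewrite lattice_inv // => -[y Gy /mulfI]; rewrite invr_eq0 => /(_ tn0) E; apply: Gh; rewrite -E.
have := zeta1 t0' Gh'.
have -> : tau^-1 * (2^-1 * tau) + 1 = tau^-1 * (2^-1 * tau + tau) by rewrite mulrDr mulVf.
rewrite !zeta_scale //; last exact: latticeDtau.
by rewrite zetatau // mulrDr => /addrI.
Qed.

End QuasiPeriods.

(** * The Eisenstein series *)

Section DoubleSums.
Variable R : realType.
Local Notation C := R[i].
Local Notation Re := (@complex.Re R).
Local Notation Im := (@complex.Im R).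

Definition dsum (K : pzRingType) (a : nat -> nat -> nat) (q : K) (M : nat) : K :=
  \sum_(m < M) \sum_(k < M) (a m k)%:R * q ^+ (m.+1 * k.+1).

(** The hook added when the square of indices grows by one; it turns the double sum into a simple
    series. *)
Definition dlayer (K : pzRingType) (a : nat -> nat -> nat) (q : K) (M : nat) : K :=
  \sum_(m < M) (a m M)%:R * q ^+ (m.+1 * M.+1) + \sum_(k < M.+1) (a M k)%:R * q ^+ (M.+1 * k.+1).

Lemma dsumE (K : pzRingType) a (q : K) M : dsum a q M = \sum_(j < M) dlayer a q j.
Proof.
elim: M => [|M IH]; first by rewrite /dsum !big_ord0.
rewrite big_ord_recr /= -IH /dsum /dlayer big_ord_recr /=.
under eq_bigr => m _ do rewrite big_ord_recr /=.
by rewrite big_split /= addrA.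
Qed.

Lemma normc_dlayer a (q : C) j : normc (dlayer a q j) <= dlayer a (normc q) j.
Proof.
apply: le_trans (normcD _ _) _; apply: lerD; apply: le_trans (normc_sum _ _ _) _;
  by apply: ler_sum => k _; rewrite normcM normc_nat normcX.
Qed.

Lemma normc_dsum a (q : C) M : normc (dsum a q M) <= dsum a (normc q) M.
Proof.
apply: le_trans (normc_sum _ _ _) _; apply: ler_sum => m _.
by apply: le_trans (normc_sum _ _ _) _; apply: ler_sum => k _; rewrite normcM normc_nat normcX.
Qed.

Definition geo (i : nat) (r : R) M : R := \sum_(m < M) m.+1%:R ^+ i * r ^+ m.

Lemma geo_ge0 i (r : R) M : 0 <= r -> 0 <= geo i r M.
Proof. by move=> r0; apply: sumr_ge0 => m _; rewrite mulr_ge0 ?exprn_ge0. Qed.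

Lemma geo0_le (r : R) M : 0 <= r < 1 -> \sum_(m < M) r ^+ m <= (1 - r)^-1.
Proof.
case/andP=> r0 r1; have d0 : 0 < 1 - r by rewrite subr_gt0.
rewrite -[leRHS]mul1r ler_pdivlMr // mulrC.
suff -> : (1 - r) * \sum_(m < M) r ^+ m = 1 - r ^+ M by rewrite gerBl exprn_ge0.
by rewrite -[RHS]opprB subrX1 -mulNr opprB.
Qed.

(** Summation by parts lowers the power: [(1 - r) geo (i+1) <= (i + 1) geo i], because [(M +
    1)^(i+1) - M^(i+1) <= (i + 1) (M + 1)^i]. *)
Lemma geo_bounded i (r : R) : 0 <= r < 1 -> exists2 K, 0 <= K & forall M, geo i r M <= K.
Proof.
case/andP=> r0 r1; have d0 : 0 < 1 - r by rewrite subr_gt0.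
have P j M : M.+1%:R ^+ j.+1 - M%:R ^+ j.+1 <= j.+1%:R * M.+1%:R ^+ j :> R.
  have N1 : (M%:R : R) <= M.+1%:R by rewrite ler_nat.
  elim: j => [|j IH]; first by rewrite !expr1 expr0 mulr1 -natr1; lra.
  have -> : M.+1%:R ^+ j.+2 - M%:R ^+ j.+2 = M.+1%:R * (M.+1%:R ^+ j.+1 - M%:R ^+ j.+1) + M%:R ^+ j.+1 :> R.
    by rewrite !(exprS _ j.+1) -natr1; ring.
  rewrite -[j.+2%:R]natr1 mulrDl mul1r; apply: lerD; last first.
    by apply: lerXn2r N1; rewrite nnegrE.
  have -> : j.+1%:R * M.+1%:R ^+ j.+1 = M.+1%:R * (j.+1%:R * M.+1%:R ^+ j) :> R by rewrite exprS mulrCA.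
  by rewrite ler_wpM2l.
elim: i => [|i [K K0 HK]].
  exists (1 - r)^-1 => [|M]; first by rewrite invr_ge0 ltW.
  by rewrite /geo; under eq_bigr do rewrite expr0 mul1r; apply: geo0_le; rewrite r0.
exists (i.+1%:R * K / (1 - r)) => [|M]; first by rewrite divr_ge0 ?mulr_ge0 // ltW.
rewrite ler_pdivlMr //; apply: (@le_trans _ _ (i.+1%:R * geo i r M)); last by rewrite ler_wpM2l.
suff : geo i.+1 r M * (1 - r) + M%:R ^+ i.+1 * r ^+ M <= i.+1%:R * geo i r M.
  by apply: le_trans; rewrite lerDl mulr_ge0 ?exprn_ge0.
elim: M => [|M IH]; first by rewrite /geo !big_ord0 mul0r mulr0 expr0n mul0r addr0.
rewrite /geo !big_ord_recr /=.
have := ler_wpM2r (exprn_ge0 M r0) (P i M).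
rewrite [r ^+ M.+1]exprS; move: IH; rewrite /geo.
move: (\sum_(m < M) _) (\sum_(m < M) _) (M.+1%:R ^+ i.+1) (M%:R ^+ i.+1) (r ^+ M) (M.+1%:R ^+ i) (i.+1%:R : R).
by move=> g h A B D E n; lra.
Qed.

(** [m + 1 <= 2^m] absorbs the polynomial factor into the ratio. This is the explicit version for
    small [r], nearly sharp for the nomes in question. *)
Lemma geo_small i (r : R) M : 0 <= r -> 2 ^+ i * r < 1 -> geo i r M <= (1 - 2 ^+ i * r)^-1.
Proof.
move=> r0 r1; apply: le_trans (_ : \sum_(m < M) (2 ^+ i * r) ^+ m <= _); last first.
  by apply: geo0_le; rewrite r1 mulr_ge0 // exprn_ge0.
apply: ler_sum => m _; rewrite exprMn; apply: ler_wpM2r; first exact: exprn_ge0.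
rewrite exprAC; apply: lerXn2r; rewrite ?nnegrE ?exprn_ge0 //.
by rewrite -natrX ler_nat; apply: ltn_expl.
Qed.

(** [(m + 1) (k + 1) >= 1 + m + k] separates the two indices. *)
Lemma dsum_le_geo a i j (r : R) M : 0 <= r <= 1 ->
  (forall m k, a m k <= m.+1 ^ i * k.+1 ^ j)%N ->
  dsum a r M <= r * (geo i r M * geo j r M).
Proof.
case/andP=> r0 r1 H; rewrite /dsum /geo big_distrl big_distrr /=; apply: ler_sum => m _.
rewrite !big_distrr /=; apply: ler_sum => k _.
have E : (m.+1 * k.+1 = 1 + (m + k) + m * k)%N by lia.
have -> : r * (m.+1%:R ^+ i * r ^+ m * (k.+1%:R ^+ j * r ^+ k)) = (m.+1%:R ^+ i * k.+1%:R ^+ j) * r ^+ (1 + (m + k)).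
  by rewrite !exprD; ring.
apply: ler_pM; rewrite ?exprn_ge0 //; first by rewrite -!natrX -natrM ler_nat.
by rewrite E exprD ler_piMr ?exprn_ge0 // exprn_ile1.
Qed.

Lemma dsum_bounded a i j (r : R) : 0 <= r < 1 ->
  (forall m k, a m k <= m.+1 ^ i * k.+1 ^ j)%N -> exists2 K, 0 <= K & forall M, dsum a r M <= K.
Proof.
case/andP=> r0 r1 H; have r01 : 0 <= r < 1 by rewrite r0.
have [K K0 HK] := geo_bounded i r01; have [L L0 HL] := geo_bounded j r01.
exists (r * (K * L)) => [|M]; first by rewrite !mulr_ge0.
apply: le_trans (dsum_le_geo _ _ H) _; first by rewrite r0 ltW.
by rewrite ler_wpM2l // ler_pM ?geo_ge0.
Qed.

Lemma cvg_sum_dom (f : nat -> C) (g : nat -> R) (B : R) :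
  (forall n, normc (f n) <= g n) -> (forall N, \sum_(n < N) g n <= B) ->
  exists l : C, (\sum_(n < N) f n) @[N --> \oo] --> l.
Proof.
move=> fg gB; pose t N := \sum_(n < N) g n.
have g0 n : 0 <= g n by apply: le_trans (fg n); exact: normc_ge0.
have tmono : nondecreasing_seq t.
  move=> N N' NN'; rewrite /t -!(big_mkord xpredT g) (@big_cat_nat _ _ _ N 0 N') //= lerDl.
  by rewrite sumr_ge0.
have tcvg : cvgn t by apply: nondecreasing_is_cvgn tmono _; exists B => _ [N _ <-]; exact: gB.
apply: cauchyC_cvg => e e0.
have /cvgrPdist_lt/(_ _ e0)[N _ HN] := tcvg.
exists [set N' | (N <= N')%N]; first by exists N.
have aux s u : (N <= s)%N -> (s <= u)%N -> normc (\sum_(n < s) f n - \sum_(n < u) f n) < e.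
  move=> Ns su; apply: (@le_lt_trans _ _ (t u - t s)); last first.
    apply: le_lt_trans (HN s Ns); apply: le_trans (ler_norm _).
    by rewrite lerB // (nondecreasing_cvgn_le tmono tcvg).
  have -> : \sum_(n < s) f n - \sum_(n < u) f n = - \sum_(s <= n < u) f n.
    by rewrite -!(big_mkord xpredT f) (@big_cat_nat _ _ _ s 0 u) //= opprD addNKr.
  have -> : t u - t s = \sum_(s <= n < u) g n.
    by rewrite /t -!(big_mkord xpredT g) (@big_cat_nat _ _ _ s 0 u) //= addrAC subrr add0r.
  by rewrite normcN; apply: le_trans (normc_sum _ _ _) _; apply: ler_sum.
move=> s u /= Hs Hu; have [su|us] := leqP s u; first exact: aux.
by rewrite normcB; apply: aux => //; exact: ltnW.
Qed.

Definition dser (a : nat -> nat -> nat) (q : C) : C := lim (dsum a q M @[M --> \oo]).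

Lemma dsum_cvg a i j (q : C) : normc q < 1 ->
  (forall m k, a m k <= m.+1 ^ i * k.+1 ^ j)%N -> dsum a q M @[M --> \oo] --> dser a q.
Proof.
move=> q1 H; have q01 : 0 <= normc q < 1 by rewrite normc_ge0.
suff [l Hl] : exists l : C, dsum a q M @[M --> \oo] --> l.
  by rewrite /dser (@cvg_lim _ _ _ _ _ _ _ Hl) //; exact: norm_hausdorff.
have [K K0 HK] := dsum_bounded q01 H.
have [|l Hl] := @cvg_sum_dom (dlayer a q) (dlayer a (normc q)) K (normc_dlayer a q).
  by move=> N; rewrite -dsumE.
by exists l; apply: cvgC_ext Hl => M; exact: dsumE.
Qed.

(** With these weights, collecting equal powers gives the series of [sigma_1(n) q^n] for [wS] and of
    [n sigma_1(n) q^n] for [wD], the image of the former under [q d/dq]. *)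
Definition wS (m k : nat) : nat := k.+1.
Definition wD (m k : nat) : nat := k.+1 * (m.+1 * k.+1).

Lemma wS_le m k : (wS m k <= m.+1 ^ 0 * k.+1 ^ 1)%N. Proof. by rewrite expn0 mul1n expn1. Qed.
Lemma wD_le m k : (wD m k <= m.+1 ^ 1 * k.+1 ^ 2)%N.
Proof. by rewrite /wD expn1 expnS expn1 mulnCA. Qed.

(** The bound is [n^2 r^(n-2) |h|^2]; dividing by [r^2] keeps it meaningful for [n < 2]. *)
Lemma exprn_taylor (x h : C) (r : R) n : 0 < r -> normc x <= r -> normc (x + h) <= r ->
  normc ((x + h) ^+ n - x ^+ n - n%:R * x ^+ n.-1 * h) <= (n ^ 2)%:R * r ^+ n / r ^+ 2 * normc h ^+ 2.
Proof.
move=> r0 xr xhr; elim: n => [|n IH].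
  by rewrite !expr0 subrr !mul0r subrr normc0.
have -> : (x + h) ^+ n.+1 - x ^+ n.+1 - n.+1%:R * x ^+ n.+1.-1 * h =
   (x + h) * ((x + h) ^+ n - x ^+ n - n%:R * x ^+ n.-1 * h) + n%:R * x ^+ n.-1 * h ^+ 2.
  case: n {IH} => [|n] /=; first by ring.
  by rewrite -[n.+2%:R]natr1 !exprS; ring.
apply: le_trans (normcD _ _) _; rewrite normcM.
apply: le_trans (lerD (ler_pM (normc_ge0 _) (normc_ge0 _) xhr IH) (lexx _)) _.
have -> : normc (n%:R * x ^+ n.-1 * h ^+ 2) = n%:R * normc x ^+ n.-1 * normc h ^+ 2.
  by rewrite (normcM _ (h ^+ 2)) (normcM _ (x ^+ n.-1)) !normcX normc_nat.
have H : n%:R * normc x ^+ n.-1 <= n%:R * r ^+ n.+1 / r ^+ 2.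
  case: n {IH} => [|n]; first by rewrite !mul0r.
  have -> : n.+1%:R * r ^+ n.+2 / r ^+ 2 = n.+1%:R * r ^+ n by rewrite !exprS; field; rewrite gt_eqF.
  by rewrite ler_wpM2l //; apply: lerXn2r xr; rewrite nnegrE ?normc_ge0 ?(ltW r0).
apply: le_trans (lerD (lexx _) (ler_wpM2r (sqr_ge0 _) H)) _.
have -> : r * ((n ^ 2)%:R * r ^+ n / r ^+ 2 * normc h ^+ 2) + n%:R * r ^+ n.+1 / r ^+ 2 * normc h ^+ 2
  = ((n ^ 2)%:R + n%:R) * r ^+ n.+1 / r ^+ 2 * normc h ^+ 2.
  by rewrite (exprS r n); move: (n ^ 2)%N => n2; field; rewrite gt_eqF.
rewrite ler_wpM2r ?sqr_ge0 // ler_wpM2r ?invr_ge0 ?sqr_ge0 // ler_wpM2r ?exprn_ge0 ?(ltW r0) //.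
by rewrite -natrD ler_nat !expnS !expn0; lia.
Qed.

(** Termwise Taylor bounds, as for [ct]: on the disc of radius [r] halfway between [|q|] and 1 the
    remainders are dominated by the series with the extra weight [n^2]. *)
Lemma cder_dser (q : C) : q != 0 -> normc q < 1 -> cder (dser wS) q (dser wD q / q).
Proof.
move=> q0 q1; set r := (1 + normc q) / 2; have nq := normc_ge0 q.
have r0 : 0 < r by rewrite divr_gt0 // ltr_pwDl.
have r1 : r < 1 by rewrite /r; lra.
have d0 : 0 < (1 - normc q) / 2 by rewrite divr_gt0 // subr_gt0.
pose w3 m k := (k.+1 * (m.+1 * k.+1) ^ 2)%N.
have w3_le m k : (w3 m k <= m.+1 ^ 2 * k.+1 ^ 3)%N.
  by rewrite /w3 !expnS !expn0; lia.
have r01 : 0 <= r < 1 by rewrite (ltW r0).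
have [K K0 HK] := dsum_bounded r01 w3_le.
apply: (cder_quad (K := K / r ^+ 2) d0) => h hd.
have qh : normc (q + h) <= r by apply: le_trans (normcD _ _) _; rewrite /r; lra.
have qr : normc q <= r by rewrite /r; lra.
have L : (dsum wS (q + h) M - dsum wS q M - dsum wD q M / q * h) @[M --> \oo] --> dser wS (q + h) - dser wS q - dser wD q / q * h.
  apply: cvgCB; first by apply: cvgCB; apply: (dsum_cvg _ wS_le) => //; exact: le_lt_trans qh r1.
  by apply: cvgCM; [apply: cvgCM; [exact: (dsum_cvg _ wD_le)|]|]; exact: cvgC_cst.
apply: (cvgC_le _ L); apply: nearW => M.
have -> : dsum wS (q + h) M - dsum wS q M - dsum wD q M / q * h =
  \sum_(m < M) \sum_(k < M) (wS m k)%:R * ((q + h) ^+ (m.+1 * k.+1) - q ^+ (m.+1 * k.+1) - (m.+1 * k.+1)%:R * q ^+ (m.+1 * k.+1).-1 * h).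
  rewrite /dsum 2!big_distrl /= -!sumrB; apply: eq_bigr => m _.
  rewrite 2!big_distrl /= -!sumrB; apply: eq_bigr => k _.
  rewrite /wD /wS (natrM _ k.+1); set N := (m.+1 * k.+1)%N.
  have -> : q ^+ N = q * q ^+ N.-1 by rewrite -exprS.
  by field.
apply: le_trans (normc_sum _ _ _) _.
apply: (@le_trans _ _ (dsum w3 r M / r ^+ 2 * normc h ^+ 2)); last first.
  by rewrite ler_wpM2r ?sqr_ge0 // ler_wpM2r ?invr_ge0 ?sqr_ge0.
rewrite /dsum 2!big_distrl /=; apply: ler_sum => m _.
apply: le_trans (normc_sum _ _ _) _; rewrite 2!big_distrl /=; apply: ler_sum => k _.
rewrite normcM normc_nat /w3 /wS; set N := (m.+1 * k.+1)%N.
rewrite (natrM _ k.+1) -3!(mulrA k.+1%:R) ler_wpM2l //; exact: exprn_taylor.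
Qed.

End DoubleSums.

Section EisensteinSeries.
Variable R : realType.
Local Notation C := R[i].
Local Notation Re := (@complex.Re R).
Local Notation Im := (@complex.Im R).

(** A zero at [z] would give, by [nome (z/2)^2 = nome z], zeros at all [z / 2^n], against
    [nome -> 1] near 0. *)
Lemma nome_neq0 (z : C) : 0 < Im z -> nome z != 0.
Proof.
move=> z0; apply/eqP => q0.
have half w : 0 < Im w -> nome w = 0 -> nome ((2^-1 : R)%:C * w) = 0.
  move=> w0 w00; have h0 : 0 < Im ((2^-1 : R)%:C * w) by rewrite !cplxE mul0r addr0 mulr_gt0.
  have E : (2^-1 : R)%:C * w + (2^-1 : R)%:C * w = w.
    by rewrite -mulrDl -rmorphD (_ : 2^-1 + 2^-1 = 1) ?mul1r //; field.
  have := nomeD h0 h0; rewrite E w00.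
  by move/esym/eqP; rewrite mulf_eq0 orbb => /eqP.
have H n : 0 < Im ((2^-1 ^+ n : R)%:C * z) /\ nome ((2^-1 ^+ n : R)%:C * z) = 0.
  split; first by rewrite !cplxE mul0r addr0 mulr_gt0 // exprn_gt0.
  elim: n => [|n IH]; first by rewrite expr0 mul1r.
  rewrite exprS rmorphM -mulrA; apply: half => //.
  by rewrite !cplxE mul0r addr0 mulr_gt0 // exprn_gt0.
set K := 2 * Pi R * normc z ^+ 2 / Im z.
have B n : 1 <= 2^-1 ^+ n * K.
  have := nome_at0 z0 (_ : 0 < 2^-1 ^+ n); rewrite (proj2 (H n)) subr0 normc1; apply.
  by rewrite exprn_gt0.
have L : (2^-1 ^+ n * K) @[n --> \oo] --> 0 * K.
  by apply: cvgM; [apply: cvg_expr; rewrite ger0_norm; lra|exact: cvg_cst].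
have L1 : (fun=> 1) n @[n --> \oo] --> (1 : R) by exact: cvg_cst.
by have := ler_cvgn L1 L B; rewrite mul0r ler10.
Qed.

Definition E2 (tau : C) : C := 1 - 24%:R * dser wS (nome tau).
Definition D2 (tau : C) : C := dser wD (nome tau).

Lemma lambert_tail (x : C) M : normc x < 1 ->
  normc (x / (1 - x) ^+ 2 - \sum_(k < M) k.+1%:R * x ^+ k.+1) <= 2 * M.+1%:R * normc x ^+ M.+1 / (1 - normc x) ^+ 2.
Proof.
move=> x1; have nx := normc_ge0 x; have d0 : 0 < 1 - normc x by rewrite subr_gt0.
have dx : 1 - normc x <= normc (1 - x) by have := ler_normcB 1 x; rewrite normc1.
have x0 : 1 - x != 0 by rewrite -normc_gt0; apply: lt_le_trans dx.
have -> : x / (1 - x) ^+ 2 - \sum_(k < M) k.+1%:R * x ^+ k.+1 = x ^+ M.+1 * (M.+1%:R - M%:R * x) / (1 - x) ^+ 2.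
  elim: M => [|M IH]; first by rewrite big_ord0 subr0 expr1 mul0r subr0 mulr1.
  rewrite big_ord_recr /= opprD addrA IH -[M.+2%:R]natr1 -natr1 !exprS.
  by field.
rewrite !normcM normcV normcX normcX; apply: ler_pM; rewrite ?mulr_ge0 ?invr_ge0 ?exprn_ge0 ?normc_ge0 //.
  rewrite mulrC ler_wpM2r ?exprn_ge0 //; apply: le_trans (normcD _ _) _.
  rewrite normcN normcM !normc_nat mulr_natl mulr2n lerD2l.
  apply: le_trans (_ : M%:R * 1 <= _); first by rewrite ler_wpM2l // ltW.
  by rewrite mulr1 ler_nat.
by rewrite lef_pV2 ?posrE ?exprn_gt0 ?normc_gt0 //; apply: lerXn2r dx; rewrite nnegrE ?normc_ge0 ?ltW.
Qed.

(** The left side sums over all [k], [dsum] only over [k < M]. The tails of the [M] rows add up to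
    at most a constant times [(M + 1) r^M], and this is O(1/M) since [(M + 1)^2 r^M] is bounded. *)
Lemma lambert_cvg (q : C) : normc q < 1 ->
  \sum_(m < M) (q ^+ m.+1 / (1 - q ^+ m.+1) ^+ 2) @[M --> \oo] --> dser wS q.
Proof.
move=> q1; set r := normc q; have r0 : 0 <= r := normc_ge0 q.
have r01 : 0 <= r < 1 by rewrite r0.
have d0 : 0 < 1 - r by rewrite subr_gt0.
have [K K0 HK] := geo_bounded 2 r01.
have L1 : (\sum_(m < M) (q ^+ m.+1 / (1 - q ^+ m.+1) ^+ 2) - dsum wS q M) @[M --> \oo] --> (0 : C).
  apply: (@cvgC_squeeze _ _ _ _ _ _ (fun M => 2 * K / (1 - r) ^+ 3 / M.+1%:R)); last exact: cvg_invSn.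
  apply: nearW => M; rewrite subr0 /dsum -sumrB; apply: le_trans (normc_sum _ _ _) _.
  apply: le_trans (_ : \sum_(m < M) (2 * M.+1%:R * r ^+ M / (1 - r) ^+ 2) * r ^+ m <= _).
    apply: ler_sum => m _.
    have xr : normc (q ^+ m.+1) <= r by rewrite normcX exprS ler_piMr // exprn_ile1 // ltW.
    have x1 : normc (q ^+ m.+1) < 1 by apply: le_lt_trans xr q1.
    have -> : \sum_(k < M) (wS m k)%:R * q ^+ (m.+1 * k.+1) = \sum_(k < M) k.+1%:R * (q ^+ m.+1) ^+ k.+1.
      by apply: eq_bigr => k _; rewrite exprM.
    apply: le_trans (lambert_tail M x1) _.
    rewrite [X in _ <= X]mulrAC; apply: ler_pM.
    - by rewrite !mulr_ge0 ?exprn_ge0 ?normc_ge0.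
    - by rewrite invr_ge0 exprn_ge0 // subr_ge0 ltW.
    - rewrite -[X in _ <= X]mulrA ler_wpM2l ?mulr_ge0 // normcX -exprM -exprD.
      have -> : (m.+1 * M.+1 = (M + m) + (m * M).+1)%N by lia.
      by rewrite exprD ler_piMr ?exprn_ge0 // exprn_ile1 // ltW.
    - rewrite lef_pV2 ?posrE ?exprn_gt0 ?subr_gt0 //; apply: lerXn2r; rewrite ?nnegrE ?subr_ge0 ?(ltW q1) ?(ltW x1) //.
      by rewrite lerD2l lerN2.
  rewrite -big_distrr /=; apply: le_trans (_ : 2 * M.+1%:R * r ^+ M / (1 - r) ^+ 2 * (1 - r)^-1 <= _).
    rewrite ler_wpM2l ?geo0_le // !mulr_ge0 ?exprn_ge0 ?invr_ge0 ?exprn_ge0 // ltW //.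
  have T : M.+1%:R ^+ 2 * r ^+ M <= K.
    apply: le_trans (HK M.+1); rewrite /geo big_ord_recr /= lerDr.
    by apply: sumr_ge0 => m _; rewrite mulr_ge0 ?exprn_ge0.
  have N0 : (0 : R) < M.+1%:R by rewrite ltr0n.
  have -> : 2 * M.+1%:R * r ^+ M / (1 - r) ^+ 2 / (1 - r) = 2 * (M.+1%:R ^+ 2 * r ^+ M) / (1 - r) ^+ 3 / M.+1%:R.
    by field; rewrite !gt_eqF.
  by rewrite ler_wpM2r ?invr_ge0 // ler_wpM2r ?invr_ge0 ?exprn_ge0 ?(ltW d0) // ler_wpM2l.
rewrite -[dser wS q]add0r.
apply: (@cvgC_ext _ _ _ _ (fun M => \sum_(m < M) (q ^+ m.+1 / (1 - q ^+ m.+1) ^+ 2) - dsum wS q M + dsum wS q M)).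
  by move=> M; rewrite subrK.
by apply: cvgCD; [exact: L1|exact: dsum_cvg wS_le].
Qed.

(** The rows [m] and [-m] together give [-8 pi^2 q^m / (1 - q^m)^2], and 24 is [8 pi^2] over
    [cs 0 = pi^2 / 3]. *)
Lemma G2_nome (tau : C) : 0 < Im tau -> G2 tau = (Pi R ^+ 2 / 3)%:C * E2 tau.
Proof.
move=> t0; have L := @G2_cvg R tau t0; apply: (cvgC_unique _ L).
have q1 := normc_nome_lt1 t0.
apply: (@cvgC_ext _ _ _ _ (fun M => (Pi R ^+ 2 / 3)%:C * (1 - 24%:R * \sum_(m < M) (nome tau ^+ m.+1 / (1 - nome tau ^+ m.+1) ^+ 2)))).
  move=> M; rewrite zsumE mul0r cs0E mulrBr mulr1; congr (_ + _).
  rewrite mulrA big_distrr -sumrN /=; apply: eq_bigr => m _.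
  have m0 : 0 < Im (m.+1%:R * tau) by rewrite !cplxE mul0r addr0 mulr_gt0.
  rewrite mulrNz mulNr cs_opp -mulr2n -pmulrn cs_nome // nomeM // -mulr_natl.
  have -> : (Pi R ^+ 2)%:C = 3 * (Pi R ^+ 2 / 3)%:C :> C.
    by rewrite -[3](rmorph_nat (real_complex R)) -rmorphM /=; congr (_%:C); field.
  by move: (_ / _) => x; ring.
apply: cvgCM; first exact: cvgC_cst.
apply: cvgCB; first exact: cvgC_cst.
by apply: cvgCM; [exact: cvgC_cst|exact: lambert_cvg].
Qed.

Lemma cder_E2 (tau : C) : 0 < Im tau -> cder E2 tau (- (48%:R * iPi R * D2 tau)).
Proof.
move=> t0; have q1 := normc_nome_lt1 t0; have q0 := nome_neq0 t0.
have H := @cder_comp R (dser wS) (@nome R) tau _ _ (cder_dser q0 q1) (cder_nome t0).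
have H2 := cderD (cder_cst 1 tau) (cderM (cder_cst (- 24%:R) tau) H).
apply: cder_ext H2; first by near=> w; rewrite /E2 mulNr.
by rewrite /D2; field.
Unshelve. all: by end_near. Qed.

Lemma cder_G2 (tau : C) : 0 < Im tau -> cder (@G2 R) tau ((Pi R ^+ 2 / 3)%:C * - (48%:R * iPi R * D2 tau)).
Proof.
move=> t0; apply: cder_ext (cderM (cder_cst (Pi R ^+ 2 / 3)%:C tau) (cder_E2 t0)).
  apply/nbhsCP; exists (Im tau) => // w wt; rewrite -G2_nome //.
  have := ler_Im_normc (w - tau); rewrite !cplxE ler_norml => /andP[]; lra.
by rewrite mul0r add0r.
Unshelve. all: by end_near. Qed.

(** The finite branch of [p]; at a zero of [G2], where [p] is infinite, it takes the default value
    [tau]. *)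
Definition pf (tau : C) : C := tau - 2 * iPi R / G2 tau.

Lemma Pi3_neq0 : (Pi R ^+ 2 / 3)%:C != 0 :> C.
Proof.
by apply/eqP => /(congr1 Re) /= H; have := Pi_gt0 R; have : 0 < Pi R ^+ 2 / 3 by [rewrite divr_gt0 // exprn_gt0 // Pi_gt0]; rewrite H ltxx.
Qed.

Lemma G2_eq0 (tau : C) : 0 < Im tau -> (G2 tau == 0) = (E2 tau == 0).
Proof. by move=> t0; rewrite G2_nome // mulf_eq0 (negbTE Pi3_neq0). Qed.

(** The derivative is E4 / E2^2 in disguise, with [288 = 24 * 12] from Ramanujan's
    [12 q dE2/dq = E2^2 - E4]. *)
Lemma cder_pf (tau : C) : 0 < Im tau -> G2 tau != 0 ->
  cder pf tau (1 + 288%:R * D2 tau / E2 tau ^+ 2).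
Proof.
move=> t0 g0; have e0 : E2 tau != 0 by rewrite -G2_eq0.
have H := @cder_comp R (fun w => w^-1) (@G2 R) tau _ _ (cder_inv g0) (cder_G2 t0).
have H2 := cderD (cder_id tau) (cderM (cder_cst (- (2 * iPi R)) tau) H).
apply: cder_ext H2; first by near=> w; rewrite /pf mulNr.
rewrite mul0r add0r G2_nome //; have := iPi_sqr R; have := Pi3_neq0.
have -> : (Pi R ^+ 2)%:C = 3 * (Pi R ^+ 2 / 3)%:C :> C.
  by rewrite -[3](rmorph_nat (real_complex R)) -rmorphM /=; congr (_%:C); field.
move: (iPi R) (Pi R ^+ 2 / 3)%:C (D2 tau) (E2 tau) e0 => P k d e e0 k0 PP.
have -> : - (2 * P) * (- (k * e) ^- 2 * (k * - (48%:R * P * d))) = - P ^+ 2 * (96%:R * d / (k * e ^+ 2)).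
  by field; rewrite e0 k0.
by rewrite PP; field; rewrite e0 k0.
Unshelve. all: by end_near. Qed.

End EisensteinSeries.

(** * Positivity of the real part of the derivative *)

Section DerivativeEstimate.
Variable R : realType.
Local Notation C := R[i].
Local Notation Re := (@complex.Re R).
Local Notation Im := (@complex.Im R).

Lemma Re_sum (I : Type) (l : seq I) (P : pred I) (F : I -> C) :
  Re (\sum_(i <- l | P i) F i) = \sum_(i <- l | P i) Re (F i).
Proof. exact: (big_morph Re (@ReD R)). Qed.

Lemma Im_sum (I : Type) (l : seq I) (P : pred I) (F : I -> C) :
  Im (\sum_(i <- l | P i) F i) = \sum_(i <- l | P i) Im (F i).
Proof. exact: (big_morph Im (@ImD R)). Qed.

Section Powers.
Variables (q : C) (r : R).
Hypotheses (r0 : 0 < r) (qr : normc q <= r).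

Lemma disk_Re_ge : - r <= Re q.
Proof. by have := le_trans (ler_Re_normc q) qr; rewrite ler_norml => /andP[]. Qed.

(** [(Im q)^2 <= (r - Re q) (r + Re q)], and the first factor is at most [2 r]. *)
Lemma disk_Im_sqr : Im q ^+ 2 <= 2 * (Re q + r) * r.
Proof.
have : normc q ^+ 2 <= r ^+ 2 by apply: lerXn2r qr; rewrite nnegrE ?normc_ge0 ?ltW.
by rewrite normc_sqr; nra.
Qed.

(** The factor [r] on the left stands for the exponent [n - 1] on the right, so that [n = 0] is no
    exception. *)
Lemma pow_Im n : r * `|Im (q ^+ n)| <= n%:R * r ^+ n * `|Im q|.
Proof.
elim: n => [|n IH]; first by rewrite expr0 Im1 normr0 mulr0 !mul0r.
rewrite exprS ImM; apply: le_trans (_ : r * (`|Re q| * `|Im (q ^+ n)| + `|Im q| * `|Re (q ^+ n)|) <= _).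
  by rewrite ler_pM2l // -!normrM ler_normD.
have H1 : `|Re q| <= r := le_trans (ler_Re_normc q) qr.
have H2 : `|Re (q ^+ n)| <= r ^+ n.
  apply: le_trans (ler_Re_normc _) _; rewrite normcX; apply: lerXn2r qr; rewrite nnegrE ?normc_ge0 ?ltW //.
rewrite -natr1 exprS.
have K1 : `|Re q| * (r * `|Im (q ^+ n)|) <= r * (n%:R * r ^+ n * `|Im q|) by apply: ler_pM => //; rewrite mulr_ge0 // ltW.
have K2 : r * (`|Im q| * `|Re (q ^+ n)|) <= r * (`|Im q| * r ^+ n) by rewrite ler_pM2l // ler_wpM2l.
move: K1 K2; move: `|Re q| `|Im q| `|Re (q ^+ n)| `|Im (q ^+ n)| (r ^+ n) (n%:R : R) => a b c d e m; lra.
Qed.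

(* The point is that [Im q ^ 2] is at most a multiple of [Re (q + r)] on the disk. *)
Lemma pow_Re n : r * `|Re (q ^+ n) - (- r) ^+ n| <= n%:R ^+ 2 * r ^+ n * (Re q + r).
Proof.
have a0 : 0 <= Re q + r by have := disk_Re_ge; lra.
elim: n => [|n IH]; first by rewrite !expr0 Re1 subrr normr0 mulr0 expr0n !mul0r.
have -> : Re (q ^+ n.+1) - (- r) ^+ n.+1 = (Re q + r) * Re (q ^+ n) - r * (Re (q ^+ n) - (- r) ^+ n) - Im q * Im (q ^+ n).
  by rewrite !exprS ReM; ring.
have H2 : `|Re (q ^+ n)| <= r ^+ n.
  by apply: le_trans (ler_Re_normc _) _; rewrite normcX; apply: lerXn2r qr; rewrite nnegrE ?normc_ge0 ?ltW.
have H3 := pow_Im n; have H4 := disk_Im_sqr.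
apply: le_trans (_ : r * ((Re q + r) * `|Re (q ^+ n)| + r * `|Re (q ^+ n) - (- r) ^+ n| + `|Im q| * `|Im (q ^+ n)|) <= _).
  rewrite ler_pM2l //; apply: le_trans (ler_normB _ _) _.
  apply: le_trans (lerD (ler_normB _ _) (lexx _)) _.
  by rewrite !normrM (ger0_norm a0) (gtr0_norm r0).
have K1 : r * ((Re q + r) * `|Re (q ^+ n)|) <= r * ((Re q + r) * r ^+ n) by rewrite ler_pM2l // ler_wpM2l.
have K2 : r * (r * `|Re (q ^+ n) - (- r) ^+ n|) <= r * (n%:R ^+ 2 * r ^+ n * (Re q + r)) by rewrite ler_pM2l.
have K3 : `|Im q| * (r * `|Im (q ^+ n)|) <= n%:R * r ^+ n * (2 * (Re q + r) * r).
  apply: le_trans (_ : `|Im q| * (n%:R * r ^+ n * `|Im q|) <= _); first by rewrite ler_wpM2l.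
  rewrite mulrCA -expr2 real_normK ?num_real //; apply: ler_wpM2l => //.
  by rewrite mulr_ge0 // exprn_ge0 // ltW.
rewrite -natr1 [r ^+ n.+1]exprS.
move: K1 K2 K3; move: `|Im q| `|Re (q ^+ n)| `|Im (q ^+ n)| `|_ - _| (Re q + r) (r ^+ n) (n%:R : R) => a b c d e f m; lra.
Qed.

End Powers.

(** The leading term, which carries [q] itself, is kept exactly; only the rest is estimated. *)
Lemma dsum_first (f g : nat -> nat -> R) M :
  (forall m k, `|f m k| <= g m k) ->
  `|\sum_(m < M.+1) \sum_(k < M.+1) f m k - f 0%N 0%N| <= \sum_(m < M.+1) \sum_(k < M.+1) g m k - g 0%N 0%N.
Proof.
move=> fg; have E (h : nat -> nat -> R) : \sum_(m < M.+1) \sum_(k < M.+1) h m k =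
    \sum_(k < M) h 0%N k.+1 + \sum_(m < M) \sum_(k < M.+1) h m.+1 k + h 0%N 0%N.
  by rewrite big_ord_recl [X in X + _ = _]big_ord_recl /= -addrA addrC.
rewrite !E !addrK; apply: le_trans (ler_normD _ _) _; apply: lerD.
  by apply: le_trans (ler_norm_sum _ _ _) _; apply: ler_sum.
apply: le_trans (ler_norm_sum _ _ _) _; apply: ler_sum => m _.
by apply: le_trans (ler_norm_sum _ _ _) _; apply: ler_sum.
Qed.

(* An upper bound for |exp (2 pi i z)| on Im z >= sqrt 3 / 2. *)
Definition nome_bound : R := 217^-1.

Lemma geo_nome_bound i r M : 0 <= r -> r <= nome_bound -> (i <= 4)%N ->
  geo i r M <= (1 - 2 ^+ i * nome_bound)^-1.
Proof.
move=> r0 r1 i4; have P0 : 0 < 2 ^+ i :> R by rewrite exprn_gt0.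
have P1 : 2 ^+ i <= 16 :> R.
  by rewrite (_ : 16 = 2 ^+ 4) ?ler_eXn2l //; [rewrite ltr1n|ring].
have P2 : 2 ^+ i * nome_bound <= 16 * nome_bound by rewrite ler_pM2r // /nome_bound; lra.
have P3 : 2 ^+ i * r <= 2 ^+ i * nome_bound by rewrite ler_pM2l.
have P4 : 16 * nome_bound < 1 by rewrite /nome_bound; lra.
apply: le_trans (geo_small _ _ _) _ => //; first by apply: le_lt_trans P3 (le_lt_trans P2 P4).
have p1 : 0 < 1 - 2 ^+ i * nome_bound by rewrite subr_gt0; exact: le_lt_trans P2 P4.
have p2 : 0 < 1 - 2 ^+ i * r by apply: lt_le_trans p1 _; rewrite lerD2l lerN2.
by rewrite lef_pV2 // lerD2l lerN2.
Qed.

(** The numbers are [217 / (217 - 2^i)], rounded up. *)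
Lemma geo_nome_bounds r M : 0 <= r -> r <= nome_bound ->
  [/\ geo 0 r M <= 201 / 200, geo 1 r M <= 101 / 100, geo 2 r M <= 51 / 50,
      geo 3 r M <= 26 / 25 & geo 4 r M <= 27 / 25].
Proof.
move=> r0 r1; split; apply: le_trans (geo_nome_bound _ r0 r1 _) _ => //;
  rewrite -[X in X <= _]mul1r ler_pdivrMr /nome_bound ?expr0 ?expr1 ?exprS; lra.
Qed.

Variables (q : C) (r : R).
Hypotheses (r0 : 0 < r) (qr : normc q <= r) (r1 : r <= nome_bound).

Let q1 : normc q < 1.
Proof. by apply: le_lt_trans (le_trans qr r1) _; rewrite /nome_bound; lra. Qed.

(** The horizontal distance from [q] to [- r], where the derivative will vanish; real parts are
    estimated in multiples of [a], imaginary parts in multiples of [b]. *)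
Let a := Re q + r.
Let b := Im q.
Let a0 : 0 <= a. Proof. by have := disk_Re_ge qr; rewrite /a; lra. Qed.

(** [pow_Re] costs a factor [n^2], absorbed into the weight; the subtracted 1 is the leading term.
    For imaginary parts [pow_Im] costs only [n]. *)
Lemma dsum_Re_bound w i j M : w 0%N 0%N = 1%N ->
  (forall m k, w m k * (m.+1 * k.+1) ^ 2 <= m.+1 ^ i * k.+1 ^ j)%N ->
  `|Re (dsum w q M.+1) - Re (dsum w (- r)%:C M.+1) - a| <= a * (geo i r M.+1 * geo j r M.+1 - 1).
Proof.
move=> w1 H; pose f m k := r * ((w m k)%:R * (Re (q ^+ (m.+1 * k.+1)) - (- r) ^+ (m.+1 * k.+1))).
pose g m k := (w m k * (m.+1 * k.+1) ^ 2)%:R * r ^+ (m.+1 * k.+1) * a.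
have fg m k : `|f m k| <= g m k.
  rewrite /f /g mulrCA normrM ger0_norm // normrM (gtr0_norm r0) natrM -!mulrA ler_wpM2l //.
  by rewrite natrX mulrA; exact: pow_Re.
have := @dsum_first f g M fg.
have -> : \sum_(m < M.+1) \sum_(k < M.+1) f m k = r * (Re (dsum w q M.+1) - Re (dsum w (- r)%:C M.+1)).
  rewrite /dsum !Re_sum -sumrB big_distrr; apply: eq_bigr => m _ /=.
  rewrite !Re_sum -sumrB big_distrr; apply: eq_bigr => k _ /=.
  by rewrite /f !ReM Re_nat Im_nat !mul0r !subr0 -rmorphXn ReC mulrBr.
have -> : \sum_(m < M.+1) \sum_(k < M.+1) g m k = dsum (fun m k => w m k * (m.+1 * k.+1) ^ 2)%N r M.+1 * a.
  by rewrite /dsum big_distrl; apply: eq_bigr => m _; rewrite big_distrl.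
rewrite /f /g w1 muln1 expr1 expr1 opprK -/a !mul1r -mulrBr normrM (gtr0_norm r0) => D.
have r01 : 0 <= r <= 1 by rewrite ltW //=; apply: le_trans r1 _; rewrite /nome_bound; lra.
have := dsum_le_geo M.+1 r01 H => G.
rewrite -(ler_pM2l r0); apply: le_trans D _.
rewrite mulrCA mulrBr mulr1 [a * _]mulrC -mulrBl ler_wpM2r // lerD2r //.
Qed.

Lemma dsum_Im_bound w i j M : w 0%N 0%N = 1%N ->
  (forall m k, w m k * (m.+1 * k.+1) <= m.+1 ^ i * k.+1 ^ j)%N ->
  `|Im (dsum w q M.+1) - b| <= `|b| * (geo i r M.+1 * geo j r M.+1 - 1).
Proof.
move=> w1 H; pose f m k := r * ((w m k)%:R * Im (q ^+ (m.+1 * k.+1))).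
pose g m k := (w m k * (m.+1 * k.+1))%:R * r ^+ (m.+1 * k.+1) * `|b|.
have fg m k : `|f m k| <= g m k.
  rewrite /f /g mulrCA normrM ger0_norm // normrM (gtr0_norm r0) natrM -!mulrA ler_wpM2l //.
  by rewrite mulrA; exact: pow_Im.
have := @dsum_first f g M fg.
have -> : \sum_(m < M.+1) \sum_(k < M.+1) f m k = r * Im (dsum w q M.+1).
  rewrite /dsum !Im_sum big_distrr; apply: eq_bigr => m _ /=.
  rewrite !Im_sum big_distrr; apply: eq_bigr => k _ /=.
  by rewrite /f !ImM Re_nat Im_nat mul0r addr0.
have -> : \sum_(m < M.+1) \sum_(k < M.+1) g m k = dsum (fun m k => w m k * (m.+1 * k.+1))%N r M.+1 * `|b|.
  by rewrite /dsum big_distrl; apply: eq_bigr => m _; rewrite big_distrl.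
rewrite /f /g w1 muln1 expr1 expr1 -/b !mul1r -mulrBr normrM (gtr0_norm r0) => D.
have r01 : 0 <= r <= 1 by rewrite ltW //=; apply: le_trans r1 _; rewrite /nome_bound; lra.
have := dsum_le_geo M.+1 r01 H => G.
rewrite -(ler_pM2l r0); apply: le_trans D _.
rewrite mulrCA mulrBr mulr1 [`|b| * _]mulrC -mulrBl ler_wpM2r // lerD2r //.
Qed.

Lemma cvg_normr_le (f : nat -> R) (l c : R) : f M.+1 @[M --> \oo] --> l ->
  (forall M, `|f M.+1| <= c) -> `|l| <= c.
Proof. by move=> /cvg_norm L H; apply: (cvgr_to_le L); apply: nearW. Qed.

Lemma dsum_cvgS w i j (x : C) : normc x < 1 -> (forall m k, w m k <= m.+1 ^ i * k.+1 ^ j)%N ->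
  dsum w x M.+1 @[M --> \oo] --> dser w x.
Proof. by move=> x1 H; rewrite (cvg_shiftS (dsum w x)); exact: dsum_cvg H. Qed.

Let r1' : normc ((- r)%:C : C) < 1.
Proof. by rewrite normc_real normrN gtr0_norm //; apply: le_lt_trans r1 _; rewrite /nome_bound; lra. Qed.

Lemma dser_Re_bound w i j i' j' (c : R) : w 0%N 0%N = 1%N ->
  (forall m k, w m k <= m.+1 ^ i' * k.+1 ^ j')%N ->
  (forall m k, w m k * (m.+1 * k.+1) ^ 2 <= m.+1 ^ i * k.+1 ^ j)%N ->
  (forall M, geo i r M * geo j r M - 1 <= c) ->
  `|Re (dser w q) - Re (dser w (- r)%:C) - a| <= c * a.
Proof.
move=> w1 H' H Hc.
have L1 := dsum_cvgS q1 H'; have L2 := dsum_cvgS r1' H'.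
apply: (@cvg_normr_le (fun M => Re (dsum w q M) - Re (dsum w (- r)%:C M) - a)).
  have K1 : Re (dsum w q M.+1) @[M --> \oo] --> Re (dser w q) by exact: (cvg_Re L1).
  have K2 : Re (dsum w (- r)%:C M.+1) @[M --> \oo] --> Re (dser w (- r)%:C) by exact: (cvg_Re L2).
  by apply: cvgB; [apply: cvgB; [exact: K1|exact: K2]|exact: cvg_cst].
by move=> M; apply: le_trans (dsum_Re_bound M w1 H) _; rewrite mulrC ler_wpM2r.
Qed.

Lemma dser_Im_bound w i j i' j' (c : R) : w 0%N 0%N = 1%N ->
  (forall m k, w m k <= m.+1 ^ i' * k.+1 ^ j')%N ->
  (forall m k, w m k * (m.+1 * k.+1) <= m.+1 ^ i * k.+1 ^ j)%N ->
  (forall M, geo i r M * geo j r M - 1 <= c) ->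
  `|Im (dser w q) - b| <= c * `|b|.
Proof.
move=> w1 H' H Hc; have L1 := dsum_cvgS q1 H'.
apply: (@cvg_normr_le (fun M => Im (dsum w q M) - b)).
  have K1 : Im (dsum w q M.+1) @[M --> \oo] --> Im (dser w q) by exact: (cvg_Im L1).
  by apply: cvgB; [exact: K1|exact: cvg_cst].
by move=> M; apply: le_trans (dsum_Im_bound M w1 H) _; rewrite mulrC ler_wpM2r.
Qed.

Lemma dser_norm_bound w i j (c : R) : (forall m k, w m k <= m.+1 ^ i * k.+1 ^ j)%N ->
  (forall M, geo i r M * geo j r M <= c) -> normc (dser w q) <= c * r.
Proof.
move=> H Hc; have L1 := dsum_cvgS q1 H; apply: (cvgC_le _ L1); apply: nearW => M.
apply: le_trans (normc_dsum _ _ _) _.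
have q01 : 0 <= normc q <= 1 by rewrite normc_ge0 ltW.
have r01 : 0 <= r <= 1 by rewrite ltW //=; apply: le_trans r1 _; rewrite /nome_bound; lra.
apply: le_trans (_ : dsum w r M.+1 <= _).
  apply: ler_sum => m _; apply: ler_sum => k _; rewrite ler_wpM2l //.
  by apply: lerXn2r qr; rewrite nnegrE ?normc_ge0 ?ltW.
by apply: le_trans (dsum_le_geo M.+1 r01 H) _; rewrite mulrC ler_pM2r.
Qed.

Let ggeo i M : 0 <= geo i r M. Proof. by apply: geo_ge0; exact: ltW. Qed.

(** Each constant is a product of two bounds from [geo_nome_bounds], less 1 where the leading term
    is subtracted, for instance [51/50 * 26/25 - 1 <= 1/16]. *)
Lemma dser_bounds :
  [/\ `|Re (dser wS q) - Re (dser wS (- r)%:C) - a| <= 16^-1 * a,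
      `|Im (dser wS q) - b| <= 32^-1 * `|b|,
      normc (dser wS q) <= 51 / 50 * r,
      `|Re (dser wD q) - Re (dser wD (- r)%:C) - a| <= 8^-1 * a &
      `|Im (dser wD q) - b| <= 16^-1 * `|b|].
Proof.
have B M := geo_nome_bounds M (ltW r0) r1.
have HS e m k : (wS m k * (m.+1 * k.+1) ^ e <= m.+1 ^ e * k.+1 ^ e.+1)%N.
  by rewrite /wS expnMn mulnCA -expnS.
have HD e m k : (wD m k * (m.+1 * k.+1) ^ e <= m.+1 ^ e.+1 * k.+1 ^ e.+2)%N.
  by rewrite /wD -mulnA -expnS expnMn mulnCA -expnS.
split.
- apply: (@dser_Re_bound wS 2 3 _ _ _ erefl wS_le (HS 2%N)) => M.
  by have := ggeo 2 M; have := ggeo 3 M; case: (B M) => _ _ + + _; nra.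
- apply: (@dser_Im_bound wS 1 2 _ _ _ erefl wS_le (HS 1%N)) => M.
  by have := ggeo 1 M; have := ggeo 2 M; case: (B M) => _ + + _ _; nra.
- apply: (dser_norm_bound wS_le) => M.
  by have := ggeo 0 M; have := ggeo 1 M; case: (B M) => + + _ _ _; nra.
- apply: (@dser_Re_bound wD 3 4 _ _ _ erefl wD_le (HD 2%N)) => M.
  by have := ggeo 3 M; have := ggeo 4 M; case: (B M) => _ _ _ + +; nra.
- apply: (@dser_Im_bound wD 2 3 _ _ _ erefl wD_le (HD 1%N)) => M.
  by have := ggeo 2 M; have := ggeo 3 M; case: (B M) => _ _ + + _; nra.
Qed.

Let F (x : C) : C := (1 - 24%:R * dser wS x) ^+ 2 + 288%:R * dser wD x.

Lemma E_neq0 : 1 - 24%:R * dser wS q != 0.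
Proof.
have [_ _ n _ _] := dser_bounds; rewrite -normc_gt0.
apply: lt_le_trans (ler_normcB _ _); rewrite normc1 normcM normc_nat subr_gt0.
by move: n r1; rewrite /nome_bound; lra.
Qed.

End DerivativeEstimate.

(** [sr + i si] and [dr + i di] are the two series at [q], [s1] and [d1] their values at [- r]. With
    [E = 1 - 24 S], [F = E^2 + 288 D = U + i V] and [E^2 = X + i Y], the claim is [U X + V Y > 0],
    the sign of [Re (F / E^2)]. Here [U >= 189 a] because [F] vanishes at [- r], and [X >= 10/13];
    [V] and [Y] are multiples of [b], and [b^2 <= 2 a r] gives [|V Y| <= 138 a < 189 * 10/13 a]. *)
Lemma Re_deriv_ineq (R : realType) (r a b sr s1 si dr d1 di : R) :
  0 < r -> r <= 217^-1 -> 0 < a -> b ^+ 2 <= 2 * a * r -> `|b| <= r ->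
  `|sr - s1 - a| <= 16^-1 * a -> `|sr| <= 51 / 50 * r -> `|s1| <= 51 / 50 * r ->
  `|si - b| <= 32^-1 * `|b| ->
  `|dr - d1 - a| <= 8^-1 * a -> `|di - b| <= 16^-1 * `|b| ->
  (1 - 24 * s1) ^+ 2 + 288 * d1 = 0 ->
  0 < ((1 - 24 * sr) ^+ 2 - (24 * si) ^+ 2 + 288 * dr) * ((1 - 24 * sr) ^+ 2 - (24 * si) ^+ 2)
      + (- (48 * si * (1 - 24 * sr)) + 288 * di) * - (48 * si * (1 - 24 * sr)).
Proof.
move=> r0 r1 a0 b2 br Hs nsr ns1 Hsi Hd Hdi F1.
have nb : `|b| ^+ 2 = b ^+ 2 by rewrite real_normK ?num_real.
have nb0 : 0 <= `|b| by [].
have si1 : `|si| <= 33 / 32 * `|b|.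
  by rewrite -(subrK b si); apply: le_trans (ler_normD _ _) _; clear -Hsi; lra.
have nsi : `|si| ^+ 2 = si ^+ 2 by rewrite real_normK ?num_real.
have nsi0 : 0 <= `|si| by [].
have c33 : 0 <= 33 / 32 :> R by clear; lra.
have si2 : si ^+ 2 <= (33 / 32) ^+ 2 * b ^+ 2.
  by rewrite -nsi -nb -exprMn; apply: lerXn2r si1; rewrite nnegrE // mulr_ge0.
have si3 : si ^+ 2 <= 100^-1 * a by clear -si2 b2 r1 a0; nra.
have X : 10 / 13 <= (1 - 24 * sr) ^+ 2 - (24 * si) ^+ 2.
  have : b ^+ 2 <= 217^-1 ^+ 2.
    by rewrite -nb; apply: lerXn2r (le_trans br r1); rewrite nnegrE // invr_ge0.
  move: nsr; rewrite ler_norml => /andP[n1 n2]; clear -si2 n1 n2 r1.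
  have e1 : 31 / 35 <= 1 - 24 * sr by lra.
  have : (31 / 35) ^+ 2 <= (1 - 24 * sr) ^+ 2 by apply: lerXn2r e1; rewrite nnegrE; lra.
  by lra.
have s2 : `|sr ^+ 2 - s1 ^+ 2| <= 100^-1 * a.
  move: Hs nsr ns1; rewrite !ler_norml => /andP[x1 x2] /andP[x3 x4] /andP[x5 x6].
  rewrite -ler_norml subr_sqr normrM; apply: (@le_trans _ _ (17 / 16 * a * (102 / 50 * 217^-1))); last by clear -a0; lra.
  by apply: ler_pM => //; rewrite ler_norml; apply/andP; split; clear -x1 x2 x3 x4 x5 x6 r1 a0; lra.
(* The main term is [240 a], as [288 - 48 = 240] is the coefficient of [q] in E4; the errors cost
   less than [51 a]. *)
have U : 189 * a <= (1 - 24 * sr) ^+ 2 - (24 * si) ^+ 2 + 288 * dr.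
  have -> : (1 - 24 * sr) ^+ 2 - (24 * si) ^+ 2 + 288 * dr = 288 * (dr - d1) - 48 * (sr - s1) + 576 * (sr ^+ 2 - s1 ^+ 2) - 576 * si ^+ 2 + ((1 - 24 * s1) ^+ 2 + 288 * d1).
    by ring.
  move: s2 Hs Hd; rewrite F1 !ler_norml => /andP[y1 _] /andP[_ y2] /andP[y3 _].
  by clear -y1 y2 y3 si3 a0; lra.
have nn (n : nat) (x : R) : `|n%:R * x| = n%:R * `|x| by rewrite normrM ger0_norm ?ler0n.
have V : `|- (48 * si * (1 - 24 * sr)) + 288 * di| <= 266 * `|b|.
  have -> : - (48 * si * (1 - 24 * sr)) + 288 * di = 240 * b + 288 * (di - b) - 48 * (si - b) + 1152 * (si * sr) by ring.
  apply: le_trans (ler_normD _ _) _; apply: le_trans (lerD (ler_normB _ _) (lexx _)) _.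
  apply: le_trans (lerD (lerD (ler_normD _ _) (lexx _)) (lexx _)) _.
  rewrite (nn 240%N b) (nn 288%N (di - b)) (nn 48%N (si - b)) (nn 1152%N (si * sr)) normrM.
  have : `|si| * `|sr| <= 33 / 32 * `|b| * (51 / 50 * 217^-1).
    apply: ler_pM => //; apply: le_trans nsr _; rewrite ler_wpM2l //; clear; lra.
  by clear -Hsi Hdi nb0; lra.
have Y : `|- (48 * si * (1 - 24 * sr))| <= 56 * `|b|.
  rewrite normrN -mulrA (nn 48%N) normrM.
  have : `|si| * `|1 - 24 * sr| <= 33 / 32 * `|b| * (69 / 62).
    apply: ler_pM => //; move: nsr; rewrite !ler_norml => /andP[n1 n2]; apply/andP; split; clear -n1 n2 r1; lra.
  by clear -nb0; lra.
have VY : `|(- (48 * si * (1 - 24 * sr)) + 288 * di) * - (48 * si * (1 - 24 * sr))| <= 138 * a.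
  rewrite normrM; apply: (@le_trans _ _ (266 * `|b| * (56 * `|b|))); first by apply: ler_pM.
  rewrite mulrACA -expr2 nb; clear -b2 r1 a0.
  apply: (@le_trans _ _ (266 * 56 * (2 * a * 217^-1))); last by lra.
  rewrite ler_wpM2l //; last (apply: le_trans b2 _; rewrite ler_wpM2l //); lra.
have UX : 189 * a * (10 / 13) <= ((1 - 24 * sr) ^+ 2 - (24 * si) ^+ 2 + 288 * dr) * ((1 - 24 * sr) ^+ 2 - (24 * si) ^+ 2).
  by apply: ler_pM; [clear -a0; lra|clear; lra|exact: U|exact: X].
by apply: lt_le_trans (lerD UX (lerNnormlW VY)); clear -a0; lra.
Qed.

(** * The corner [rho], and injectivity on the half plane *)

Section Injectivity.
Variable R : realType.
Local Notation C := R[i].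
Local Notation Re := (@complex.Re R).
Local Notation Im := (@complex.Im R).
Local Notation rho := (rho R).
Local Notation s3 := (Num.sqrt 3 : R).

Lemma sqr_s3 : s3 ^+ 2 = 3. Proof. exact: sqr_sqrtr. Qed.

Lemma rhoE : rho = (2^-1 +i* (s3 / 2)).
Proof.
rewrite /Defs.rho (_ : (2^-1 : C) = (2^-1 : R)%:C); last by rewrite fmorphV rmorph_nat.
by simpc; congr (_ +i* _); rewrite mulrC.
Qed.

Lemma rho_conjE : rho_conj R = conjc rho.
Proof.
rewrite rhoE /rho_conj (_ : (2^-1 : C) = (2^-1 : R)%:C); last by rewrite fmorphV rmorph_nat.
by simpc; congr (_ +i* _); rewrite mulrC.
Qed.

Lemma Re_rho : Re rho = 2^-1. Proof. by rewrite rhoE. Qed.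
Lemma Im_rho : Im rho = s3 / 2. Proof. by rewrite rhoE. Qed.
Lemma s3_gt0 : 0 < s3. Proof. by rewrite sqrtr_gt0. Qed.
Lemma Im_rho_gt0 : 0 < Im rho. Proof. by rewrite Im_rho divr_gt0 // s3_gt0. Qed.

Lemma rho_sqr : rho ^+ 2 = rho - 1.
Proof.
have := sqr_s3; rewrite expr2 rhoE => H; apply: eqC; rewrite !(ReM, ImM, ReD, ImD, ReN, ImN, Re1, Im1) /=.
  by move: H; lra.
by rewrite subr0; field.
Qed.

Lemma rho_neq0 : rho != 0.
Proof. by apply: contraTneq Im_rho_gt0 => ->; rewrite ltxx. Qed.

Lemma rho_inv : rho^-1 = 1 - rho.
Proof. by apply: (mulfI rho_neq0); rewrite divff ?rho_neq0 // mulrBr mulr1 -expr2 rho_sqr; ring. Qed.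

Lemma conj_rho : conjc rho = 1 - rho.
Proof.
rewrite rhoE; apply: eqC; rewrite !(Re_conj, Im_conj, ReD, ImD, ReN, ImN, Re1, Im1) /=; last by ring.
by field.
Qed.

Let c : C := 2 * iPi R.

Lemma c_neq0 : c != 0.
Proof.
by apply/eqP => /(congr1 Im); rewrite ImM Re_nat Im_nat Im_iPi mul0r addr0 Im0 => H; have := Pi_gt0 R; lra.
Qed.

Lemma nomeB1 (z : C) : nome (z - 1) = nome z.
Proof. by rewrite -(nome1 (z - 1)) subrK. Qed.

Lemma G2_1 (tau : C) : 0 < Im tau -> G2 (tau - 1) = G2 tau.
Proof.
move=> t0; have t1 : 0 < Im (tau - 1) by rewrite ImD ImN Im1 subr0.
by rewrite (G2_nome t0) (G2_nome t1) /E2 nomeB1.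
Qed.

(** [- 1 / rho = rho - 1], so the inversion law and the period 1 of [G2] give a linear equation for
    [G2 rho]. *)
Lemma G2_rho : c = - (1 - 2 * rho) * G2 rho.
Proof.
have := G2_inv Im_rho_gt0; rewrite rho_inv opprB (G2_1 Im_rho_gt0) -/c => H.
have : (1 - rho) * G2 rho = rho * G2 rho - c.
  by apply: (mulfI rho_neq0); rewrite -H mulrA -rho_inv divff ?rho_neq0 // mul1r.
by move=> E; rewrite -(subKr (rho * G2 rho) c) -E; ring.
Qed.

Definition dG2 (tau : C) : C := (Pi R ^+ 2 / 3)%:C * - (48%:R * iPi R * D2 tau).

(** The inversion law differentiated at [rho], again with the period 1. As [p = tau - c / G2], the
    equation says [p' (rho) = 0]. *)
Lemma dG2_rho : G2 rho ^+ 2 + c * dG2 rho = 0.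
Proof.
have t0 := Im_rho_gt0; have t0' := Im_invN t0.
have Dinv : cder (fun w : C => - w^-1) rho (rho ^- 2).
  apply: cder_ext (cderM (cder_cst (-1) rho) (cder_inv rho_neq0)); first by near=> w; rewrite mulN1r.
  by rewrite mul0r add0r mulN1r opprK.
have D1 := @cder_comp R (@G2 R) (fun w => - w^-1) rho _ _ (cder_G2 t0') Dinv.
have D2' := cderM (cder_id rho) (cderD (cderM (cder_id rho) (cder_G2 t0)) (cder_cst (- c) rho)).
have D3 : cder (fun w => w * (w * G2 w - c)) rho (dG2 (- rho^-1) * rho ^- 2).
  apply: cder_ext D1 => //; apply/nbhsCP; exists (Im rho) => // w wt; rewrite -G2_inv //.
  have := ler_Im_normc (w - rho); rewrite ImD ImN ler_norml => /andP[]; lra.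
have : dG2 (- rho^-1) = dG2 rho by rewrite /dG2 rho_inv opprB /D2 nomeB1.
move=> EG; have := cder_unique D3 D2'; rewrite EG -exprVn rho_inv -/(dG2 rho) addr0 !mul1r.
have -> : (1 - rho) ^+ 2 = - rho by rewrite sqrrB rho_sqr; ring.
move: (dG2 rho) (G2 rho) G2_rho rho_sqr => dG G cE rr E.
have {}E : dG * (1 - 2 * rho) = 2 * rho * G - c.
  have E1 : rho * (rho * dG) = (rho - 1) * dG by rewrite mulrA -expr2 rr.
  have : dG * - rho - (rho * G - c + rho * (G + rho * dG)) = 0 by rewrite E subrr.
  rewrite mulrDr E1 => E3; apply/eqP; rewrite -subr_eq0 -E3; apply/eqP; ring.
have -> : c * dG = - (dG * (1 - 2 * rho)) * G by rewrite {1}cE; ring.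
by rewrite E cE; ring.
Unshelve. all: by end_near. Qed.

(** This is E4(rho) = 0. *)
Lemma F_rho : E2 rho ^+ 2 + 288%:R * D2 rho = 0.
Proof.
have := dG2_rho; rewrite (G2_nome Im_rho_gt0) /dG2 /c => H.
have PP := iPi_sqr R; have k0 := Pi3_neq0 R.
have : (Pi R ^+ 2 / 3)%:C ^+ 2 * (E2 rho ^+ 2 + 288%:R * D2 rho) = 0.
  rewrite -[RHS]H.
  have -> : 2 * iPi R * ((Pi R ^+ 2 / 3)%:C * - (48%:R * iPi R * D2 rho)) = - iPi R ^+ 2 * (96%:R * (Pi R ^+ 2 / 3)%:C * D2 rho) by ring.
  rewrite PP opprK.
  have -> : (Pi R ^+ 2)%:C = 3 * (Pi R ^+ 2 / 3)%:C :> C.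
    by rewrite -[3](rmorph_nat (real_complex R)) -rmorphM /=; congr (_%:C); field.
  by ring.
by move/eqP; rewrite mulf_eq0 expf_eq0 (negbTE k0) /= => /eqP.
Qed.

Definition r0 : R := normc (nome rho).

Lemma r0_gt0 : 0 < r0. Proof. by rewrite normc_gt0 nome_neq0 // Im_rho_gt0. Qed.

Lemma r0_le : r0 <= nome_bound R. Proof. by apply: normc_nome_small; rewrite Im_rho. Qed.

(** For [b = 0] the bounds on the imaginary parts leave only 0. *)
Lemma Im_dser_real (x r : R) : 0 < r -> r <= nome_bound R -> `|x| <= r ->
  Im (dser wS x%:C) = 0 /\ Im (dser wD x%:C) = 0.
Proof.
move=> r0 r1 xr; have nx : normc x%:C <= r by rewrite normc_real.
have [_ + _ _ +] := dser_bounds r0 nx r1; rewrite !subr0 normr0 !mulr0 !normr_le0.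
by move=> /eqP -> /eqP ->.
Qed.

(** The nome is real at [rho] because [- conjc rho = rho - 1]. Its sign comes from [F_rho]: at a
    positive real [q] the expression [E2^2 + 288 D2] would be positive. *)
Lemma nome_rho : nome rho = (- r0)%:C.
Proof.
have E : nome rho = (Re (nome rho))%:C.
  have H : conjc (nome rho) = nome rho.
    by rewrite -nome_conj conj_rho opprB nomeB1.
  apply: eqC => //; have := congr1 Im H; rewrite Im_conj ImC; lra.
have : `|Re (nome rho)| = r0 by rewrite /r0 {2}E normc_real.
set x := Re (nome rho) in E *; move=> Hx.
have [x0|x0] := lerP 0 x; last by rewrite E -Hx ltr0_norm // opprK.
have xr : `|x| <= r0 by rewrite Hx.
have [S0 D0] := Im_dser_real r0_gt0 r0_le xr.
have nx : normc x%:C <= r0 by rewrite normc_real.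
have [_ _ nS _ _] := dser_bounds r0_gt0 nx r0_le.
have xr1 : normc (x%:C : C) < 1.
  by apply: le_lt_trans nx (le_lt_trans r0_le _); rewrite /nome_bound; lra.
have Dge : 0 <= Re (dser wD x%:C).
  have L := dsum_cvg xr1 wD_le.
  apply: (cvgr_to_ge (cvg_Re L)); apply: nearW => M.
  have -> : dsum wD (x%:C : C) M = (dsum wD x M)%:C.
    rewrite /dsum rmorph_sum; apply: eq_bigr => m _; rewrite rmorph_sum; apply: eq_bigr => k _.
    by rewrite rmorphM rmorphXn rmorph_nat.
  by rewrite ReC; apply: sumr_ge0 => m _; apply: sumr_ge0 => k _; rewrite mulr_ge0 ?exprn_ge0.
have := congr1 Re F_rho; rewrite /E2 /D2 E expr2 !(ReD, ReM, ReN, Re_nat, Im_nat, ImD, ImN, ImM, Re1, Im1, Re0) S0 D0.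
have : 0 < 1 - 24 * Re (dser wS x%:C).
  have := le_trans (ler_Re_normc _) nS; rewrite ler_norml => /andP[_].
  by have := r0_le; rewrite /nome_bound; lra.
clear -Dge; move: (Re (dser wS _)) (Re (dser wD _)) Dge => u v; rewrite !mulr0 !mul0r !(addr0, subr0, oppr0) => v0 u0 H.
suff : (0 : R) < 0 by rewrite ltxx.
by have := mulr_gt0 u0 u0; lra.
Qed.

Lemma E2_neq0 (tau : C) : s3 / 2 <= Im tau -> E2 tau != 0.
Proof.
move=> t1; have s0 := s3_gt0; have t0 : 0 < Im tau by lra.
apply: (E_neq0 r0_gt0 _ r0_le); apply: normc_nome_le; rewrite ?Im_rho_gt0 ?Im_rho //.
Qed.

Definition dpf (tau : C) : C := 1 + 288%:R * D2 tau / E2 tau ^+ 2.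

Lemma ReIm_quasi (S D : C) :
  Re ((1 - 24%:R * S) ^+ 2 + 288%:R * D) = (1 - 24 * Re S) ^+ 2 - (24 * Im S) ^+ 2 + 288 * Re D /\
  Im ((1 - 24%:R * S) ^+ 2 + 288%:R * D) = - (48 * Im S * (1 - 24 * Re S)) + 288 * Im D.
Proof.
have nat_conv (n : nat) (z : C) : Re (n%:R * z) = n%:R * Re z /\ Im (n%:R * z) = n%:R * Im z.
  by rewrite ReM ImM Re_nat Im_nat !mul0r subr0 addr0.
have [r1 i1] := nat_conv 24 S; have [r2 i2] := nat_conv 288 D.
have rT : Re (1 - 24%:R * S) = 1 - 24 * Re S by rewrite ReD ReN r1.
have iT : Im (1 - 24%:R * S) = - (24 * Im S) by rewrite ImD ImN i1 add0r.
by rewrite expr2 (ReD (_ * _)) (ImD (_ * _)) ReM ImM rT iT r2 i2; split; ring.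
Qed.

Lemma Re_div (a b : C) : Re (a / b) = (Re a * Re b + Im a * Im b) / normc b ^+ 2.
Proof. by rewrite ReM Re_inv Im_inv; ring. Qed.

Lemma Re_dpf_gt0 (tau : C) : s3 / 2 <= Im tau -> nome tau != nome rho -> 0 < Re (dpf tau).
Proof.
move=> t1 qn; have e0 := E2_neq0 t1.
have s0 := s3_gt0.
have qr : normc (nome tau) <= r0.
  by apply: normc_nome_le; rewrite ?Im_rho_gt0 ?Im_rho //; apply: lt_le_trans t1; rewrite divr_gt0.
have -> : dpf tau = (E2 tau ^+ 2 + 288%:R * D2 tau) / E2 tau ^+ 2 by rewrite /dpf; field.
rewrite Re_div divr_gt0 //; last by rewrite exprn_gt0 // normc_gt0 expf_neq0.
have m0 := r0_gt0; have m1 := r0_le.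
have nr0 : `|- r0| <= r0 by rewrite normrN (gtr0_norm m0) lexx.
have nr : normc ((- r0)%:C : C) <= r0 by rewrite normc_real.
have [bS bSi nS bD bDi] := dser_bounds m0 qr m1.
have [_ _ nS1 _ _] := dser_bounds m0 nr m1.
have [S0 D0] : Im (dser wS (- r0)%:C) = 0 /\ Im (dser wD (- r0)%:C) = 0.
  exact: Im_dser_real m0 m1 nr0.
have F1 : (1 - 24 * Re (dser wS (- r0)%:C)) ^+ 2 + 288 * Re (dser wD (- r0)%:C) = 0.
  have [+ _] := ReIm_quasi (dser wS (- r0)%:C) (dser wD (- r0)%:C).
  by have := F_rho; rewrite /E2 /D2 nome_rho => ->; rewrite S0 mulr0 expr0n subr0 Re0.
have a0 : 0 < Re (nome tau) + r0.
  have a1 := disk_Re_ge qr; rewrite lt_neqAle; apply/andP; split; last by rewrite -lerBlDr sub0r.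
  rewrite eq_sym; apply: contraNneq qn => a0; have := disk_Im_sqr m0 qr; rewrite a0 mulr0 mul0r => i0.
  have /eqP : Im (nome tau) ^+ 2 = 0 by apply: le_anti; rewrite i0 sqr_ge0.
  rewrite sqrf_eq0 => /eqP I0; rewrite nome_rho; apply/eqP/eqC; rewrite ?ReC ?ImC //.
  by apply/eqP; rewrite -addr_eq0; apply/eqP.
have b2 := disk_Im_sqr m0 qr.
have br : `|Im (nome tau)| <= r0 by apply: le_trans (ler_Im_normc _) qr.
have := @Re_deriv_ineq R r0 (Re (nome tau) + r0) (Im (nome tau)) _ _ _ _ _ _ m0 m1 a0 b2 br bS
  (le_trans (ler_Re_normc _) nS) (le_trans (ler_Re_normc _) nS1) bSi bD bDi F1.
rewrite /E2 /D2; have [-> ->] := ReIm_quasi (dser wS (nome tau)) (dser wD (nome tau)).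
have [+ +] := ReIm_quasi (dser wS (nome tau)) 0; rewrite mulr0 addr0 => -> ->.
by rewrite Re0 Im0 mulr0 !addr0.
Qed.

Lemma cder_pf_hp (tau : C) : s3 / 2 <= Im tau -> cder (@pf R) tau (dpf tau).
Proof.
move=> t1; have s0 := s3_gt0; have t0 : 0 < Im tau by lra.
by apply: cder_pf => //; rewrite G2_eq0 // E2_neq0.
Qed.

Lemma nome_hp_neq (tau : C) : s3 / 2 < Im tau -> nome tau != nome rho.
Proof.
move=> t1; apply/eqP => E.
have : normc (nome tau) < normc (nome rho).
  by apply: normc_nome_lt; rewrite ?Im_rho_gt0 ?Im_rho // nome_neq0 // Im_rho_gt0.
by rewrite E ltxx.
Qed.

(* A function whose derivative has positive real part on an open segment
   separates its endpoints. *)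
Lemma pf_inj (z w : C) : s3 / 2 <= Im z -> s3 / 2 <= Im w -> s3 / 2 < Im z \/ s3 / 2 < Im w ->
  pf z = pf w -> z = w.
Proof.
move=> z1 w1 zw E; apply/eqP; rewrite -subr_eq0 -[_ == _]negbK; apply/negP => d0.
pose d := w - z; have nd : 0 < normc d ^+ 2 by rewrite exprn_gt0 // normc_gt0 /d -opprB oppr_eq0.
pose f (t : R) := Re (conjc d * pf (z + t%:C * d)).
have It (t : R) : Im (z + t%:C * d) = (1 - t) * Im z + t * Im w by rewrite /d !cplxE; ring.
have It1 (t : R) : 0 <= t <= 1 -> s3 / 2 <= Im (z + t%:C * d).
  case/andP=> t0 t1; rewrite It; move: t0 t1 z1 w1; move: (s3 / 2) (Im z) (Im w) => s x y; nra.
(* One end strictly above the boundary line keeps the open segment off it, hence off the zeros of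
   the derivative. *)
have It2 (t : R) : 0 < t < 1 -> s3 / 2 < Im (z + t%:C * d).
  case/andP=> t0 t1; rewrite It; case: zw; move: t0 t1 z1 w1; move: (s3 / 2) (Im z) (Im w) => s x y; nra.
have D (t : R) : 0 <= t <= 1 -> is_derive t 1 f (normc d ^+ 2 * Re (dpf (z + t%:C * d))).
  move=> /It1 /cder_pf_hp H.
  have -> : normc d ^+ 2 * Re (dpf (z + t%:C * d)) = Re (conjc d * dpf (z + t%:C * d) * d).
    by rewrite [conjc d * _ * d]mulrAC [conjc d * d]mulrC mulcJ ReM ReC ImC mul0r subr0.
  apply: (@is_derive_line R (fun y => conjc d * pf y)).
  apply: cder_ext (cderM (cder_cst (conjc d) _) H); first by near=> y.
  by rewrite mul0r add0r.
have [||t t01 Ht] := @MVT R f (fun t => normc d ^+ 2 * Re (dpf (z + t%:C * d))) 0 1 ltr01.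
- by move=> t; rewrite in_itv /= => /andP[t0 t1]; apply: D; rewrite !ltW.
- apply: derivable_within_continuous => t; rewrite in_itv /= => t01.
  by have [] := D t t01.
move: t01; rewrite in_itv /= => t01.
have := It2 t t01 => I2.
have : 0 < normc d ^+ 2 * Re (dpf (z + t%:C * d)) by apply: mulr_gt0 nd (Re_dpf_gt0 (ltW I2) (nome_hp_neq I2)).
move: Ht; rewrite subr0 mulr1 => <-.
have -> : f 1 = f 0 by rewrite /f !rmorph0 rmorph1 mul0r mul1r addr0 (_ : z + d = w) ?E // /d addrC subrK.
by rewrite subrr ltxx.
Unshelve. all: by end_near. Qed.

End Injectivity.

(** Closed subsets of [A] are compact, so their images are closed. It serves both for the inverse of
    [p_ext] and for [disc_chart_inv]. *)
Lemma compact_continuous_inverse (T U : topologicalType) (A : set T) (f : T -> U) (g : U -> T) :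
  hausdorff_space U -> compact A -> {within A, continuous f} -> {in A, cancel f g} ->
  {within f @` A, continuous g}.
Proof.
move=> hU cA cf fK; apply/subspace_continuousP => _ [a Aa <-].
rewrite /from_subspace fK ?inE // => V /=; rewrite nbhsE => -[W [oW Wa] WV].
pose B := A `&` ~` W.
have cB : compact (f @` B).
  apply: continuous_compact; first by apply: continuous_subspaceW cf => x [].
  by apply: compact_closedI => //; exact: open_closedC.
have : open (~` (f @` B)) by apply: closed_openC; exact: compact_closed.
move=> oB; have : \forall y \near f a, (~` (f @` B)) y.
  apply: open_nbhs_nbhs; split=> // -[x [Ax nWx] E].
  by apply: nWx; rewrite -(fK x) ?inE // E fK ?inE.
rewrite /= /within /=; apply: filterS => y nB [b Ab yE]; apply: WV.
rewrite -yE fK ?inE //; apply: contrapT => nW.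
by apply: nB; exists b.
Qed.

(** * Topology of the Riemann sphere *)

Section SphereTopology.
Variable R : realType.
Local Notation C := R[i].
Local Notation Re := (@complex.Re R).
Local Notation Im := (@complex.Im R).
Local Notation S := (Chat R).

Lemma normc_continuous : continuous (fun z : C => normc z).
Proof. by move=> z; exact: (@cvg_normc R _ (nbhs z) (nbhs_filter z) id z (fun A H => H)). Qed.

Lemma Re_continuous : continuous Re.
Proof. by move=> z; exact: (@cvg_Re R _ (nbhs z) (nbhs_filter z) id z (fun A H => H)). Qed.

Lemma Im_continuous : continuous Im.
Proof. by move=> z; exact: (@cvg_Im R _ (nbhs z) (nbhs_filter z) id z (fun A H => H)). Qed.

Lemma closed_normc_le (r : R) : closed [set z : C | normc z <= r].
Proof.
by apply: (@preimage_closed _ _ (fun z : C => normc z) [set x | x <= r] (fun z _ => @normc_continuous z)); exact: closed_le.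
Qed.

Lemma compact_closed_disk (r : R) : compact [set z : C | normc z <= r].
Proof.
pose f (x : R * R) : C := x.1 +i* x.2.
have cf : continuous f.
  by move=> x; apply: cvg_complex; [exact: cvg_fst|exact: cvg_snd].
apply: (@subclosed_compact _ _ (f @` (`[- r, r] `*` `[- r, r]))); first exact: closed_normc_le.
  apply: continuous_compact; first exact: continuous_subspaceT.
  by apply: compact_setX; exact: segment_compact.
move=> z /= zr; exists (Re z, Im z); last by case: z zr.
by split; rewrite /= in_itv /= -ler_norml; apply: le_trans zr; rewrite ?ler_Re_normc ?ler_Im_normc.
Qed.

Lemma compact_normc_bounded (A : set C) : compact A -> exists K, forall z, A z -> normc z <= K.
Proof.
have [-> _|/set0P A0 cA] := eqVneq A set0; first by exists 0.
have [|c _ H] := compact_EVT_max A0 cA (f := fun z : C => normc z).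
  by apply: continuous_subspaceT; exact: normc_continuous.
by exists (normc c) => z Az; apply: H; rewrite inE.
Qed.

Lemma locally_compact_complex : locally_compact [set: C].
Proof.
move=> z _; exists [set w | normc w <= normc z + 1].
  apply/nbhsCP; exists 1 => // w wz _; have := normcD (w - z) z; rewrite subrK /=; lra.
by split; [exact: compact_closed_disk|exact: closed_normc_le].
Qed.

Lemma sphere_hausdorff : hausdorff_space S.
Proof.
by apply: one_point_compactification_hausdorff; [exact: locally_compact_complex|exact: norm_hausdorff].
Qed.

Definition large (K : R) : set S := [set P | if P is Some z then K < normc z else True].

Lemma nbhs_inftyP (A : set S) : nbhs (infty R) A <-> exists K, large K `<=` A.
Proof.
split.
  case=> U [cU _] UA; have [K HK] := compact_normc_bounded cU.
  exists K => -[z|] H; apply: UA; last by right.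
  by left; exists z => // /HK; rewrite leNgt => /negP; apply.
case=> K KA; exists [set z | normc z <= K].
  by split; [exact: compact_closed_disk|exact: closed_normc_le].
by move=> P [[z /negP + <-]|->]; [rewrite -ltNge => Kz|]; apply: KA.
Qed.

Lemma cvg_inftyP (T : Type) (F : set_system T) {FF : Filter F} (f : T -> S) :
  f t @[t --> F] --> infty R <-> forall K, \forall t \near F, large K (f t).
Proof.
split=> [H K|H A /nbhs_inftyP[K KA]]; last by apply: filterS (H K) => t; exact: KA.
by apply: H; apply/nbhs_inftyP; exists K.
Qed.

Lemma nbhs_fin (z : C) (A : set S) : nbhs (fin z) A <-> exists2 e, 0 < e & forall w, normc (w - z) < e -> A (fin w).
Proof. exact: (nbhsCP z (fun w => A (fin w))). Qed.

End SphereTopology.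

(** * Equivariance and poles *)

Section Equivariance.
Variable R : realType.
Local Notation C := R[i].
Local Notation Re := (@complex.Re R).
Local Notation Im := (@complex.Im R).
Local Notation rho := (rho R).
Local Notation s3 := (Num.sqrt 3 : R).
Let c : C := 2 * iPi R.

Lemma p_fin (tau : C) : 0 < Im tau -> G2 tau != 0 -> p tau = fin (pf tau).
Proof. by move=> t0 /negbTE G0; rewrite pE // G0. Qed.

Lemma p_infty (tau : C) : 0 < Im tau -> G2 tau = 0 -> p tau = infty R.
Proof. by move=> t0 G0; rewrite pE // G0 eqxx. Qed.

Lemma G2_add1 (tau : C) : 0 < Im tau -> G2 (tau + 1) = G2 tau.
Proof. by move=> t0; rewrite -{2}(addrK 1 tau) G2_1 // ImD Im1 addr0. Qed.

Lemma p_add1 (tau : C) : 0 < Im tau -> p (tau + 1) = if p tau is Some z then fin (z + 1) else infty R.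
Proof.
move=> t0; have t1 : 0 < Im (tau + 1) by rewrite ImD Im1 addr0.
rewrite !pE // G2_add1 //; case: ifP => // _; congr fin; rewrite -/c; ring.
Qed.

Definition sphere_inv (P : Chat R) : Chat R :=
  if P is Some z then (if z == 0 then infty R else fin (- z^-1)) else fin 0.

Lemma p_inv (tau : C) : 0 < Im tau -> p (- tau^-1) = sphere_inv (p tau).
Proof.
move=> t0; have t1 := Im_invN t0; have c0 := @c_neq0 R.
have tn : tau != 0 by apply: contraTneq t0 => ->; rewrite Im0 ltxx.
rewrite !pE // G2_inv // -/c; have [->|G0] := eqVneq (G2 tau) 0.
  rewrite mulr0 sub0r mulrN oppr_eq0 mulf_eq0 (negbTE tn) (negbTE c0) /=.
  by congr fin; rewrite invrN mulrN opprK invfM mulrCA divff // mulr1 addrC subrr.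
rewrite /sphere_inv /fin.
have E : tau * G2 tau - c = G2 tau * (tau - c / G2 tau) by field.
rewrite E !mulf_eq0 (negbTE tn) (negbTE G0) /=; case: eqVneq => // p0; congr Some.
have : c = G2 tau * (tau - (tau - c / G2 tau)) by field.
by move: p0; move: (tau - c / _) => w w0 {1}->; field; rewrite tn G0 w0.
Qed.

Lemma cs_conj (z : C) : cs (conjc z) = conjc (cs z).
Proof.
apply: (cvgC_unique _ (@csN_cvg R (conjc z))).
apply: cvgC_ext (cvg_conj (@csN_cvg R z)) => N.
rewrite /csN (raddf_zsum (@conjc R)); apply: eq_zsum => n /=.
by rewrite ?conjc_inv ?conjcX ?conjc_inv conjcB (rmorph_int (@conjc R)).
Qed.

Lemma conj_G2 (tau : C) : 0 < Im tau -> G2 (- conjc tau) = conjc (G2 tau).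
Proof.
move=> t0; have t1 : 0 < Im (- conjc tau) by rewrite ImN Im_conj opprK.
apply: (cvgC_unique _ (G2_cvg t1)); apply: cvgC_ext (cvg_conj (G2_cvg t0)) => M.
rewrite (raddf_zsum (@conjc R)); apply: eq_zsum => k.
have -> : k%:~R * - conjc tau = - conjc (k%:~R * tau) by rewrite conjcM (rmorph_int (@conjc R)) mulrN.
by rewrite cs_opp cs_conj.
Qed.

Lemma conj_pf (tau : C) : 0 < Im tau -> pf (- conjc tau) = - conjc (pf tau).
Proof.
move=> t0; rewrite /pf conj_G2 // conjcB conjcM conjcV.
have -> : conjc (2 * iPi R) = - (2 * iPi R).
  rewrite conjcM (rmorph_nat (@conjc R)) (_ : conjc (iPi R) = - iPi R) ?mulrN //.
  by rewrite /iPi; simpc.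
by rewrite mulNr; ring.
Qed.

(** Equivariance under inversion leaves both [i] and [-i] possible; the law of [G2] itself decides,
    giving [c / G2 = 2 i] at [i]. *)
Lemma p_i : p (iunit R) = fin (- iunit R).
Proof.
have i0 : 0 < Im (iunit R) by exact: ltr01.
have ii : iunit R * iunit R = -1 by rewrite /iunit; simpc.
have iV : - (iunit R)^-1 = iunit R.
  by apply/eqP; rewrite eqr_oppLR; apply/eqP/(mulfI (x := iunit R)); rewrite ?divff ?mulrN ?ii ?opprK //;
   apply: contraTneq i0 => ->; rewrite ltxx.
have := G2_inv i0; rewrite iV mulrBr mulrA ii mulN1r => H.
have c0 := @c_neq0 R.
have GE : 2 * G2 (iunit R) = - (iunit R * c).
  by apply: (addIr (- G2 (iunit R))); rewrite mulr_natl mulr2n addrK {1}H addrC.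
have G0 : G2 (iunit R) != 0.
  apply: contraTneq i0 => E; move: GE; rewrite E mulr0 => /eqP; rewrite eq_sym oppr_eq0 mulf_eq0 (negbTE c0) orbF => /eqP ->.
  by rewrite ltxx.
rewrite (p_fin i0 G0) /pf -/c; congr fin.
have -> : c = 2 * (iunit R * G2 (iunit R)).
  by rewrite mulrCA GE mulrN mulrA ii mulN1r opprK.
by field.
Qed.

Lemma p_rho : p rho = fin (rho_conj R).
Proof.
have t0 := @Im_rho_gt0 R; have c0 := @c_neq0 R; have cE := @G2_rho R.
have G0 : G2 rho != 0 by apply: contraNneq c0 => E; rewrite cE E mulr0.
by rewrite p_fin // rho_conjE conj_rho /pf cE; congr fin; field.
Qed.

Lemma near_uhp (tau : C) : 0 < Im tau -> \forall w \near tau, 0 < Im w.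
Proof.
move=> t0; apply/nbhsCP; exists (Im tau) => // w wt.
have := ler_Im_normc (w - tau); rewrite ImD ImN ler_norml => /andP[]; lra.
Qed.

Lemma near_G2_neq0 (tau : C) : 0 < Im tau -> G2 tau != 0 -> \forall w \near tau, 0 < Im w /\ G2 w != 0.
Proof.
move=> t0 G0; have cG := cder_continuous (cder_G2 t0).
near=> w; split; near: w.
  exact: near_uhp.
move/cvgC_nbhs: cG => /(_ (normc (G2 tau))); rewrite normc_gt0 => /(_ G0)[d d0 Hd].
apply/nbhsCP; exists d; [exact: d0|move=> w /Hd; apply: contraTneq => ->].
by rewrite subr0 ltxx.
Unshelve. all: by end_near. Qed.

Lemma cder_isolated (f : C -> C) (z d : C) : cder f z d -> d != 0 ->
  exists2 r, 0 < r & forall w, normc (w - z) < r -> f w = f z -> w = z.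
Proof.
move=> Hf d0; have nd : 0 < normc d by rewrite normc_gt0.
have e0 : 0 < normc d / 2 by rewrite divr_gt0.
have [r r0 Hr] := Hf _ e0; exists r => // w wz fw; apply/eqP; rewrite -subr_eq0 -normc_eq0.
have := Hr _ wz; rewrite [z + _]addrC subrK fw subrr sub0r normcN normcM.
have := normc_ge0 (w - z); move: (normc (w - z)) (normc d) nd => x y y0 x0 H.
rewrite eq_le x0 andbT; have : y * x <= 0 by clear -H; lra.
by rewrite pmulr_rle0.
Qed.

Lemma pf_holomorphic (tau : C) : 0 < Im tau -> G2 tau != 0 -> finite_holomorphic_at (@p R) tau.
Proof.
move=> t0 G0; have U := near_G2_neq0 t0 G0.
exists (@pf R); apply: filterS U => w [w0 Gw]; last exact: p_fin.
by have [] := cder_is_derive (cder_pf w0 Gw).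
Qed.

(* The second alternative makes this property invariant under the modular group,
   although p is not injective near the orbit of rho; at a pole it fails, so that
   the first alternative isolates the pole. *)
Definition isolated_value (tau : C) :=
  (\forall w \near tau, w != tau -> p w <> p tau) \/ (exists2 z, p tau = fin z & Im z != 0).

(** [phi] is a modular substitution and [sigma] its action on values, which must not create non-real
    finite values out of real or infinite ones. *)
Lemma isolated_value_pull (phi : C -> C) (sigma : Chat R -> Chat R) (tau : C) :
  phi w @[w --> tau] --> phi tau ->
  (\forall w \near tau, p (phi w) = sigma (p w)) ->
  (\forall w \near tau, phi w = phi tau -> w = tau) ->
  (forall P, (exists2 z, sigma P = fin z & Im z != 0) -> exists2 z, P = fin z & Im z != 0) ->
  isolated_value (phi tau) -> isolated_value tau.
Proof.
move=> cphi pphi iphi Hs [H|H]; last by right; apply: Hs; rewrite -(nbhs_singleton pphi).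
left; have {}H := cphi _ H; have p0 := nbhs_singleton pphi.
move: H; rewrite nbhs_simpl => H; near=> w => wt pw.
have pE : p (phi w) = sigma (p w) by near: w.
have : phi w != phi tau -> p (phi w) <> p (phi tau) by near: w; exact: H.
have iw : phi w = phi tau -> w = tau by near: w.
by apply; [apply: contraNneq wt => /iw ->|rewrite pE p0 pw].
Unshelve. all: by end_near. Qed.

Lemma isolated_value_sub1 (tau : C) : 0 < Im tau -> isolated_value (tau + 1) -> isolated_value tau.
Proof.
move=> t0; apply: (@isolated_value_pull (fun w => w + 1) (fun P => if P is Some z then fin (z + 1) else infty R)).
- exact: (cder_continuous (cderD (cder_id tau) (cder_cst 1 tau))).
- by near=> w; apply: p_add1; near: w; exact: near_uhp.
- by near=> w => /addIr.
- move=> [z|] [w] // [<-]; rewrite ImD Im1 addr0 => wz; by exists z.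
Unshelve. all: by end_near. Qed.

Lemma p_sub1 (tau : C) : 0 < Im tau -> p (tau - 1) = if p tau is Some z then fin (z - 1) else infty R.
Proof.
move=> t0; have t1 : 0 < Im (tau - 1) by rewrite ImD ImN Im1 subr0.
have := p_add1 t1; rewrite subrK => ->; case: (p _) => //= z.
by rewrite addrK.
Qed.

Lemma isolated_value_add1 (tau : C) : 0 < Im tau -> isolated_value (tau - 1) -> isolated_value tau.
Proof.
move=> t0; apply: (@isolated_value_pull (fun w => w - 1) (fun P => if P is Some z then fin (z - 1) else infty R)).
- exact: (cder_continuous (cderD (cder_id tau) (cder_cst (-1) tau))).
- by near=> w; apply: p_sub1; near: w; exact: near_uhp.
- by near=> w => /addIr.
- move=> [z|] [w] // [<-]; rewrite ImD ImN Im1 subr0 => wz; by exists z.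
Unshelve. all: by end_near. Qed.

Lemma isolated_value_inv (tau : C) : 0 < Im tau -> isolated_value (- tau^-1) -> isolated_value tau.
Proof.
move=> t0; have tn : tau != 0 by apply: contraTneq t0 => ->; rewrite Im0 ltxx.
apply: (@isolated_value_pull (fun w => - w^-1) sphere_inv).
- exact: (@cvgCN R _ (nbhs tau) (nbhs_filter tau) _ _ (cder_continuous (cder_inv tn))).
- by near=> w; apply: p_inv; near: w; exact: near_uhp.
- by near=> w => /oppr_inj/invr_inj.
- move=> [z|] [w] /=; last by case=> <-; rewrite Im0 eqxx.
  case: eqVneq => // z0 [<-]; rewrite ImN Im_inv => H; exists z => //.
  by apply: contraNneq H => ->; rewrite oppr0 mul0r oppr0.
Unshelve. all: by end_near. Qed.

Lemma translate_to_strip (tau : C) : exists n : int, `|Re (tau + n%:~R)| <= 2^-1.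
Proof.
exists (- Num.floor (Re tau + 2^-1)); rewrite ReD Re_int.
have /andP[] := floor_itv (Re tau + 2^-1).
rewrite rmorphD rmorphN /= ler_norml; move: ((Num.floor _)%:~R : R) => x h1 h2.
by apply/andP; split; clear -h1 h2; lra.
Qed.

Lemma isolated_value_int (tau : C) (n : int) : 0 < Im tau -> isolated_value (tau + n%:~R) -> isolated_value tau.
Proof.
elim/int_ind: n tau => [|n IH|n IH] tau t0; first by rewrite addr0.
  rewrite -addn1 PoszD rmorphD /= [n%:~R + _]addrC addrA => H; apply: isolated_value_sub1 => //.
  by apply: IH H; rewrite ImD Im1 addr0.
rewrite -addn1 PoszD opprD rmorphD /= [(- n%:Z)%:~R + _]addrC addrA => H; apply: isolated_value_add1 => //.
by apply: IH H; rewrite ImD ImN Im1 subr0.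
Qed.

Lemma isolated_value_hp (tau : C) : s3 / 2 <= Im tau -> isolated_value tau.
Proof.
move=> t1; have s0 := @s3_gt0 R; have t0 : 0 < Im tau by apply: lt_le_trans t1; rewrite divr_gt0.
have E0 := E2_neq0 t1; have G0 : G2 tau != 0 by rewrite G2_eq0.
have [qE|qn] := eqVneq (nome tau) (nome rho).
  right; exists (pf tau); first exact: p_fin.
  have Gr : G2 tau = G2 rho by rewrite (G2_nome t0) (G2_nome (@Im_rho_gt0 R)) /E2 qE.
  (* Here [c / G2 tau = 2 rho - 1], so [Im (pf tau) = Im tau - s3 <= - s3 / 2]. *)
  have cE := @G2_rho R; rewrite /pf cE -Gr mulfK // ImD opprK ImD Im1 add0r ImN ImM Re_nat Im_nat Im_rho mul0r addr0.
  have t2 : Im tau <= s3 / 2.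
    by rewrite leNgt; apply/negP => /nome_hp_neq; rewrite qE eqxx.
  by rewrite lt_eqF //; clear -t2 s0; lra.
have d0 : dpf tau != 0 by apply: contraTneq (Re_dpf_gt0 t1 qn) => ->; rewrite Re0 ltxx.
have [r r0 Hr] := cder_isolated (cder_pf_hp t1) d0.
left; near=> w.
have [w0 Gw] : 0 < Im w /\ G2 w != 0 by near: w; exact: near_G2_neq0.
have wr : normc (w - tau) < r by near: w; apply/nbhsCP; exists r.
by move=> /eqP wt; rewrite (p_fin t0 G0) (p_fin w0 Gw) => -[/(Hr _ wr)].
Unshelve. all: by end_near. Qed.

(** Reduction to the half plane by translations and inversions. In the strip [|Re z| <= 1/2],
    inversion at least doubles [Im z] when [Im z <= 1/2], whence the induction on [n]; for
    [1/2 < Im z < s3 / 2] it lands in the half plane at once. *)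
Lemma isolated_valueP (tau : C) : 0 < Im tau -> isolated_value tau.
Proof.
have s0 := @s3_gt0 R; have ss := @sqr_s3 R.
suff key n (w : C) : 0 < Im w -> s3 / 2 <= Im w * 2 ^+ n -> isolated_value w.
  move=> t0; have [n Hn] : exists n, s3 / 2 / Im tau <= n%:R by
    exists (Num.bound (s3 / 2 / Im tau)); apply/ltW/archi_boundP; rewrite !divr_ge0 // ltW.
  apply: (key n) => //; rewrite -ler_pdivrMl // mulrC; apply: le_trans Hn _.
  by rewrite -natrX ler_nat ltnW // ltn_expl.
elim: n w => [|n IH] w w0 Hw; first by apply: isolated_value_hp; rewrite expr0 mulr1 in Hw.
have [k Hk] := translate_to_strip w.
apply: (isolated_value_int (n := k)) => //.
have : Im (w + k%:~R) = Im w by rewrite ImD Im_int addr0.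
move: (w + k%:~R) Hk => z Hk zw; rewrite -zw in w0 Hw.
have [h1|h1] := lerP (s3 / 2) (Im z); first exact: isolated_value_hp.
have h2 : normc z ^+ 2 <= 4^-1 + Im z ^+ 2.
  rewrite normc_sqr lerD2r; move: Hk; rewrite ler_norml => /andP[]; clear; move: (Re z) => x; nra.
have n0 : 0 < normc z ^+ 2 by rewrite exprn_gt0 // normc_gt0; apply: contraTneq w0 => ->; rewrite Im0 ltxx.
have Iinv : Im (- z^-1) = Im z / normc z ^+ 2 by rewrite ImN Im_inv mulNr opprK.
apply: isolated_value_inv => //; have [h3|h3] := lerP (Im z) 2^-1.
  apply: IH; first by rewrite Iinv divr_gt0.
  rewrite Iinv; apply: le_trans Hw _; rewrite exprS mulrA ler_wpM2r ?exprn_ge0 //.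
  rewrite ler_pdivlMr // mulrAC -mulrA ler_piMr ?(ltW w0) //; clear -h2 h3 w0; nra.
apply: isolated_value_hp; rewrite Iinv ler_pdivlMr //.
apply: le_trans (ler_wpM2l _ h2) _; first by rewrite divr_ge0 // ltW.
clear -h1 h3 s0 ss; move: (Im z) (Num.sqrt 3 : R) h1 h3 s0 ss => y s h1 h3 s0 ss.
have s2 : s <= 2 by clear -s0 ss; nra.
have e1 : s ^+ 2 * y = 3 * y by rewrite ss.
have e2 : s ^+ 2 * s = 3 * s by rewrite ss.
(* The inequality [s / 2 * (1/4 + y^2) <= y] is quadratic in [y], with roots [s / 6] and [s / 2]. *)
have := mulr_ge0 (ltW s0) (mulr_ge0 (_ : 0 <= s / 2 - y) (_ : 0 <= y - s / 6)).
by move=> H; have {}H := H (ltac:(lra)) (ltac:(lra)); clear -H e1 e2; lra.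
Qed.

Lemma p_meromorphic : meromorphic_on (@upper_half_plane R) (@p R).
Proof.
move=> tau t0; have [G0|G0] := eqVneq (G2 tau) 0; last by left; exact: pf_holomorphic.
right; have pt := p_infty t0 G0.
have I : \forall w \near tau, w != tau -> G2 w != 0.
  case: (isolated_valueP t0) => [|[z]]; last by rewrite pt.
  rewrite pt => H; near=> w => wt; have w0 : 0 < Im w by near: w; exact: near_uhp.
  apply/eqP => Gw; have : w != tau -> p w <> infty R by near: w.
  by move/(_ wt); rewrite p_infty.
split => //.
  rewrite near_withinE /=; near=> w => wt; apply: pf_holomorphic; first by near: w; exact: near_uhp.
  by move: wt; near: w.
apply/cvg_inftyP => K; rewrite near_withinE.
have nc : 0 < normc c by rewrite normc_gt0 c_neq0.
(* For [|w - tau| < 1], [|c / G2 w| > M] leaves more than [|K|] after subtracting [|w|]. *)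
pose M := `|K| + normc tau + 1; have M0 : 0 < M by rewrite ltr_wpDl // addr_ge0 ?normc_ge0.
have d0 : 0 < normc c / M by rewrite divr_gt0.
have [e e0 He] := (cvgC_nbhs _ _ _).1 (cder_continuous (cder_G2 t0)) _ d0.
near=> w => wt.
have w0 : 0 < Im w by near: w; exact: near_uhp.
have Gw : G2 w != 0 by move: wt; near: w.
have w1 : normc (w - tau) < 1 by near: w; apply/nbhsCP; exists 1.
have we : normc (w - tau) < e by near: w; apply/nbhsCP; exists e.
rewrite (p_fin w0 Gw) /large /= /pf -/c.
have := He _ we; rewrite G0 sub0r normcN ltr_pdivlMr // mulrC -ltr_pdivlMr ?normc_gt0 //.
have := ler_normcB (c / G2 w) w; rewrite -(normcN (_ - w)) opprB normcM normcV.
have := normcD (w - tau) tau; rewrite subrK.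
have := ler_norm K; rewrite /M; clear -w1; lra.
Unshelve. all: by end_near. Qed.

End Equivariance.

(** * The image of T0 *)

Section Boundary.
Variable R : realType.
Local Notation C := R[i].
Local Notation Re := (@complex.Re R).
Local Notation Im := (@complex.Im R).
Local Notation rho := (rho R).
Local Notation s3 := (Num.sqrt 3 : R).
Let c : C := 2 * iPi R.

(* The finite parts of T0 and T1, and their interiors. *)
Definition K0 : set C := [set z | [/\ 0 <= Re z <= 2^-1, 0 < Im z & 1 <= normc z]].
Definition K0i : set C := [set z | [/\ 0 < Re z < 2^-1, 0 < Im z & 1 < normc z]].
Definition K1 : set C := [set z | 0 <= Re z <= 2^-1 /\ (0 <= Im z \/ normc z <= 1)].
Definition K1i : set C := [set z | 0 < Re z < 2^-1 /\ (0 <= Im z \/ normc z < 1)].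

Lemma normc_ge1 (z : C) : (1 <= normc z) = (1 <= Re z ^+ 2 + Im z ^+ 2).
Proof. by rewrite -normc_sqr expr_ge1 ?normc_ge0. Qed.

Lemma normc_gt1 (z : C) : (1 < normc z) = (1 < Re z ^+ 2 + Im z ^+ 2).
Proof. by rewrite -normc_sqr expr_gt1 ?normc_ge0. Qed.

Lemma normc_le1 (z : C) : (normc z <= 1) = (Re z ^+ 2 + Im z ^+ 2 <= 1).
Proof. by rewrite !leNgt normc_gt1. Qed.

Lemma normc_lt1 (z : C) : (normc z < 1) = (Re z ^+ 2 + Im z ^+ 2 < 1).
Proof. by rewrite !ltNge normc_ge1. Qed.

Lemma K0iW (z : C) : K0i z -> K0 z.
Proof. by case=> /andP[a b] d e; split; rewrite ?(ltW a) ?(ltW b) ?(ltW e). Qed.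

(** [K0] meets the boundary of the half plane only at [rho], so [pf_inj] applies to any two distinct
    points of [K0]. *)
Lemma K0_Im (z : C) : K0 z -> s3 / 2 <= Im z /\ (Im z = s3 / 2 -> z = rho).
Proof.
case=> /andP[x0 x1] y0; rewrite normc_ge1 => n1; have s0 := @s3_gt0 R; have ss := @sqr_s3 R.
split; first by clear -x0 x1 y0 n1 s0 ss; move: (Re z) (Im z) (Num.sqrt 3 : R) x0 x1 y0 n1 s0 ss => x y s; nra.
move=> yE; apply: eqC; rewrite ?Im_rho // Re_rho.
rewrite yE in n1; apply: le_anti; rewrite x1 /=.
by clear -x0 x1 n1 s0 ss; move: (Re z) (Num.sqrt 3 : R) x0 x1 n1 s0 ss => x s; nra.
Qed.

Lemma K0i_Im (z : C) : K0i z -> s3 / 2 < Im z.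
Proof.
case=> /andP[x0 x1] y0; rewrite normc_gt1 => n1; have s0 := @s3_gt0 R; have ss := @sqr_s3 R.
by clear -x0 x1 y0 n1 s0 ss; move: (Re z) (Im z) (Num.sqrt 3 : R) x0 x1 y0 n1 s0 ss => x y s; nra.
Qed.

Lemma K0_Im_gt0 (z : C) : K0 z -> 0 < Im z. Proof. by case. Qed.

Lemma K0_G2 (z : C) : K0 z -> G2 z != 0.
Proof. by move=> Kz; rewrite (G2_eq0 (K0_Im_gt0 Kz)) E2_neq0 //; have [] := K0_Im Kz. Qed.

Lemma K0_p (z : C) : K0 z -> p z = fin (pf z).
Proof. by move=> Kz; apply: p_fin (K0_Im_gt0 Kz) (K0_G2 Kz). Qed.

Lemma pf_inj_K0 (z w : C) : K0 z -> K0 w -> pf z = pf w -> z = w.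
Proof.
move=> Kz Kw; have [z1 zr] := K0_Im Kz; have [w1 wr] := K0_Im Kw.
have [z2|z2] := eqVneq (Im z) (s3 / 2); last by apply: pf_inj => //; left; rewrite lt_neqAle eq_sym z2.
have [w2|w2] := eqVneq (Im w) (s3 / 2); last by apply: pf_inj => //; right; rewrite lt_neqAle eq_sym w2.
by move=> _; rewrite (zr z2) (wr w2).
Qed.

(** The displacement [c / G2] is [6 i / (pi E2)], with [E2] within 1/8 of 1. The bound 3 controls
    [p] near infinity; [9/8 > 1] makes [Im (pf z)] negative on the unit arc. *)
Lemma shift_bound (z : C) : s3 / 2 <= Im z ->
  normc (pf z - z) <= 3 /\ Im (pf z) <= Im z - 9 / 8.
Proof.
move=> z1; have s0 := @s3_gt0 R; have z0 : 0 < Im z by apply: lt_le_trans z1; rewrite divr_gt0.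
have m0 := @r0_gt0 R; have m1 := @r0_le R.
have qr : normc (nome z) <= r0 R by apply: normc_nome_le; rewrite ?Im_rho_gt0 ?Im_rho.
have [_ _ nS _ _] := dser_bounds m0 qr m1.
have n24 : normc (E2 z - 1) <= 8^-1.
  rewrite /E2 addrC addKr normcN normcM normc_nat; move: nS m1; rewrite /nome_bound; clear.
  by move: (normc _) (r0 R) => a b; lra.
have P0 := Pi_gt0 R; have P1 := Pi_ge R; have P2 := Pi_le R.
have E0 := E2_neq0 z1.
have nc : normc c = 2 * Pi R.
  by apply/eqP; rewrite -(eqrXn2 (n := 2)) ?normc_ge0 ?mulr_ge0 ?(ltW P0) // normc_sqr ReM ImM Re_nat Im_nat Re_iPi Im_iPi; apply/eqP; ring.
have cR : Re c = 0 by rewrite ReM Re_nat Im_nat Re_iPi; ring.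
have cI : Im c = 2 * Pi R by rewrite ImM Re_nat Im_nat Re_iPi Im_iPi; ring.
have E2E : E2 z = 1 + (E2 z - 1) by rewrite addrC subrK.
have h1 : 7 / 8 <= Re (E2 z).
  have := le_trans (ler_Re_normc _) n24; rewrite ReD ReN Re1 ler_norml => /andP[+ _]; clear; lra.
have h2 : normc (E2 z) <= 9 / 8.
  by have := normcD 1 (E2 z - 1); rewrite -E2E normc1 => /le_trans; apply; move: n24; clear; lra.
have h3 : 7 / 8 <= normc (E2 z) by apply: le_trans h1 (le_trans (ler_norm _) (ler_Re_normc _)).
have k0 : 0 < Pi R ^+ 2 / 3 by rewrite divr_gt0 // exprn_gt0.
rewrite /pf -/c (G2_nome z0); move: (E2 z) (Pi R) c E0 P0 P1 P2 nc cR cI h1 h2 h3 k0 => E P w E0 P0 P1 P2 nc cR cI h1 h2 h3 k0.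
have e0 : 0 < normc E by rewrite normc_gt0.
split.
  rewrite addrC addKr normcN normcM normcV nc normcM normc_real gtr0_norm // ler_pdivrMr; last by rewrite mulr_gt0.
  clear -P0 P1 h3; move: (normc E) h3 => e h3; nra.
rewrite ImD ImN lerD2l lerN2 ImM Re_inv Im_inv cR mul0r add0r cI ReM ReC ImC mul0r subr0 normcM normc_real gtr0_norm // exprMn mulrA ler_pdivlMr; last by rewrite mulr_gt0 // exprn_gt0.
have e2 : normc E ^+ 2 <= (9 / 8) ^+ 2 by rewrite ler_pXn2r ?nnegrE ?normc_ge0 //; clear; lra.
clear -P0 P2 h1 e2 k0; move: (normc E ^+ 2) (Re E) h1 e2 => e x h1 e2.
have e0 : 0 <= P ^+ 2 / 3 * (P / 3) by rewrite !mulr_ge0 ?exprn_ge0 ?invr_ge0 // ltW.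
have hA : 0 <= 6 * x - 9 / 8 * (P * e) by clear -h1 e2 P0 P2; nra.
rewrite -subr_ge0; apply: le_trans (mulr_ge0 e0 hA) _.
by rewrite le_eqVlt; apply/orP; left; apply/eqP; field.
Qed.

Lemma pf_left (z : C) : 0 < Im z -> Re z = 0 -> Re (pf z) = 0.
Proof.
move=> z0 x0; have zE : - conjc z = z by apply: eqC; rewrite ?ReN ?ImN ?Re_conj ?Im_conj ?opprK // x0 oppr0.
have := conj_pf z0; rewrite zE => /(congr1 Re); rewrite ReN Re_conj; lra.
Qed.

Lemma pf_right (z : C) : 0 < Im z -> Re z = 2^-1 -> Re (pf z) = 2^-1.
Proof.
move=> z0 x0; have zE : - conjc z = z - 1.
  by apply: eqC; rewrite !(ReD, ReN, ImD, ImN, Re_conj, Im_conj, Re1, Im1, opprK) ?subr0 // x0; field.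
have := conj_pf z0; rewrite zE.
have -> : pf (z - 1) = pf z - 1 by rewrite /pf G2_1 //; ring.
by move: (pf z) => w /(congr1 Re); rewrite !(ReD, ReN, Re1) Re_conj; clear; lra.
Qed.

(** On the circle [- 1 / z = - conjc z], so inversion and reflection give the same value. *)
Lemma pf_circle (z : C) : 0 < Im z -> normc z = 1 -> G2 z != 0 -> normc (pf z) = 1.
Proof.
move=> z0 z1 Gz; have zn : z != 0 by rewrite -normc_gt0 z1.
have E : - z^-1 = - conjc z by congr (- _); apply: (mulfI zn); rewrite divff // mulcJ z1 expr1n.
have := p_inv z0; rewrite E (p_fin z0 Gz) /= p_fin; last 2 first.
- by rewrite ImN Im_conj opprK.
- by rewrite conj_G2 // -normc_eq0 normc_conj normc_eq0.
rewrite conj_pf //; case: eqVneq => // p0 [/oppr_inj H].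
have : pf z * conjc (pf z) = 1 by rewrite H divff.
rewrite mulcJ => /(congr1 Re); rewrite ReC Re1 => /eqP.
by rewrite sqrp_eq1 ?normc_ge0 // => /eqP.
Qed.

Opaque pf.

Lemma pf_continuous_K0 (z : C) : K0 z -> pf w @[w --> z] --> pf z.
Proof. by move=> Kz; have [z1 _] := K0_Im Kz; apply: cder_continuous (cder_pf_hp z1). Qed.

Lemma i_K0 : K0 (iunit R).
Proof. by split; rewrite ?normc_ge1 /=; [apply/andP; split; rewrite ?invr_ge0|exact: ltr01|rewrite expr0n expr1n add0r]. Qed.

Lemma rho_K0 : K0 rho.
Proof.
split; rewrite ?normc_ge1 ?Re_rho ?Im_rho_gt0 //; first by apply/andP; split; rewrite ?invr_ge0.
by rewrite Im_rho exprMn sqr_s3; clear; lra.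
Qed.

Lemma pf_i : pf (iunit R) = - iunit R.
Proof. by have [] : fin (pf (iunit R)) = fin (- iunit R) by rewrite -K0_p ?p_i //; exact: i_K0. Qed.

Lemma pf_rho : pf rho = conjc rho.
Proof. by have [] : fin (pf rho) = fin (conjc rho) by rewrite -K0_p ?p_rho ?rho_conjE //; exact: rho_K0. Qed.

Lemma ReIm_eta (z : C) : z = Re z +i* Im z. Proof. by case: z. Qed.

Definition arcz (x : R) : C := x +i* Num.sqrt (1 - x ^+ 2).

Lemma arcz_sqr (x : R) : 0 <= x <= 2^-1 -> Num.sqrt (1 - x ^+ 2) ^+ 2 = 1 - x ^+ 2.
Proof. by move=> /andP[x0 x1]; rewrite sqr_sqrtr //; clear -x0 x1; nra. Qed.

Lemma normc_arcz (x : R) : 0 <= x <= 2^-1 -> normc (arcz x) = 1.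
Proof.
move=> x01; apply/eqP; rewrite -sqrp_eq1 ?normc_ge0 // normc_sqr /=; apply/eqP.
by rewrite arcz_sqr // addrC subrK.
Qed.

Lemma arcz_K0 (x : R) : 0 <= x <= 2^-1 -> K0 (arcz x).
Proof.
move=> x01; split=> //; last by rewrite normc_arcz.
by rewrite /= sqrtr_gt0; case/andP: x01; clear; nra.
Qed.

Lemma unit_arcz (z : C) : 0 <= Im z -> normc z = 1 -> z = arcz (Re z).
Proof.
move=> z0 z1; apply: eqC => //=; have := normc_sqr z; rewrite z1 expr1n => E.
by rewrite E addrC addKr sqrtr_sqr ger0_norm.
Qed.

Lemma arcz_continuous : continuous arcz.
Proof.
move=> x; apply: cvg_complex; first exact: cvg_id.
apply: (@continuous_comp _ _ _ (fun y : R => 1 - y ^+ 2) (@Num.sqrt R)); last exact: sqrt_continuous.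
by apply: cvgB; [exact: cvg_cst|exact: exprn_continuous].
Qed.

Lemma lower_eq (z w : C) : normc z = normc w -> Re z = Re w -> Im z < 0 -> Im w < 0 -> z = w.
Proof.
move=> n r z0 w0; apply: eqC; first exact: r.
have := normc_sqr z; rewrite n normc_sqr r => /addrI/eqP; rewrite eqf_sqr => /orP[/eqP ->//|/eqP E].
by move: w0; rewrite E oppr_lt0 => /lt_trans/(_ z0); rewrite ltxx.
Qed.

(** The image lies on the lower half circle, where a point is determined by its real part. So
    [Re (pf (arcz x))] is continuous and injective in [x], hence monotone, and its end values 0 and
    1/2 come from [i] and [rho]. *)
Lemma pf_arc (z : C) : K0 z -> normc z = 1 -> [/\ 0 <= Re (pf z) <= 2^-1, Im (pf z) < 0 & normc (pf z) = 1].
Proof.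
have Ineg w : K0 w -> normc w = 1 -> Im (pf w) < 0 /\ normc (pf w) = 1.
  move=> Kw w1; have [w2 _] := K0_Im Kw; have [_ w3] := shift_bound w2; split.
    have := le_trans (ler_norm _) (ler_Im_normc w); rewrite w1; move: w3; clear; lra.
  exact: pf_circle (K0_Im_gt0 Kw) w1 (K0_G2 Kw).
move=> Kz z1; have [] := Ineg z Kz z1; split=> //.
pose f x := Re (pf (arcz x)).
have cf : {within `[0, 2^-1], continuous f}.
  apply: continuous_in_subspaceT => x; rewrite inE /= in_itv /= => x01.
  apply: (@continuous_comp _ _ _ (fun y => pf (arcz y)) Re); last exact: Re_continuous.
  apply: (@continuous_comp _ _ _ arcz (@pf R)); first exact: arcz_continuous.
  exact: pf_continuous_K0 (arcz_K0 x01).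
have fi : {in `[0, 2^-1] &, injective f}.
  move=> x y; rewrite !in_itv /= => x01 y01 E.
  have [nx ex] := Ineg _ (arcz_K0 x01) (normc_arcz x01); have [ny ey] := Ineg _ (arcz_K0 y01) (normc_arcz y01).
  have /(pf_inj_K0 (arcz_K0 x01) (arcz_K0 y01))/(congr1 Re) : pf (arcz x) = pf (arcz y); last by [].
  exact: lower_eq (etrans ex (esym ey)) E nx ny.
have f0 : f 0 = 0.
  by rewrite /f (_ : arcz 0 = iunit R) ?pf_i ?ReN ?oppr0 //; rewrite /arcz expr0n subr0 sqrtr1.
have f1 : f 2^-1 = 2^-1.
  rewrite /f (_ : arcz 2^-1 = rho) ?pf_rho ?Re_conj ?Re_rho //.
  rewrite -Re_rho -unit_arcz ?(ltW (@Im_rho_gt0 R)) //; apply/eqP; rewrite -sqrp_eq1 ?normc_ge0 // normc_sqr Re_rho Im_rho exprMn sqr_s3.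
  by apply/eqP; field.
have h01 : (0 : R) <= 2^-1 by rewrite invr_ge0.
have := @segment_continuous_inj_le R f 0 2^-1; rewrite f0 f1 => /(_ h01 cf fi) mono.
have x01 : 0 <= Re z <= 2^-1 by case: Kz.
rewrite (unit_arcz (ltW (K0_Im_gt0 Kz)) z1) -/(f (Re z)).
have i0 : (0 : R) \in `[0, 2^-1] by rewrite in_itv /= lexx.
have i1 : (2^-1 : R) \in `[0, 2^-1] by rewrite in_itv /= lexx h01.
have ix : Re z \in `[0, 2^-1] by rewrite in_itv.
case/andP: x01 => x0 x1; have := mono _ _ ix i1; have := mono _ _ i0 ix.
by rewrite x0 x1 f0 f1 => -> ->.
Qed.

Lemma pf_line_mono (x0 : R) (z0 z : C) : (forall w, K0 w -> Re w = x0 -> Re (pf w) = x0) ->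
  K0 z0 -> Re z0 = x0 -> Re z = x0 -> Im z0 <= Im z -> Im (pf z0) <= Im (pf z).
Proof.
move=> Hx K0z z0x zx z0z.
have KK y : Im z0 <= y -> K0 (x0 +i* y).
  case: K0z; rewrite normc_ge1 z0x => a b d e; split => //; first exact: lt_le_trans e.
  by rewrite normc_ge1 /=; apply: le_trans d _; rewrite lerD2l ler_pXn2r ?nnegrE ?(ltW b) // (le_trans (ltW b)).
pose f y := Im (pf (x0 +i* y)).
have E0 : f (Im z0) = Im (pf z0) by rewrite /f -z0x -ReIm_eta.
have Ez : f (Im z) = Im (pf z) by rewrite /f -zx -ReIm_eta.
(* An injective continuous function is monotone; a point this high fixes the direction, since
   [shift_bound] gives [f B >= B - 3 = Im z] and [f (Im z0) < Im z0]. *)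
pose B := Im z + 3; have zB : Im z0 <= B by rewrite /B; clear -z0z; lra.
have cf : {within `[Im z0, B], continuous f}.
  apply: continuous_in_subspaceT => y; rewrite inE /= in_itv /= => /andP[y0 _].
  apply: (@continuous_comp _ _ _ (fun y => pf (x0 +i* y)) Im); last exact: Im_continuous.
  apply: (@continuous_comp _ _ _ (fun y => x0 +i* y) (@pf R)).
    by apply: cvg_complex; [exact: cvg_cst|exact: cvg_id].
  exact: pf_continuous_K0 (KK _ y0).
have fi : {in `[Im z0, B] &, injective f}.
  move=> x y; rewrite !in_itv /= => /andP[x1 _] /andP[y1 _] E.
  have /(pf_inj_K0 (KK _ x1) (KK _ y1))/(congr1 Im) : pf (x0 +i* x) = pf (x0 +i* y); last by [].
  by apply: eqC; [rewrite (Hx _ (KK _ x1) erefl) (Hx _ (KK _ y1) erefl)|exact: E].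
have fB : f (Im z0) <= f B.
  have [_ h1] := shift_bound (K0_Im (KK _ (lexx _))).1; have [h2 _] := shift_bound (K0_Im (KK _ zB)).1.
  have := le_trans (ler_Im_normc _) h2; rewrite ImD ImN -/(f B) ler_norml => /andP[+ _].
  move: h1 z0z; rewrite -/(f _) /= /B; clear; lra.
have mono := segment_continuous_inj_le fB cf fi.
have i0 : Im z0 \in `[Im z0, B] by rewrite in_itv /= lexx zB.
have iz : Im z \in `[Im z0, B] by rewrite in_itv /= z0z /B; clear; lra.
by rewrite -E0 -Ez (mono _ _ i0 iz).
Qed.

Lemma pf_boundary (z : C) : K0 z -> ~ K0i z -> K1 (pf z) /\ ~ K1i (pf z).
Proof.
move=> Kz nz; have [/andP[x0 x1] y0 n1] := Kz.
have h01 : (0 : R) <= 2^-1 by rewrite invr_ge0.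
have [z1|z1] := eqVneq (normc z) 1.
  have [a b d] := pf_arc Kz z1; split; first by split=> //; right; rewrite d.
  by case=> _ []; [move: b; rewrite ltNge => /negP|rewrite d ltxx].
have [r1|r1] := eqVneq (Re z) 0.
  have rr := pf_left y0 r1; split; last by rewrite /K1i /= rr ltxx; case.
  split; first by rewrite rr lexx h01.
  have H : Im (pf (iunit R)) <= Im (pf z).
    apply: (@pf_line_mono 0) => //; [by move=> w [_ w0 _]; exact: pf_left|exact: i_K0|].
    by move: n1; rewrite normc_ge1 r1 expr0n add0r expr_ge1 ?(ltW y0).
  have [|i0] := lerP 0 (Im (pf z)); first by left.
  right; rewrite normc_le1 rr expr0n add0r; move: H; rewrite pf_i ImN /=; clear -i0; move: (Im _) i0 => y; nra.
have [r2|r2] := eqVneq (Re z) 2^-1; last first.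
  by case: nz; split=> //; [rewrite !lt_neqAle x0 x1 r2 eq_sym r1|rewrite lt_neqAle eq_sym z1].
have rr := pf_right y0 r2; split; last by rewrite /K1i /= rr ltxx andbF; case.
split; first by rewrite rr lexx h01.
have H : Im (pf rho) <= Im (pf z).
  apply: (@pf_line_mono 2^-1) => //; [by move=> w [_ w0 _]; exact: pf_right|exact: rho_K0|exact: Re_rho|].
  by rewrite Im_rho; have [] := K0_Im Kz.
have [|i0] := lerP 0 (Im (pf z)); first by left.
right; rewrite normc_le1 rr; move: H; rewrite pf_rho Im_conj Im_rho; have := @sqr_s3 R; have := @s3_gt0 R.
clear -i0; move: (Im _) (Num.sqrt _) i0 => y s; nra.
Qed.

End Boundary.

(** * Open mapping and inverse functions *)

Section OpenMapping.
Variable R : realType.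
Local Notation C := R[i].
Local Notation Re := (@complex.Re R).
Local Notation Im := (@complex.Im R).

(** A damped Newton step [h = - m (f z - v) / d] reduces the distance by the factor [1 - m], up to
    an error of at most half the gain. *)
Lemma cder_decrease (f : C -> C) (z d v : C) (r : R) : cder f z d -> d != 0 -> f z != v -> 0 < r ->
  exists2 w, normc (w - z) < r & normc (f w - v) < normc (f z - v).
Proof.
move=> Hf d0 fv r0; have nd : 0 < normc d by rewrite normc_gt0.
have e0 : 0 < normc d / 2 by rewrite divr_gt0.
have [s s0 Hs] := Hf _ e0; pose u := f z - v; have u0 : u != 0 by rewrite subr_eq0.
have nu : 0 < normc (u / d) by rewrite normc_gt0 mulf_neq0 ?invr_eq0.
pose m := Num.min 1 (Num.min r s / (2 * normc (u / d))).
have rs : 0 < Num.min r s by rewrite lt_min r0.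
have m0 : 0 < m by rewrite lt_min ltr01 divr_gt0 // mulr_gt0.
have m1 : m <= 1 by rewrite ge_min lexx.
have m2 : m * normc (u / d) < Num.min r s.
  apply: (@le_lt_trans _ _ (Num.min r s / 2)); last by clear -rs; lra.
  by rewrite -ler_pdivlMr // -mulrA -invfM ge_min lexx orbT.
pose h := - (m%:C * (u / d)).
have nh : normc h = m * normc (u / d) by rewrite normcN normcM normc_real gtr0_norm.
move: m2; rewrite -nh lt_min => /andP[hr hs]; exists (z + h); first by rewrite addrC addKr.
have -> : f (z + h) - v = (f (z + h) - f z - d * h) + (1 - m%:C) * u by rewrite /h /u; field.
apply: le_lt_trans (normcD _ _) _.
have -> : normc ((1 - m%:C) * u) = (1 - m) * normc u.
  by rewrite -(rmorph1 (real_complex R)) -rmorphB normcM normc_real ger0_norm // subr_ge0.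
apply: le_lt_trans (lerD (Hs _ hs) (lexx _)) _.
have -> : normc d / 2 * normc h = m * normc u / 2.
  by rewrite nh normcM normcV; field; rewrite gt_eqF.
have : 0 < m * normc u by rewrite mulr_gt0 // normc_gt0.
by clear; lra.
Qed.

(* Minimise |f - v| over a closed disc: for v near f z the minimum is not on
   the boundary circle, and where f' is nonzero it can only be zero. *)
Lemma open_mapping_at (f : C -> C) (z : C) (r : R) : 0 < r ->
  (forall w, normc (w - z) <= r -> exists2 d, cder f w d & d != 0) ->
  (forall w, normc (w - z) <= r -> f w = f z -> w = z) ->
  exists2 e, 0 < e & forall v, normc (v - f z) < e -> exists2 w, normc (w - z) <= r & f w = v.
Proof.
move=> r0 Hd Hi.
have nc : continuous (fun w => normc (w - z)).
  move=> w; apply: (@cvg_normc R _ (nbhs w) (nbhs_filter w)).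
  exact: (cder_continuous (cderD (cder_id w) (cder_cst (- z) w))).
have cdisk : compact [set w | normc (w - z) <= r].
  apply: (@subclosed_compact _ _ [set w | normc w <= normc z + r]).
  - by apply: (@preimage_closed _ _ _ [set x | x <= r] (fun w _ => nc w)); exact: closed_le.
  - exact: compact_closed_disk.
  - by move=> w /=; have := normcD (w - z) z; rewrite subrK; lra.
have ccirc : compact [set w | normc (w - z) = r].
  apply: (@subclosed_compact _ _ [set w | normc (w - z) <= r]) => //.
  - by apply: (@preimage_closed _ _ _ [set x | x = r] (fun w _ => nc w)); exact: closed_eq.
  - by move=> w /= ->.
have cf v A : A `<=` [set w | normc (w - z) <= r] -> {within A, continuous (fun w => normc (f w - v))}.
  move=> Ar; apply: continuous_in_subspaceT => w; rewrite inE => /Ar /Hd[d Hf _].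
  apply: (@cvg_normc R _ (nbhs w) (nbhs_filter w)).
  exact: (cder_continuous (cderD Hf (cder_cst (- v) w))).
have circ0 : [set w | normc (w - z) = r] !=set0.
  by exists (z + r%:C); rewrite /= addrC addKr normc_real gtr0_norm.
have [c] := compact_EVT_min circ0 ccirc (cf (f z) _ (fun w (E : normc (w - z) = r) => eq_ind_r (fun x => x <= r) (lexx r) E)).
rewrite inE /= => cr Hc.
pose m := normc (f c - f z); have m0 : 0 < m.
  rewrite normc_gt0 subr_eq0; apply/eqP => /Hi; rewrite cr lexx => /(_ isT) cz.
  by move: cr r0; rewrite cz subrr normc0 => <-; rewrite ltxx.
exists (m / 2) => [|v vz]; first by rewrite divr_gt0.
have disk0 : [set w | normc (w - z) <= r] !=set0 by exists z; rewrite /= subrr normc0 ltW.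
have [w] := compact_EVT_min disk0 cdisk (cf v _ (fun w H => H)); rewrite inE /= => wr Hw.
exists w => //; apply/eqP; apply: contraT => fv; exfalso.
have wlt : normc (w - z) < r.
  rewrite lt_neqAle wr andbT; apply/eqP => wE.
  have h1 : m <= normc (f w - f z) by apply: Hc; rewrite inE.
  have h2 : normc (f w - v) <= normc (f z - v) by apply: Hw; rewrite inE /= subrr normc0 ltW.
  have := normcD (f w - v) (v - f z); rewrite addrA subrK.
  by move: h2; rewrite (normcB (f z) v); clear -h1 vz; lra.
have [d Hf d0] := Hd w wr.
have s0 : 0 < r - normc (w - z) by rewrite subr_gt0.
have [w' w'w] := cder_decrease Hf d0 fv s0.
rewrite ltNge => /negP; apply; apply: Hw; rewrite inE /=.
by have := normcD (w' - w) (w - z); rewrite addrA subrK; clear -w'w; lra.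
Qed.

Lemma cder_inverse (f k : C -> C) (w d : C) : cder f (k w) d -> d != 0 ->
  k v @[v --> w] --> k w -> (\forall v \near w, f (k v) = v) -> cder k w d^-1.
Proof.
move=> Hf d0 /cvgC_nbhs ck /nbhsCP[r r0 Hr] e e0.
have nd : 0 < normc d by rewrite normc_gt0.
(* The first bound yields [|k (w + h) - k w| <= 2 |h| / |d|]; the second then brings the error below
   [e |h|]. *)
pose e' := Num.min (normc d / 2) (e * normc d ^+ 2 / 2).
have e'0 : 0 < e' by rewrite lt_min !divr_gt0 // mulr_gt0 // exprn_gt0.
have [s s0 Hs] := Hf _ e'0; have [t t0 Ht] := ck _ s0.
exists (Num.min r t); first by rewrite lt_min r0.
move=> h; rewrite lt_min => /andP[hr ht]; pose D := k (w + h) - k w.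
have hD : normc D < s by rewrite /D normcB; apply: Ht; rewrite addrC addKr.
have := Hs _ hD; rewrite /D [k w + _]addrC subrK Hr; last by rewrite addrC addKr.
rewrite Hr; last by rewrite subrr normc0.
rewrite (_ : w + h - w = h) -?/D => [H|]; last by rewrite addrC addKr.
have e1 : e' <= normc d / 2 by rewrite ge_min lexx.
have e2 : e' <= e * normc d ^+ 2 / 2 by rewrite ge_min lexx orbT.
have nD : normc d * normc D <= 2 * normc h.
  rewrite -normcM; have := normcB (d * D) h; have := normcD (d * D - h) h; rewrite subrK.
  have : e' * normc D <= normc d / 2 * normc D by rewrite ler_wpM2r ?normc_ge0.
  move: H; rewrite normcM; clear; lra.
have -> : D - d^-1 * h = - d^-1 * (h - d * D) by field.
rewrite normcM normcN normcV mulrC ler_pdivrMr //; apply: le_trans H _.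
apply: (@le_trans _ _ (e * normc d ^+ 2 / 2 * normc D)); first by rewrite ler_wpM2r ?normc_ge0.
have -> : e * normc d ^+ 2 / 2 * normc D = e * normc d / 2 * (normc d * normc D) by ring.
apply: le_trans (ler_wpM2l _ nD) _; first by rewrite divr_ge0 // mulr_ge0 // ltW.
by rewrite le_eqVlt; apply/orP; left; apply/eqP; field.
Qed.

End OpenMapping.

(** * Surjectivity onto [T1] *)

Section Surjectivity.
Variable R : realType.
Local Notation C := R[i].
Local Notation Re := (@complex.Re R).
Local Notation Im := (@complex.Im R).
Local Notation s3 := (Num.sqrt 3 : R).
Local Notation K0 := (@K0 R).
Local Notation K1 := (@K1 R).
Local Notation K0i := (@K0i R).
Local Notation K1i := (@K1i R).
Local Notation T0 := (@T0 R).
Local Notation T1 := (@T1 R).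
Opaque pf.

Lemma normcE_le1 (z : C) : (`|z| <= 1) = (normc z <= 1).
Proof. by rewrite normcE -[1]/(1%:C) lecR. Qed.

Lemma T0_fin (z : C) : T0 (fin z) <-> K0 z.
Proof.
split=> [[[w [a b d] [<-]]|//]|[a b d]].
  by split=> //; move: d; rewrite normcE -[1]/(1%:C) lecR.
by left; exists z => //; split=> //; rewrite normcE -[1]/(1%:C) lecR.
Qed.

Lemma T1_fin (z : C) : T1 (fin z) <-> K1 z.
Proof.
split=> [[[w [a b] [<-]]|//]|[a b]].
  split=> //; have [|w0] := lerP 0 (Im w); first by left.
  by right; rewrite leNgt; apply/negP => w1; apply: b; split=> //; rewrite normcE -[1]/(1%:C) ltcR.
left; exists z => //; split=> //= -[z0]; rewrite normcE -[1]/(1%:C) ltcR ltNge.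
by case: b => [b0|-> //]; move: z0; rewrite ltNge b0.
Qed.

Lemma T0_infty : T0 (infty R). Proof. by right. Qed.
Lemma T1_infty : T1 (infty R). Proof. by right. Qed.

Lemma closed_real_le (f g : C -> R) : continuous f -> continuous g -> closed [set z | f z <= g z].
Proof.
move=> cf cg; rewrite (_ : mkset _ = [set z | 0 <= g z - f z]).
  apply: (@preimage_closed _ _ (fun z => g z - f z) [set x | 0 <= x]); last exact: closed_ge.
  by move=> z _; exact: (cvgB (cg z) (cf z)).
by apply/seteqP; split=> z /=; rewrite subr_ge0.
Qed.

Lemma closed_K0 : closed K0.
Proof.
have E : K0 = [set z : C | 0 <= Re z] `&` [set z | Re z <= 2^-1] `&` [set z | 0 <= Im z] `&` [set z | 1 <= normc z].
  apply/seteqP; split=> [z [/andP[a b] d e]|z [[[/= a b] d] e]]; first by do !split => //=; exact: ltW.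
  split=> //; first by rewrite a.
  rewrite lt_neqAle d andbT; apply/eqP => I0; move: e; rewrite normc_ge1 -I0.
  by clear -a b; nra.
rewrite E; do !apply: closedI; apply: closed_real_le;
  by [exact: cst_continuous|exact: Re_continuous|exact: Im_continuous|exact: normc_continuous].
Qed.

Lemma closed_K1 : closed K1.
Proof.
have E : K1 = [set z : C | 0 <= Re z] `&` [set z | Re z <= 2^-1] `&` ([set z | 0 <= Im z] `|` [set z | normc z <= 1]).
  apply/seteqP; split=> [z [/andP[a b] d]|z [[/= a b] d]]; first by [].
  by split=> //; rewrite a.
rewrite E; apply: closedI; first apply: closedI; last (apply: closedU); apply: closed_real_le;
  by [exact: cst_continuous|exact: Re_continuous|exact: Im_continuous|exact: normc_continuous].
Qed.

Lemma closed_sphere (K : set C) (T : set (Chat R)) : closed K -> (forall z, T (fin z) <-> K z) ->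
  T (infty R) -> closed T.
Proof.
move=> cK TK Ti; rewrite -(setCK T); apply: open_closedC.
have -> : ~` T = @fin R @` (~` K).
  apply/seteqP; split=> [[z|] nT|_ [z nK <-]]; last by move/TK.
    by exists z => // /TK.
  by case: nT.
by apply: one_point_compactification_open_some; exact: closed_openC.
Qed.

Lemma closed_T0 : closed T0. Proof. exact: closed_sphere closed_K0 T0_fin T0_infty. Qed.
Lemma closed_T1 : closed T1. Proof. exact: closed_sphere closed_K1 T1_fin T1_infty. Qed.

Lemma compact_sphere (T : set (Chat R)) : closed T -> compact T.
Proof. by move=> cT; apply: (subclosed_compact cT (@one_point_compactification_compact C)). Qed.

Lemma p_ext_continuous_fin (z : C) : K0 z -> {for fin z, continuous (@p_ext R)}.
Proof.
move=> Kz A; rewrite /= (K0_p Kz) => /nbhs_fin[e e0 He]; apply/nbhs_fin.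
have [d d0 Hd] := (cvgC_nbhs _ _ _).1 (pf_continuous_K0 Kz) _ e0.
have /nbhsCP[r r0 Hr] := near_G2_neq0 (K0_Im_gt0 Kz) (K0_G2 Kz).
exists (Num.min d r); first by rewrite lt_min d0.
move=> w; rewrite lt_min => /andP[wd /Hr[w0 Gw]] /=; rewrite p_fin //; apply: He.
by rewrite normcB; exact: Hd.
Qed.

Lemma p_ext_cvg_infty : p_ext P @[P --> within T0 (nbhs (infty R))] --> infty R.
Proof.
apply/cvg_inftyP => K; rewrite near_withinE; apply/nbhs_inftyP; exists (K + 3) => -[z|//] /= Kz /T0_fin K0z.
rewrite (K0_p K0z) /=; have [h _] := shift_bound (K0_Im K0z).1.
by have := normcD (pf z) (z - pf z); rewrite addrC subrK (normcB z); move: h Kz; clear; lra.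
Qed.

Lemma p_ext_continuous : {within T0, continuous (@p_ext R)}.
Proof.
apply/subspace_continuousP => -[z /T0_fin Kz|_]; last exact: p_ext_cvg_infty.
apply: cvg_within_filter; exact: p_ext_continuous_fin.
Qed.

Let A : set C := @pf R @` K0.

Lemma image_T0_fin (w : C) : (@p_ext R @` T0) (fin w) <-> A w.
Proof.
split=> [[[z /T0_fin Kz|//]]|[z Kz <-]]; first by rewrite /= (K0_p Kz) => -[<-]; exists z.
by exists (fin z); [exact/T0_fin|rewrite /= (K0_p Kz)].
Qed.

Lemma closed_image : closed A.
Proof.
have cT : closed (@p_ext R @` T0).
  apply: (compact_closed (@sphere_hausdorff R)); apply: continuous_compact p_ext_continuous _.
  exact: compact_sphere closed_T0.
have -> : A = @fin R @^-1` (@p_ext R @` T0) by apply/seteqP; split=> w /image_T0_fin.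
by apply: preimage_closed cT => z _; exact: one_point_compactification_some_continuous.
Qed.

Lemma open_K0i : open K0i.
Proof.
have E : K0i = ~` ([set z : C | Re z <= 0] `|` [set z | 2^-1 <= Re z] `|` [set z | Im z <= 0] `|` [set z | normc z <= 1]).
  apply/seteqP; split=> [z [/andP[a b] d e]|z nz].
    by move=> [[[]|]|] /=; rewrite leNgt ?a ?b ?d ?e.
  split; first (apply/andP; split); rewrite ltNge; apply/negP => H; apply: nz;
    by [left; left; left|left; left; right|left; right|right].
rewrite E; apply: closed_openC; do !apply: closedU; apply: closed_real_le;
  by [exact: cst_continuous|exact: Re_continuous|exact: Im_continuous|exact: normc_continuous].
Qed.

Lemma dpf_neq0 (z : C) : K0i z -> dpf z != 0.
Proof.
move=> Kz; apply: contraTneq (Re_dpf_gt0 (ltW (K0i_Im Kz)) (nome_hp_neq (K0i_Im Kz))) => ->.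
by rewrite Re0 ltxx.
Qed.

Lemma pf_open (z : C) : K0i z -> exists2 e, 0 < e & forall v, normc (v - pf z) < e -> exists2 w, K0i w & pf w = v.
Proof.
move=> Kz; have /nbhsCP[r r0 Hr] := open_nbhs_nbhs (conj open_K0i Kz).
have r2 : 0 < r / 2 by rewrite divr_gt0.
have H w : normc (w - z) <= r / 2 -> K0i w by move=> wr; apply: Hr; move: wr r0; clear; lra.
have [||e e0 He] := @open_mapping_at R (@pf R) z (r / 2) r2.
- by move=> w /H Kw; exists (dpf w); [exact: cder_pf_hp (ltW (K0i_Im Kw))|exact: dpf_neq0].
- by move=> w /H Kw; apply: pf_inj_K0; exact: K0iW.
by exists e => // v /He[w wr wv]; exists w => //; exact: H.
Qed.

(* The image is closed, and open away from K1 minus K1i, hence constant along segments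
   that stay inside K1i or outside K1. *)
Lemma image_path (D : set C) (g : R -> C) : (forall w, D w -> K1 w -> K1i w) ->
  continuous g -> (forall t, 0 <= t <= 1 -> D (g t)) -> A (g 0) -> A (g 1).
Proof.
move=> HD cg Dg A0; pose B := `[(0:R), 1]%classic `&` (g @^-1` A).
have BE : B = `[(0:R), 1]%classic `&` (g @^-1` (interior A)).
  apply/seteqP; split=> t [t01]; last by move=> /interior_subset.
  move=> [z Kz zE]; split=> //; have Ki : K0i z.
    apply: contrapT => nz; have [k1 k2] := pf_boundary Kz nz.
    by apply: k2; apply: HD k1; rewrite zE; apply: Dg; move: t01; rewrite /= in_itv.
  have [e e0 He] := pf_open Ki; rewrite /= -zE; apply/nbhsCP; exists e => // v /He[w Kw wv].
  by exists w => //; exact: K0iW.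
suff : B = `[(0:R), 1]%classic.
  move=> E; have : B 1 by rewrite E /= in_itv /= lexx ler01.
  by case.
apply: (@segment_connected R 0 1).
- by exists 0; split=> //=; rewrite in_itv /= lexx ler01.
- exists (g @^-1` (interior A)) => //.
  by apply: open_comp; [move=> t _; exact: cg|exact: open_interior].
- exists (g @^-1` A) => //.
  by apply: preimage_closed; [move=> t _; exact: cg|exact: closed_image].
Qed.

Lemma image_segment (D : set C) (a b : C) : (forall w, D w -> K1 w -> K1i w) ->
  (forall t, 0 <= t <= 1 -> D ((Re a + t * (Re b - Re a)) +i* (Im a + t * (Im b - Im a)))) -> A a -> A b.
Proof.
move=> HD Hab Aa; have := @image_path D _ HD _ Hab; rewrite !mul0r !mul1r !addr0 ![_ + (_ - _)]addrC !subrK -!ReIm_eta.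
apply=> // t; apply: cvg_complex.
  by apply: cvgD; [exact: cvg_cst|apply: cvgMr_tmp; exact: cvg_id].
by apply: cvgD; [exact: cvg_cst|apply: cvgMr_tmp; exact: cvg_id].
Qed.

Lemma image_far (w : C) : A w -> [/\ - 3 <= Re w, Re w <= 4 & - 3 <= Im w].
Proof.
move=> [z Kz <-]; have [h _] := shift_bound (K0_Im Kz).1; have [/andP[a b] d _] := Kz.
have := le_trans (ler_Re_normc _) h; have := le_trans (ler_Im_normc _) h.
rewrite !ReD !ImD !ReN !ImN !ler_norml => /andP[h1 h2] /andP[h3 h4].
by split; clear -a b d h1 h2 h3 h4; lra.
Qed.

(** The complement of [K1] is covered by a left half plane, a right half plane and the region below
    the arc. Each is stable under translation outwards, and a move by 4 carries an image point
    beyond the limits of [image_far]. *)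
Lemma image_sub (w : C) : A w -> K1 w.
Proof.
move=> Aw; apply: contrapT => nK.
have [x0|x0] := ltrP (Re w) 0.
  have [] // := @image_far ((Re w - 4) +i* Im w); last by rewrite /=; clear -x0; lra.
  apply: (@image_segment [set z | Re z < 0] w) => // [z|t /andP[t0 t1]] /=; last by clear -x0 t0 t1; lra.
  by move=> z0 [/andP[]]; rewrite leNgt z0.
have [x1|x1] := ltrP 2^-1 (Re w).
  have [] // := @image_far ((Re w + 4) +i* Im w); last by rewrite /=; clear -x1; lra.
  apply: (@image_segment [set z | 2^-1 < Re z] w) => // [z|t /andP[t0 t1]] /=; last by clear -x1 t0 t1; lra.
  by move=> z0 [/andP[_]]; rewrite leNgt z0.
have [y0|y0] := lerP 0 (Im w); first by apply: nK; split; [rewrite x0|left].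
have [n1|n1] := lerP (normc w) 1; first by apply: nK; split; [rewrite x0|right].
have [] // := @image_far (Re w +i* (Im w - 4)); last by rewrite /=; clear -y0; lra.
apply: (@image_segment [set z | Im z < 0 /\ 1 < normc z] w) => // [z|t /andP[t0 t1]].
  by move=> [z0 z1] [_ []]; rewrite leNgt ?z0 ?z1.
rewrite /mkset normc_gt1 /=; move: n1; rewrite normc_gt1; clear -y0 t0 t1; move: (Re w) (Im w) y0 => x y y0 n1.
split; first by nra.
rewrite subrr mulr0 addr0; apply: lt_le_trans n1 _; rewrite lerD2l.
have : 0 <= t * 4 by lra.
rewrite (_ : t * (y - 4 - y) = - (t * 4)); last by ring.
by clear -y0; move: (t * 4) => u; nra.
Qed.

Lemma interior_K1 (w : C) (e : R) : 0 < e -> (forall v, normc (v - w) < e -> K1 v) -> K1i w.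
Proof.
move=> e0 H; have e2 : 0 < e / 2 by rewrite divr_gt0.
have [/andP[x0 x1] yn] : K1 w by apply: H; rewrite subrr normc0.
have Hx (s : R) : `|s| < e -> 0 <= Re w + s <= 2^-1.
  move=> se; have [] : K1 (w + s%:C) by apply: H; rewrite addrC addKr normc_real.
  by rewrite ReD ReC.
have ne : `|e / 2| < e by rewrite gtr0_norm //; clear -e0; lra.
have nne : `|- (e / 2)| < e by rewrite normrN.
have /andP[a1 _] := Hx _ nne; have /andP[_ a2] := Hx _ ne.
split; first by apply/andP; split; clear -a1 a2 e2; lra.
case: yn => [|n1]; first by left.
have [|y0] := lerP 0 (Im w); first by left.
right; rewrite lt_neqAle n1 andbT; apply/eqP => nE.
have [_] : K1 (w + 'i%C * (- (e / 2))%:C).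
  by apply: H; rewrite addrC addKr normcM normci mul1r normc_real.
have Rv : Re (w + 'i%C * (- (e / 2))%:C) = Re w by rewrite !(ReD, ReM, Rei, Imi, ReC, ImC); ring.
have Iv : Im (w + 'i%C * (- (e / 2))%:C) = Im w - e / 2 by rewrite !(ImD, ImM, Rei, Imi, ReC, ImC); ring.
rewrite normc_le1 Rv Iv => -[|]; first by clear -y0 e2; lra.
have := normc_sqr w; rewrite nE expr1n; move: (Re w) (Im w) y0 => x y y0.
by clear -y0 e2; move: (e / 2) e2 => f e2; nra.
Qed.

(** Near an inner point the image fills a disc, and that disc lies in [K1]. *)
Lemma pf_K0i (z : C) : K0i z -> K1i (pf z).
Proof.
move=> /pf_open[e e0 He]; apply: (interior_K1 e0) => v /He[w Kw <-].
by apply: image_sub; exists w => //; exact: K0iW.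
Qed.

Lemma segment_between (a b u v t : R) : u < a < v -> u < b < v -> 0 <= t <= 1 -> u < a + t * (b - a) < v.
Proof.
move=> /andP[a0 a1] /andP[b0 b1] /andP[t0 t1].
have [ab|ab] := lerP a b.
  have h1 : 0 <= t * (b - a) by rewrite mulr_ge0 // subr_ge0.
  have h2 : t * (b - a) <= b - a by rewrite ler_piMl // subr_ge0.
  by apply/andP; split; clear -a0 b1 h1 h2; lra.
have h1 : 0 <= t * (a - b) by rewrite mulr_ge0 // subr_ge0 ltW.
have h2 : t * (a - b) <= a - b by rewrite ler_piMl // subr_ge0 ltW.
by apply/andP; split; clear -a1 b0 h1 h2; lra.
Qed.

Lemma K1i_sub_image (w : C) : K1i w -> A w.
Proof.
move=> [/andP[x0 x1] yn].
(* Any inner point high enough would do: its image has [Im >= 7], so the path to [w] runs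
   horizontally inside the strip above the real axis, then vertically. *)
pose z0 : C := 4^-1 +i* 10%:R.
have Kz0 : K0i z0.
  by split; rewrite ?normc_gt1 /=; first (apply/andP; split); clear; lra.
have [/andP[a0 a1] _] := pf_K0i Kz0.
have Ib : 7 <= Im (pf z0).
  have [h _] := shift_bound (ltW (K0i_Im Kz0)).
  have := le_trans (ler_Im_normc _) h; rewrite ImD ImN /= ler_norml => /andP[+ _]; clear; lra.
have Az0 : A (pf z0) by exists z0 => //; exact: K0iW.
have A1 : A (Re w +i* Im (pf z0)).
  apply: (@image_segment K1i (pf z0)) Az0 => // t /andP[t0 t1] /=; split=> /=.
    apply: segment_between; [rewrite a0|rewrite x0|rewrite t0] => //.
  left; rewrite subrr mulr0 addr0; clear -Ib; lra.
apply: (@image_segment K1i _ w) A1 => // t /andP[t0 t1]; rewrite /K1i /mkset normc_lt1; split=> /=.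
  by rewrite subrr mulr0 addr0 x0.
move: yn; rewrite normc_lt1 subrr mulr0 addr0; move: (Im w) (Re w) (Im (pf z0)) Ib; clear -t0 t1 => y x b b0.
have [h|h] := lerP 0 (b + t * (y - b)); first by left.
case=> [y0|n1]; right; first by exfalso; nra.
have yb : y < b by clear -n1 b0; nra.
have : 0 <= (1 - t) * (b - y) by rewrite mulr_ge0 // subr_ge0 // ltW.
move: h; rewrite (_ : (1 - t) * (b - y) = b + t * (y - b) - y); last by ring.
by clear -n1; move: (b + _) => v; nra.
Qed.

(** The image is closed, and contracting [K1] slightly towards the point 1/4 moves it into [K1i]. *)
Lemma K1_sub_image (w : C) : K1 w -> A w.
Proof.
move=> Kw; apply: closed_image => B /nbhsCP[e e0 He].
pose m : C := 4^-1%:C; pose N := normc (m - w); have N0 : 0 <= N by exact: normc_ge0.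
have d0 : 0 < e + N by rewrite ltr_pwDl.
pose s := e / (e + N); have s0 : 0 < s by rewrite divr_gt0.
have s1 : s <= 1 by rewrite ler_pdivrMr // mul1r lerDl.
have sN : s * N < e.
  by rewrite /s mulrAC ltr_pdivrMr // ltr_pM2l // ltrDr.
pose v := w + s%:C * (m - w); exists v; split; last first.
  by apply: He; rewrite /v addrC addKr normcM normc_real gtr0_norm.
apply: K1i_sub_image; have Rv : Re v = (1 - s) * Re w + s / 4.
  by rewrite !(ReD, ReM, ReN, ReC, ImC); ring.
have Iv : Im v = (1 - s) * Im w by rewrite !(ImD, ImM, ImN, ReC, ImC); ring.
case: Kw => /andP[x0 x1] yn; split; first by rewrite Rv; apply/andP; split; clear -x0 x1 s0 s1; nra.
case: yn => [y0|n1]; first by left; rewrite Iv mulr_ge0 // subr_ge0.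
right; apply: (@le_lt_trans _ _ ((1 - s) * normc w + s / 4)).
  have -> : v = (1 - s)%:C * w + (s / 4)%:C.
    by apply: eqC; rewrite ?Rv ?Iv !(ReD, ReM, ImD, ImM, ReC, ImC); ring.
  apply: le_trans (normcD _ _) _; rewrite normcM !normc_real !ger0_norm ?subr_ge0 // divr_ge0 // ltW //.
by clear -n1 s0 s1; nra.
Qed.

End Surjectivity.

(** * The conformal map and its inverse *)

Section Conformal.
Variable R : realType.
Local Notation C := R[i].
Local Notation Re := (@complex.Re R).
Local Notation Im := (@complex.Im R).
Local Notation K0 := (@K0 R).
Local Notation K1 := (@K1 R).
Local Notation K0i := (@K0i R).
Local Notation K1i := (@K1i R).
Local Notation T0 := (@T0 R).
Local Notation T1 := (@T1 R).
Local Notation p_ext := (@p_ext R).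
Opaque pf.

Lemma K1i_image (w : C) : K1i w -> exists2 z, K0i z & pf z = w.
Proof.
move=> Kw; have [z Kz zw] := K1i_sub_image Kw; exists z => //; apply: contrapT => nz.
by have [_] := pf_boundary Kz nz; rewrite zw.
Qed.

Lemma K1iW (w : C) : K1i w -> K1 w.
Proof. by move=> /K1i_sub_image; exact: image_sub. Qed.

Lemma open_K1i : open K1i.
Proof.
rewrite openE => w /K1i_image[z /pf_open[e e0 He] zw]; apply/nbhsCP; exists e => // v.
by rewrite -zw => /He[u Ku <-]; exact: pf_K0i.
Qed.

Lemma interior_K0 (w : C) (e : R) : 0 < e -> (forall v, normc (v - w) < e -> K0 v) -> K0i w.
Proof.
move=> e0 H; have e2 : 0 < e / 2 by rewrite divr_gt0.
have [/andP[x0 x1] y0 n1] : K0 w by apply: H; rewrite subrr normc0.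
have Hx (s : R) : `|s| < e -> 0 <= Re w + s <= 2^-1.
  move=> se; have [] : K0 (w + s%:C) by apply: H; rewrite addrC addKr normc_real.
  by rewrite ReD ReC.
have ne : `|e / 2| < e by rewrite gtr0_norm //; clear -e0; lra.
have nne : `|- (e / 2)| < e by rewrite normrN.
have /andP[a1 _] := Hx _ nne; have /andP[_ a2] := Hx _ ne.
split=> //; first by apply/andP; split; clear -a1 a2 e2; lra.
rewrite lt_neqAle n1 andbT; apply/eqP => nE.
have [_] : K0 (w + 'i%C * (- (e / 2))%:C).
  by apply: H; rewrite addrC addKr normcM normci mul1r normc_real.
have Rv : Re (w + 'i%C * (- (e / 2))%:C) = Re w by rewrite !(ReD, ReM, Rei, Imi, ReC, ImC); ring.
have Iv : Im (w + 'i%C * (- (e / 2))%:C) = Im w - e / 2 by rewrite !(ImD, ImM, Rei, Imi, ReC, ImC); ring.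
rewrite normc_ge1 Rv Iv; have := normc_sqr w; rewrite -nE expr1n; move: (Re w) (Im w) y0 => x y y0.
by clear -y0 e2; move: (e / 2) e2 => f e2; nra.
Qed.

Lemma inte_sphere (K Ki : set C) (T : set (Chat R)) : closed T -> (forall z, T (fin z) <-> K z) ->
  open Ki -> Ki `<=` K ->
  (forall w e, 0 < e -> (forall v, normc (v - w) < e -> K v) -> Ki w) ->
  (forall M : R, exists2 z : C, M < normc z & ~ K z) ->
  boundary T = T `\` (@fin R @` Ki) /\ inte T = @fin R @` Ki.
Proof.
move=> cT TK oK KiK iK unb.
have iT : interior T = @fin R @` Ki.
  apply/seteqP; split=> [[z|]|_ [z Kz <-]].
  - by move=> /nbhs_fin[e e0 He]; exists z => //; apply: (iK z e) => // v /He/TK.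
  (* Infinity is not interior: points outside [K] have arbitrarily large modulus. *)
  - by move=> /nbhs_inftyP[M HM]; have [z Mz nK] := unb M; case: nK; apply/TK; exact: HM.
  - have /nbhsCP[e e0 He] := open_nbhs_nbhs (conj oK Kz).
    by apply/nbhs_fin; exists e => // v /He Kv; apply/TK; exact: KiK.
have bT : boundary T = T `\` (@fin R @` Ki) by rewrite /boundary -iT -(closure_id T).1.
split=> //; rewrite /inte bT setDD; apply/setIidPr => _ [z Kz <-].
by apply/TK; exact: KiK.
Qed.

Lemma strip_unbounded (M : R) (K : set C) : (forall z, K z -> 0 <= Re z) -> exists2 z : C, M < normc z & ~ K z.
Proof.
move=> HK; exists (- (`|M| + 1))%:C.
  by rewrite normc_real normrN ger0_norm ?addr_ge0 //; have := ler_norm M; lra.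
by move=> /HK; rewrite ReC; have := normr_ge0 M; lra.
Qed.

Lemma T0_boundary : boundary T0 = T0 `\` (@fin R @` K0i) /\ inte T0 = @fin R @` K0i.
Proof.
apply: (@inte_sphere K0) => [|z|||w e|M]; [exact: closed_T0|exact: T0_fin|exact: open_K0i|exact: K0iW|exact: interior_K0|].
by apply: strip_unbounded => z [/andP[]].
Qed.

Lemma T1_boundary : boundary T1 = T1 `\` (@fin R @` K1i) /\ inte T1 = @fin R @` K1i.
Proof.
apply: (@inte_sphere K1) => [|z|||w e|M]; [exact: closed_T1|exact: T1_fin|exact: open_K1i|exact: K1iW|exact: interior_K1|].
by apply: strip_unbounded => z [/andP[]].
Qed.

Lemma p_ext_bij : set_bij T0 T1 p_ext.
Proof.
split.
- move=> [z|] /=; last by move=> _; exact: T1_infty.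
  by move=> /T0_fin Kz; rewrite (K0_p Kz); apply/T1_fin; apply: image_sub; exists z.
- move=> [z|] [w|]; rewrite !inE => /[dup] Tz + /[dup] Tw + //=.
  + by move=> /T0_fin Kz /T0_fin Kw; rewrite (K0_p Kz) (K0_p Kw) => -[/(pf_inj_K0 Kz Kw) ->].
  + by move=> /T0_fin Kz _; rewrite (K0_p Kz).
  + by move=> _ /T0_fin Kw; rewrite (K0_p Kw).
- move=> [w|]; last by move=> _; exists (infty R) => //; exact: T0_infty.
  move=> /T1_fin /K1_sub_image[z Kz <-]; exists (fin z); first exact/T0_fin.
  by rewrite /= (K0_p Kz).
Qed.

Definition p_inverse (P : Chat R) : Chat R := get [set Q | T0 Q /\ p_ext Q = P].

Lemma p_inverseK : {in T0, cancel p_ext p_inverse}.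
Proof.
move=> P; rewrite inE => TP.
have [TQ QP] : [set Q | T0 Q /\ p_ext Q = p_ext P] (p_inverse (p_ext P)) by apply: getPex; exists P.
by have [_ inj _] := p_ext_bij; apply: inj; rewrite ?inE.
Qed.

Lemma p_inverse_continuous : {within T1, continuous p_inverse}.
Proof.
have := compact_continuous_inverse (@sphere_hausdorff R) (compact_sphere (@closed_T0 R)) (@p_ext_continuous R) p_inverseK.
have -> // : p_ext @` T0 = T1.
have [f1 _ f2] := p_ext_bij; apply/seteqP; split=> [_ [P TP <-]|]; [exact: f1|exact: f2].
Qed.

Lemma p_homeomorphism : homeomorphism_between T0 T1 p_ext.
Proof.
split; [exact: p_ext_bij|exact: p_ext_continuous|].
by exists p_inverse; [exact: p_inverseK|exact: p_inverse_continuous].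
Qed.

Lemma p_inverse_pf (z : C) : K0 z -> p_inverse (fin (pf z)) = fin z.
Proof.
move=> Kz; have := p_inverseK (_ : fin z \in T0); rewrite inE /= (K0_p Kz); apply.
exact/T0_fin.
Qed.

Lemma p_holomorphic (P : Chat R) : inte T0 P -> sphere_holomorphic_at p_ext P.
Proof.
have [_ ->] := T0_boundary; move=> [z Kz <-]; split.
  exact: p_ext_continuous_fin (K0iW Kz).
have oK := open_nbhs_nbhs (conj (@open_K0i R) Kz).
near=> w; have Kw : K0i w by near: w.
have H : cder (fun v => chart_coord (p_ext (fin z)) (p_ext (chart_param (fin z) v))) w (dpf w).
  apply: cder_ext (cder_pf_hp (ltW (K0i_Im Kw))) => //; near=> v.
  have Kv : K0i v by near: v; exact: (open_nbhs_nbhs (conj (@open_K0i R) Kw)).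
  by rewrite /= (K0_p (K0iW Kz)) (K0_p (K0iW Kv)).
by have [] := cder_is_derive H.
Unshelve. all: by end_near. Qed.

(** Continuity within [T1] is full continuity at inner points, and a continuous inverse of a
    function with nonzero derivative is differentiable. *)
Lemma p_inverse_holomorphic (Q : Chat R) : inte T1 Q -> sphere_holomorphic_at p_inverse Q.
Proof.
have [_ ->] := T1_boundary; move=> [w Kw <-].
have ct v : K1i v -> {for fin v, continuous p_inverse}.
  move=> Kv; have := (subspace_continuousP _ _).1 p_inverse_continuous (fin v).
  move=> /(_ ((T1_fin _).2 (K1iW Kv))) H B /H HB.
  have /nbhs_fin[d d0 Hd] : nbhs (fin v) [set P | T1 P -> B (p_inverse P)] by exact: HB.
  have /nbhsCP[e e0 He] := open_nbhs_nbhs (conj open_K1i Kv).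
  suff : nbhs (fin v) (p_inverse @^-1` B) by [].
  apply/nbhs_fin; exists (Num.min d e); first by rewrite lt_min d0.
  by move=> u; rewrite lt_min => /andP[/Hd + /He /K1iW/T1_fin]; exact.
split; first exact: ct.
have oK := open_nbhs_nbhs (conj open_K1i Kw).
pose k v := chart_coord (p_inverse (fin w)) (p_inverse (fin v)).
have kE v : K0i v -> k (pf v) = v.
  move=> Kv; have [u Ku uw] := K1i_image Kw.
  by rewrite /k -uw (p_inverse_pf (K0iW Ku)) (p_inverse_pf (K0iW Kv)).
near=> v; have Kv : K1i v by near: v.
have [z Kz zv] := K1i_image Kv.
have H : cder k v (dpf z)^-1.
  apply: (@cder_inverse _ (@pf R)) => //.
  - by rewrite -zv kE //; exact: cder_pf_hp (ltW (K0i_Im Kz)).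
  - exact: dpf_neq0.
  - apply/cvgC_nbhs => e e0; rewrite -zv kE //.
    have ctv : p_inverse P @[P --> fin (pf z)] --> fin z.
      by rewrite -(p_inverse_pf (K0iW Kz)); apply: ct; exact: pf_K0i.
    have N : nbhs (fin z) (@fin R @` [set u | normc (u - z) < e]).
      by apply/nbhs_fin; exists e => // u; exists u.
    have /nbhs_fin[d d0 Hd] := ctv _ N.
    have oz := open_nbhs_nbhs (conj open_K1i (pf_K0i Kz)); move/nbhsCP: oz => [r r0 Hr].
    exists (Num.min d r); first by rewrite lt_min d0.
    move=> u; rewrite lt_min => /andP[ud /Hr/K1i_image[s Ks su]]; rewrite -su kE //.
    have := Hd _ ud; rewrite /= -su (p_inverse_pf (K0iW Ks)) => -[s' ss' [<-]].
    by rewrite normcB.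
  - have := open_nbhs_nbhs (conj open_K1i Kv); apply: filterS => u /K1i_image[s Ks <-].
    by rewrite kE.
by have [] := cder_is_derive H.
Unshelve. all: by end_near. Qed.

Lemma p_biholomorphism : biholomorphism (inte T0) (inte T1) p_ext.
Proof.
have [_ i0] := T0_boundary; have [_ i1] := T1_boundary; have [f1 f2 f3] := p_ext_bij.
have sub : inte T0 `<=` T0 by move=> P [].
split; last 2 first.
- exact: p_holomorphic.
- by exists p_inverse; [move=> P; rewrite inE => /sub TP; apply: p_inverseK; rewrite inE|exact: p_inverse_holomorphic].
split.
- by rewrite i0 i1 => _ [z Kz <-]; exists (pf z); [exact: pf_K0i|rewrite /= (K0_p (K0iW Kz))].
- by move=> P Q; rewrite !inE => /sub TP /sub TQ; apply: f2; rewrite inE.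
- rewrite i0 i1 => _ [w /K1i_image[z Kz <-] <-]; exists (fin z); first by exists z.
  by rewrite /= (K0_p (K0iW Kz)).
Qed.

Lemma p_vertices : p_ext @` @vertices_T0 R = @vertices_T1 R.
Proof.
apply/seteqP; split=> [_ [P [[->|->]|->] <-]|P [[->|->]|->]] /=.
- by left; left.
- by left; right; rewrite p_i.
- by right; rewrite p_rho.
- by exists (infty R) => //; left; left.
- by exists (fin (iunit R)); [left; right|rewrite /= p_i].
- by exists (fin (rho R)); [right|rewrite /= p_rho].
Qed.

End Conformal.

(** * Circular arc triangles *)

Section Arcs.
Variable R : realType.
Local Notation C := R[i].
Local Notation Re := (@complex.Re R).
Local Notation Im := (@complex.Im R).
Local Notation s3 := (Num.sqrt 3 : R).

Lemma continuous_within_itv (g : R -> Chat R) : (forall t : R, 0 <= t <= 1 ->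
  g u @[u --> within `[0, 1] (nbhs t)] --> g t) -> {within `[0, 1], continuous g}.
Proof.
by move=> H; apply/subspace_continuousP => t; rewrite /= in_itv /= => t01; exact: H.
Qed.

Lemma circular_arc_sym (A : set (Chat R)) (a b : Chat R) : circular_arc A a b -> circular_arc A b a.
Proof.
move=> [K HK [g [cg ig [g0 g1] gA AK]]]; exists K => //; exists (fun t => g (1 - t)).
have sub (t : R) : `[0, 1]%classic t -> `[0, 1]%classic (1 - t) by rewrite /= !in_itv /= => /andP[t0 t1]; apply/andP; split; lra.
split=> //.
- apply/subspace_continuousP => t /sub t01; have := (subspace_continuousP _ _).1 cg _ t01.
  apply: cvg_comp => B; rewrite /= /within /= => HB.
  have c1 : continuous (fun u : R => 1 - u) by move=> u; apply: cvgB; [exact: cvg_cst|exact: cvg_id].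
  have HB' : \forall u \near t, `[0, 1]%classic (1 - u) -> B (1 - u) by exact: (c1 t _ HB).
  suff : \forall u \near t, `[0, 1]%classic u -> B (1 - u) by [].
  by near=> u => /sub; near: u.
- move=> t u; rewrite !inE => /sub t01 /sub u01 E.
  have : 1 - t = 1 - u by apply: ig => //; rewrite inE.
  lra.
- by rewrite subr0 subrr.
- rewrite -gA; apply/seteqP; split=> [_ [t /sub t01 <-]|_ [t /sub t01 <-]]; first by exists (1 - t).
  by exists (1 - t) => //; rewrite opprB addrC subrK.
Unshelve. all: by end_near. Qed.

Definition ray (x0 y0 : R) : set (Chat R) :=
  [set P | if P is Some z then Re z = x0 /\ y0 <= Im z else True].

Lemma ray_arc (x0 y0 : R) : circular_arc (ray x0 y0) (infty R) (fin (x0 +i* y0)).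
Proof.
exists ([set fin (x0%:C + t%:C * 'i%C) | t in [set: R]] `|` [set infty R]).
  by right; exists x0%:C, 'i%C; split=> //; apply/eqP => /(congr1 Im); rewrite Imi Im0 => /eqP; rewrite oner_eq0.
(* [1/t - 1] decreases from infinity to 0 on []0, 1]]; the parameter 0 is sent to infinity. *)
pose z (t : R) : C := x0 +i* (y0 + (t^-1 - 1)).
exists (fun t => if t == 0 then infty R else fin (z t)); split.
- apply: continuous_within_itv => t /andP[t0 t1]; have [->|tn] := eqVneq t 0.
    apply/cvg_inftyP => K; rewrite near_withinE.
    pose d := (`|K| + `|y0| + 1)^-1; have D0 : 0 < `|K| + `|y0| + 1 by rewrite ltr_wpDl // addr_ge0.
    have d0 : 0 < d by rewrite invr_gt0.
    near=> u => u01; case: eqVneq => // un.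
    have u0 : 0 < u by rewrite lt_neqAle eq_sym un; move: u01; rewrite /= in_itv /= => /andP[].
    have ud : u < d by near: u; exact: (@lt_nbhsl _ 0 d d0).
    suff : K < normc (z u) by [].
    apply: (@lt_le_trans _ _ (Im (z u))); last exact: le_trans (ler_norm _) (ler_Im_normc _).
    have : `|K| + `|y0| + 1 < u^-1 by rewrite -[X in X < _]invrK ltf_pV2 ?posrE.
    have := ler_norm K; have := ler_norm (- y0); rewrite normrN /=; clear; lra.
  apply: cvg_within_filter.
  have L : fin (z u) @[u --> t] --> fin (z t).
    have Lz : z u @[u --> t] --> z t.
      apply: cvg_complex; first exact: cvg_cst.
      apply: cvgD; first exact: cvg_cst.
      by apply: cvgB; [apply: cvgV => //; exact: cvg_id|exact: cvg_cst].
    by move=> B /= /Lz.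
  have NZ : \forall u \near t, u != 0.
    apply/nbhs_ballP; exists `|t|; first by rewrite /= normr_gt0.
    by move=> v; rewrite /ball /=; apply: contraTneq => ->; rewrite subr0 ltxx.
  move=> B /L HB.
  have {}HB : \forall u \near t, B (fin (z u)) by exact: HB.
  suff : \forall u \near t, B (if u == 0 then infty R else fin (z u)) by [].
  near=> u; have un : u != 0 by near: u.
  by rewrite (negbTE un); near: u.
- move=> t u _ _; case: eqVneq => [->|tn]; case: eqVneq => [->|un] // [] /addrI/addIr.
  exact: invr_inj.
- by rewrite eqxx oner_eq0 /z invr1 subrr addr0.
- apply/seteqP; split=> [_ [t t01 <-]|[w|]] /=.
  + move: t01; rewrite /= in_itv /= => /andP[t0 t1]; case: eqVneq => // tn; split=> //=.
    rewrite lerDl subr_ge0 invf_ge1 // lt_neqAle eq_sym tn //.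
  + move=> [wx wy]; have v0 : 0 < Im w - y0 + 1 by lra.
    exists (Im w - y0 + 1)^-1.
      by rewrite /= in_itv /= invr_ge0 (ltW v0) invf_le1 // lerDr subr_ge0.
    rewrite invr_eq0 gt_eqF // /z invrK addrK; congr Some; apply: eqC => //=.
    by rewrite addrC subrK.
  + by move=> _; exists 0; rewrite ?eqxx //= in_itv /= lexx ler01.
- move=> [w|] /=; last by right.
  move=> [wx _]; left; exists (Im w) => //; congr Some; apply: eqC.
    by rewrite !(ReD, ReM, Rei, Imi) !(ReC, ImC) wx; ring.
  by rewrite !(ImD, ImM, Rei, Imi) !(ReC, ImC); ring.
Unshelve. all: by end_near. Qed.

Definition unit_arc (s : R) : set (Chat R) :=
  @fin R @` [set z | [/\ 0 <= Re z <= 2^-1, 0 < s * Im z & normc z = 1]].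

Lemma half_itv (t : R) : 0 <= t <= 1 -> 0 <= t / 2 <= 2^-1.
Proof. by move=> /andP[t0 t1]; apply/andP; split; lra. Qed.

Lemma unit_arc_arc (s : R) : s ^+ 2 = 1 ->
  circular_arc (unit_arc s) (fin (0 +i* s)) (fin (2^-1 +i* (s * (s3 / 2)))).
Proof.
move=> ss; have ss' : s * s = 1 by rewrite -expr2.
exists (@fin R @` [set z | `|z - 0| = 1%:C]); first by left; exists 0, 1.
pose y (x : R) := Num.sqrt (1 - x ^+ 2).
have cy : continuous y.
  move=> x; apply: (@continuous_comp _ _ _ (fun v : R => 1 - v ^+ 2) (@Num.sqrt R)); last exact: sqrt_continuous.
  by apply: cvgB; [exact: cvg_cst|exact: exprn_continuous].
pose z (t : R) : C := (t / 2) +i* (s * y (t / 2)).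
have nz t : 0 <= t <= 1 -> normc (z t) = 1.
  move=> /half_itv t01; apply/eqP; rewrite -sqrp_eq1 ?normc_ge0 // normc_sqr /= [(s * _) ^+ 2]exprMn ss mul1r.
  by apply/eqP; have := arcz_sqr t01; rewrite /y => ->; rewrite addrC subrK.
have y1 : y 2^-1 = s3 / 2.
  rewrite /y (_ : 1 - 2^-1 ^+ 2 = (s3 / 2) ^+ 2); last by rewrite exprMn sqr_s3; field.
  by rewrite sqrtr_sqr ger0_norm // divr_ge0 // sqrtr_ge0.
exists (fun t => fin (z t)); split.
- apply: continuous_within_itv => t _; apply: cvg_within_filter.
  have Lt : (u / 2) @[u --> t] --> t / 2 by apply: cvgMr_tmp; exact: cvg_id.
  have Lz : z u @[u --> t] --> z t.
    apply: cvg_complex => //; apply: cvgMl_tmp.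
    exact: (cvg_comp _ _ Lt (cy (t / 2))).
  by move=> B /= /Lz.
- move=> t u _ _ [] E _; lra.
- have z0 : z 0 = 0 +i* s by rewrite /z (mul0r (2^-1 : R)) /y expr0n subr0 sqrtr1 mulr1.
  have z1 : z 1 = 2^-1 +i* (s * (s3 / 2)) by rewrite /z (mul1r (2^-1 : R)) y1.
  by rewrite z0 z1.
- apply/seteqP; split=> [_ [t t01 <-]|_ [w [w01 w0 w1] <-]] /=.
    move: t01; rewrite /= in_itv /= => t01; exists (z t) => //; split; [exact: half_itv| |exact: nz].
    rewrite /= mulrA ss' mul1r sqrtr_gt0; have := half_itv t01; clear; move: (t / 2) => x; nra.
  exists (2 * Re w).
    by rewrite /= in_itv /=; case/andP: w01 => a b; apply/andP; split; lra.
  congr fin; apply: eqC; rewrite /= mulrAC divff // mul1r //.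
  have sw : y (Re w) = s * Im w.
    rewrite /y -[RHS]gtr0_norm // -sqrtr_sqr exprMn ss mul1r; congr Num.sqrt.
    by have := normc_sqr w; rewrite w1 expr1n => ->; rewrite addrC addKr.
  by rewrite sw mulrA ss' mul1r.
- move=> _ [w [_ _ w1] <-]; exists w => //=.
  by rewrite subr0 normcE w1.
Qed.

(** Both triangles have two vertical rays and a unit arc as sides; [s = 1] gives [T0] and [s = -1]
    gives [T1]. *)
Lemma circular_arc_triangle_of_sign (s : R) (X : set (Chat R)) : s ^+ 2 = 1 -> closed_Jordan_region X ->
  boundary X = ray 0 s `|` unit_arc s `|` ray 2^-1 (s * (s3 / 2)) ->
  circular_arc_triangle X [set infty R; fin (0 +i* s); fin (2^-1 +i* (s * (s3 / 2)))].
Proof.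
move=> ss JX bX; split=> //; have ss' : s * s = 1 by rewrite -expr2.
exists (infty R), (fin (0 +i* s)), (fin (2^-1 +i* (s * (s3 / 2)))).
exists (ray 0 s), (unit_arc s), (ray 2^-1 (s * (s3 / 2))).
have s30 := @s3_gt0 R; have s32 := @sqr_s3 R.
split=> //; split; rewrite ?bX //.
- exact: ray_arc.
- exact: unit_arc_arc.
- by apply: circular_arc_sym; exact: ray_arc.
- apply/seteqP; split=> [[z|] //=|_ ->//].
  by move=> [[-> _] [/eqP]]; rewrite invr_eq0 pnatr_eq0.
- apply/seteqP; split=> [P [rP [z [_ z0 z1] zP]]|_ ->].
    move: rP; rewrite -zP => -[zx zs] /=; congr fin; apply: eqC => //=.
    have := normc_sqr z; rewrite z1 expr1n zx expr0n add0r => E.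
    have : (s * Im z) ^+ 2 = 1 by rewrite exprMn ss -E mulr1.
    by move=> /eqP; rewrite sqrp_eq1 ?ltW // => /eqP H; rewrite -[Im z]mul1r -ss' -mulrA H mulr1.
  split; first by [].
  exists (0 +i* s) => //; split; [by rewrite /= lexx invr_ge0 ler0n|by rewrite /= ss' ltr01|].
  by apply/eqP; rewrite -sqrp_eq1 ?normc_ge0 // normc_sqr /= ss expr0n add0r.
- apply/seteqP; split=> [_ [[z [_ z0 z1] <-]]|_ ->].
    move=> [zx zs] /=; congr fin; apply: eqC => //=.
    have := normc_sqr z; rewrite z1 expr1n zx => E.
    have : (s * Im z) ^+ 2 = (s3 / 2) ^+ 2.
      by rewrite exprMn ss mul1r exprMn s32; move: E; clear; lra.
    move=> /eqP; rewrite eqrXn2 ?ltW ?divr_gt0 // => /eqP H.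
    by rewrite -H mulrA ss' mul1r.
  split; last by [].
  exists (2^-1 +i* (s * (s3 / 2))) => //; split.
  + by rewrite /= lexx invr_ge0 ler0n.
  + by rewrite /= mulrA ss' mul1r divr_gt0.
  + by apply/eqP; rewrite -sqrp_eq1 ?normc_ge0 // normc_sqr /= exprMn ss mul1r exprMn s32; apply/eqP; field.
Qed.

End Arcs.

(** * [T0] as a closed disc *)

Section DiscModel.
Variable R : realType.
Local Notation C := R[i].
Local Notation Re := (@complex.Re R).
Local Notation Im := (@complex.Im R).
Local Notation K0 := (@K0 R).
Local Notation T0 := (@T0 R).

Definition disc_height (z : C) : R := Im z - Num.sqrt (1 - Re z ^+ 2).
Definition disc_radius (z : C) : R := (1 + disc_height z)^-1.
(** [(disc_re, disc_im)] is the point of the upper half disc with radius [disc_radius] in the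
    direction of abscissa [4 Re z - 1], which runs over [[-1, 1]]. *)
Definition disc_re (z : C) : R := (4 * Re z - 1) * disc_radius z.
Definition disc_im (z : C) : R := Num.sqrt (1 - (4 * Re z - 1) ^+ 2) * disc_radius z.

(* The vertical strip above the unit arc is parametrised by Re z and the height
   above the arc; this becomes a half disc centred at the image of infinity,
   and each vertical chord of the half disc is then stretched to the full disc. *)
Definition disc_chart (P : Chat R) : C :=
  if P is Some z then disc_re z +i* (2 * disc_im z - Num.sqrt (1 - disc_re z ^+ 2)) else 0 -i* 1.

(** [Y] undoes the stretching of the chord; [r] is the radius, hence [1/r - 1] the height above the
    arc, and [Re w / r] equals [4 x - 1]. *)
Definition disc_chart_inv (w : C) : Chat R :=
  let Y := (Im w + Num.sqrt (1 - Re w ^+ 2)) / 2 in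
  let r := Num.sqrt (Re w ^+ 2 + Y ^+ 2) in
  let x := (Re w / r + 1) / 4 in
  if r == 0 then infty R else fin (x +i* (r^-1 - 1 + Num.sqrt (1 - x ^+ 2))).

Lemma disc_facts (z : C) : K0 z ->
  [/\ 0 <= disc_height z, -1 <= 4 * Re z - 1 <= 1, 0 < disc_radius z <= 1,
      0 <= disc_im z & disc_re z ^+ 2 + disc_im z ^+ 2 = disc_radius z ^+ 2].
Proof.
move=> [/andP[x0 x1] y0]; rewrite normc_ge1 => n1.
have t0 : 0 <= disc_height z.
  rewrite /disc_height subr_ge0 -(gtr0_norm y0) -sqrtr_sqr; apply: ler_wsqrtr.
  by move: n1; clear; lra.
have xi : -1 <= 4 * Re z - 1 <= 1 by apply/andP; split; lra.
have d0 : 0 < 1 + disc_height z by rewrite ltr_pwDl.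
have r0 : 0 < disc_radius z by rewrite invr_gt0.
split=> //.
- by rewrite r0 /disc_radius invf_le1 // lerDl.
- by rewrite mulr_ge0 ?sqrtr_ge0 // ltW.
rewrite /disc_re /disc_im !exprMn sqr_sqrtr; first by ring.
by case/andP: xi; clear; move: (4 * Re z - 1) => x; nra.
Qed.

Lemma disc_chart_in (P : Chat R) : T0 P -> normc (disc_chart P) <= 1.
Proof.
case: P => [z /T0_fin Kz|_]; last by rewrite normc_le1 /= sqrrN expr1n expr0n add0r.
have [_ _ /andP[r0 r1] Y0 XY] := disc_facts Kz; rewrite normc_le1 /=.
have : disc_radius z ^+ 2 <= 1 by rewrite expr_le1 // ltW.
rewrite -XY; move: (disc_re z) (disc_im z) Y0 => X Y Y0 XY1.
have s2 : Num.sqrt (1 - X ^+ 2) ^+ 2 = 1 - X ^+ 2 by rewrite sqr_sqrtr //; clear -XY1; nra.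
have s0 := sqrtr_ge0 (1 - X ^+ 2).
have Ys : Y <= Num.sqrt (1 - X ^+ 2) by rewrite -(ler_pXn2r (n := 2)) ?nnegrE // s2; clear -XY1; lra.
have : 0 <= Y * (Num.sqrt (1 - X ^+ 2) - Y) by rewrite mulr_ge0 // subr_ge0.
by move: s2; clear; move: (Num.sqrt _) => t; nra.
Qed.

Lemma disc_chartK : {in T0, cancel disc_chart disc_chart_inv}.
Proof.
move=> P; rewrite inE; case: P => [z /T0_fin Kz|_].
  have [_ _ /andP[r0 r1] Y0 XY] := disc_facts Kz.
  rewrite /disc_chart /disc_chart_inv /= subrK mulrAC divff // mul1r XY sqrtr_sqr gtr0_norm // gt_eqF //.
  have -> : (disc_re z / disc_radius z + 1) / 4 = Re z by rewrite /disc_re; field; rewrite gt_eqF.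
  by rewrite invrK /disc_height [1 + _]addrC addrK subrK -ReIm_eta.
rewrite /disc_chart /disc_chart_inv /= expr0n subr0 sqrtr1 addNr mul0r.
by rewrite expr0n addr0 sqrtr0 eqxx.
Qed.

Lemma disc_chart_invP (w : C) : normc w <= 1 -> T0 (disc_chart_inv w) /\ disc_chart (disc_chart_inv w) = w.
Proof.
rewrite normc_le1 /disc_chart_inv; case: w => X V /= w1.
set s := Num.sqrt (1 - X ^+ 2); set Y := (V + s) / 2; set r := Num.sqrt (X ^+ 2 + Y ^+ 2).
have s0 : 0 <= s by exact: sqrtr_ge0.
have s2 : s ^+ 2 = 1 - X ^+ 2 by rewrite sqr_sqrtr //; clear -w1; nra.
have /andP[V0 V1] : - s <= V <= s.
  by rewrite -ler_norml -(ler_pXn2r (n := 2)) ?nnegrE // real_normK ?num_real // s2; clear -w1; lra.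
have Y0 : 0 <= Y by rewrite /Y; clear -V0; lra.
have Ys : Y <= s by rewrite /Y; clear -V1; lra.
have r2 : r ^+ 2 = X ^+ 2 + Y ^+ 2 by rewrite sqr_sqrtr // addr_ge0 ?sqr_ge0.
case: eqVneq => [r0|rn].
  have /eqP : X ^+ 2 + Y ^+ 2 = 0 by rewrite -r2 r0 expr0n.
  rewrite paddr_eq0 ?sqr_ge0 // !sqrf_eq0 => /andP[/eqP X0 /eqP YZ].
  have s1 : s = 1 by rewrite /s X0 expr0n subr0 sqrtr1.
  split; first exact: T0_infty.
  by rewrite /= X0; congr (_ +i* _); move: YZ; rewrite /Y s1; clear; lra.
have r0 : 0 < r by rewrite lt_neqAle eq_sym rn sqrtr_ge0.
have r1 : r <= 1.
  rewrite -(ler_pXn2r (n := 2)) ?nnegrE ?(ltW r0) // r2 expr1n.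
  have : Y ^+ 2 <= s ^+ 2 by rewrite ler_pXn2r ?nnegrE.
  by rewrite s2; clear; lra.
have Xr : - r <= X <= r.
  rewrite -ler_norml -(ler_pXn2r (n := 2)) ?nnegrE ?(ltW r0) // real_normK ?num_real // r2.
  by rewrite lerDl sqr_ge0.
have /andP[xi0 xi1] : -1 <= X / r <= 1.
  by case/andP: Xr => a b; rewrite ler_pdivlMr // mulN1r a ler_pdivrMr // mul1r b.
set x := (X / r + 1) / 4.
have x0 : 0 <= x by rewrite /x; clear -xi0; lra.
have x1 : x <= 2^-1 by rewrite /x; clear -xi1; lra.
have x2 : Num.sqrt (1 - x ^+ 2) ^+ 2 = 1 - x ^+ 2 by rewrite sqr_sqrtr //; clear -x0 x1; nra.
have q0 : 0 < Num.sqrt (1 - x ^+ 2) by rewrite sqrtr_gt0; clear -x0 x1; nra.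
have ri : 1 <= r^-1 by rewrite invf_ge1.
split.
  apply/T0_fin; split; first by rewrite /= x0.
    by rewrite /=; clear -q0 ri; lra.
  rewrite normc_ge1 /=; move: (Num.sqrt (1 - x ^+ 2)) q0 x2 => q q0 q2.
  apply: (@le_trans _ _ (x ^+ 2 + q ^+ 2)); first by rewrite q2 addrC subrK.
  have qy : q <= r^-1 - 1 + q by clear -ri; lra.
  by rewrite lerD2l ler_pXn2r ?nnegrE ?(ltW q0) // (le_trans (ltW q0) qy).
have E1 : disc_radius (x +i* (r^-1 - 1 + Num.sqrt (1 - x ^+ 2))) = r.
  by rewrite /disc_radius /disc_height /= addrK addrC subrK invrK.
have E2 : 4 * x - 1 = X / r by rewrite /x; field; rewrite rn.
have E3 : disc_re (x +i* (r^-1 - 1 + Num.sqrt (1 - x ^+ 2))) = X.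
  by rewrite /disc_re E1 /= E2 divfK.
have E4 : disc_im (x +i* (r^-1 - 1 + Num.sqrt (1 - x ^+ 2))) = Y.
  rewrite /disc_im E1 /= E2.
  have -> : 1 - (X / r) ^+ 2 = (Y / r) ^+ 2.
    have Y2 : Y ^+ 2 = r ^+ 2 - X ^+ 2 by rewrite r2 addrC addKr.
    by rewrite (expr_div_n X) (expr_div_n Y) Y2 mulrBl divff // expf_eq0.
  have Yr : 0 <= Y / r by rewrite divr_ge0 // ltW.
  by rewrite sqrtr_sqr (ger0_norm Yr) divfK.
rewrite /disc_chart /= E3 E4; congr (_ +i* _).
by rewrite -/s /Y; field.
Qed.

Lemma cvg_sqrt (T : Type) (F : set_system T) {FF : Filter F} (f : T -> R) (l : R) :
  f t @[t --> F] --> l -> Num.sqrt (f t) @[t --> F] --> Num.sqrt l.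
Proof. by move=> Hf; exact: (cvg_comp _ _ Hf (@sqrt_continuous R l)). Qed.

Lemma disc_chart_fin_continuous (z : C) : K0 z -> disc_chart (fin w) @[w --> z] --> disc_chart (fin z).
Proof.
move=> Kz; have [t0 _ _ _ _] := disc_facts Kz.
have cRe := @Re_continuous R z; have cIm := @Im_continuous R z.
have sq (f : C -> R) (l : R) : f w @[w --> z] --> l -> (1 - f w ^+ 2) @[w --> z] --> 1 - l ^+ 2.
  have cv : continuous (fun v : R => 1 - v ^+ 2).
    by move=> v; apply: cvgB; [exact: cvg_cst|exact: exprn_continuous].
  by move=> Hf; exact: (cvg_comp _ _ Hf (cv l)).
have cst (a : R) : (fun=> a) w @[w --> z] --> a by exact: (@cvg_cst _ a _ (nbhs z) (nbhs_filter z)).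
have cH : disc_height w @[w --> z] --> disc_height z by apply: (cvgB cIm); apply: cvg_sqrt; exact: sq.
have cR : disc_radius w @[w --> z] --> disc_radius z.
  have nz : 1 + disc_height z != 0 by rewrite gt_eqF // ltr_pwDl.
  exact: (cvgV nz (cvgD (cst 1) cH)).
have cX : (4 * Re w - 1) @[w --> z] --> 4 * Re z - 1.
  exact: (cvgB (cvgM (cst 4) cRe) (cst 1)).
have c1 : disc_re w @[w --> z] --> disc_re z by exact: cvgM cX cR.
have c2 : disc_im w @[w --> z] --> disc_im z by apply: cvgM cR; apply: cvg_sqrt; exact: sq.
exact: (cvg_complex c1 (cvgB (cvgM (cst 2) c2) (cvg_sqrt (sq _ _ c1)))).
Qed.

Lemma disc_chart_infty (z : C) (e : R) : K0 z -> 0 < e -> disc_radius z <= e ->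
  normc (disc_chart (infty R) - disc_chart (fin z)) <= 4 * e.
Proof.
move=> Kz e0 re; have [_ _ /andP[r0 r1] Y0 XY] := disc_facts Kz.
apply: le_trans (normc_le_ReIm _) _; rewrite !(ReD, ReN, ImD, ImN) /=.
have X1 : `|disc_re z| <= disc_radius z.
  by rewrite -(ler_pXn2r (n := 2)) ?nnegrE ?(ltW r0) // real_normK ?num_real // -XY lerDl sqr_ge0.
have Y1 : disc_im z <= disc_radius z.
  by rewrite -(ler_pXn2r (n := 2)) ?nnegrE ?(ltW r0) // -XY lerDr sqr_ge0.
have s0 := sqrtr_ge0 (1 - disc_re z ^+ 2).
have X2 : disc_re z ^+ 2 <= disc_radius z ^+ 2 by rewrite -XY lerDl sqr_ge0.
have s2 : Num.sqrt (1 - disc_re z ^+ 2) ^+ 2 = 1 - disc_re z ^+ 2.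
  by rewrite sqr_sqrtr // subr_ge0 (le_trans X2) // expr_le1 // ltW.
rewrite add0r normrN; move: (disc_radius z) (disc_re z) (disc_im z) (Num.sqrt _) r0 r1 Y0 X1 Y1 re X2 s0 s2.
clear -e0 => r X Y s r0 r1 Y0 X1 Y1 re X2 s0 s2.
have s1 : s <= 1 by nra.
have s3 : 1 - s <= r by nra.
have : `|-1 - (2 * Y - s)| <= 3 * r by rewrite ler_norml; apply/andP; split; lra.
lra.
Qed.

Lemma disc_chart_continuous : {within T0, continuous disc_chart}.
Proof.
apply/subspace_continuousP => -[z /T0_fin Kz|_].
  by apply: cvg_within_filter => B /(disc_chart_fin_continuous Kz).
apply/cvgCP => e e0; rewrite near_withinE; apply/nbhs_inftyP.
have d0 : 0 < e / 5 by rewrite divr_gt0.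
exists ((e / 5)^-1 + 1) => -[z|_ _]; last by rewrite subrr normc0.
move=> zK /T0_fin Kz; apply: le_lt_trans (disc_chart_infty Kz d0 _) _; last by clear -e0; lra.
have [t0 _ /andP[r0 r1] _ _] := disc_facts Kz.
rewrite -[X in _ <= X]invrK lef_pV2 ?posrE ?invr_gt0 //; last by rewrite ltr_pwDl.
have [/andP[x0 x1] y0 _] := Kz; have := normc_le_ReIm z.
rewrite (ger0_norm x0) (gtr0_norm y0) /disc_height.
have : Num.sqrt (1 - Re z ^+ 2) <= 1.
  by rewrite -[X in _ <= X]sqrtr1 ler_wsqrtr // gerBl sqr_ge0.
have {}zK : (e / 5)^-1 + 1 < normc z by exact: zK.
by move: zK; clear -x1; move: (Num.sqrt _) (normc z) (e / 5)^-1 => s n k; lra.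
Qed.

Lemma T0_Jordan : closed_Jordan_region T0.
Proof.
split; first exact: compact_sphere (@closed_T0 R).
exists disc_chart_inv.
have dE : [set z : C | `|z| <= 1] = disc_chart @` T0.
  apply/seteqP; split=> [w|_ [P TP <-]] /=; rewrite normcE_le1; last exact: disc_chart_in.
  by move=> /disc_chart_invP[TP <-]; exists (disc_chart_inv w).
split.
- split=> [w|w v|P TP].
  + by rewrite /= normcE_le1 => /disc_chart_invP[].
  + rewrite !inE /= !normcE_le1 => /disc_chart_invP[_ E1] /disc_chart_invP[_ E2] E.
    by rewrite -E1 -E2 E.
  + exists (disc_chart P); last by rewrite disc_chartK ?inE.
    by rewrite /= normcE_le1; exact: disc_chart_in.
- rewrite dE; apply: (@compact_continuous_inverse (Chat R) C T0 disc_chart disc_chart_inv).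
  + exact: norm_hausdorff.
  + exact: compact_sphere (@closed_T0 R).
  + exact: disc_chart_continuous.
  + exact: disc_chartK.
- exists disc_chart; last exact: disc_chart_continuous.
  by move=> w; rewrite inE /= normcE_le1 => /disc_chart_invP[].
Qed.

End DiscModel.

Lemma homeomorphism_comp (T U V : topologicalType) (A : set T) (B : set U) (D : set V)
    (f : T -> U) (g : U -> V) :
  homeomorphism_between A B f -> homeomorphism_between B D g -> homeomorphism_between A D (g \o f).
Proof.
move=> [[f1 f2 f3] cf [f' fK cf']] [[g1 g2 g3] cg [g' gK cg']].
have g'B d : D d -> B (g' d) by move=> /g3[b Bb <-]; rewrite gK ?inE.
have cc (X Y Z : topologicalType) (E : set X) (F : set Y) (h : X -> Y) (k : Y -> Z) :
    {within E, continuous h} -> {within F, continuous k} -> (forall x, E x -> F (h x)) ->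
    {within E, continuous (k \o h)}.
  move=> /subspace_continuousP ch /subspace_continuousP ck EF; apply/subspace_continuousP => x Ex.
  move=> W /(ck _ (EF _ Ex)); rewrite /= /within /= => NW.
  have H : \forall y \near x, E y -> F (h y) -> W (k (h y)) by exact: (ch _ Ex _ NW).
  suff : \forall y \near x, E y -> W (k (h y)) by [].
  near=> y => Ey; have Hy : E y -> F (h y) -> W (k (h y)) by near: y.
  exact: Hy Ey (EF _ Ey).
split.
- split=> [x /f1 /g1 //|x y|d /g3[b /f3[a Aa <-] <-]]; last by exists a.
  rewrite !inE => Ax Ay /g2 E; apply: f2; rewrite ?inE //.
  by apply: E; rewrite inE; exact: f1.
- exact: cc cf cg f1.
- exists (f' \o g'); last exact: cc cg' cf' g'B.
  by move=> x; rewrite inE => Ax; rewrite /= gK ?inE ?fK ?inE //; exact: f1.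
Unshelve. all: by end_near. Qed.

(** * [T0] and [T1] as circular arc triangles *)

Section Triangles.
Variable R : realType.
Local Notation C := R[i].
Local Notation Re := (@complex.Re R).
Local Notation Im := (@complex.Im R).
Local Notation s3 := (Num.sqrt 3 : R).
Local Notation K0 := (@K0 R).
Local Notation K1 := (@K1 R).
Local Notation K0i := (@K0i R).
Local Notation K1i := (@K1i R).
Local Notation T0 := (@T0 R).
Local Notation T1 := (@T1 R).

(** [p_ext] itself transports the disc model from [T0], so [T1] needs no chart of its own. *)
Lemma T1_Jordan : closed_Jordan_region T1.
Proof.
split; first exact: compact_sphere (@closed_T1 R).
have [_ [h Hh]] := @T0_Jordan R; exists (@p_ext R \o h).
exact: homeomorphism_comp Hh (@p_homeomorphism R).
Qed.

Lemma boundary_T0E : boundary T0 = ray 0 1 `|` unit_arc 1 `|` ray 2^-1 (1 * (s3 / 2)).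
Proof.
have [-> _] := @T0_boundary R; have s0 := @s3_gt0 R; have ss := @sqr_s3 R.
have h01 : (0 : R) <= 2^-1 by rewrite invr_ge0.
rewrite mul1r; apply/seteqP; split=> [[z [/T0_fin Kz nK]|_]|P]; last first.
- move=> [[]|]; case: P => [z|] //.
  + move=> [x0 y1]; split; last by move=> [w [/andP[+ _] _ _] [wz]]; rewrite wz x0 ltxx.
    apply/T0_fin; split; first by rewrite x0 lexx h01.
      exact: lt_le_trans y1.
    by rewrite normc_ge1 x0 expr0n add0r expr_ge1 // (le_trans ler01).
  + by move=> _; split; [exact: T0_infty|case].
  + move=> [w [w01]]; rewrite mul1r => w0 w1 [<-]; split; last by move=> [v [_ _ +] [vw]]; rewrite vw w1 ltxx.
    by apply/T0_fin; split=> //; rewrite w1.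
  + by case.
  + move=> [x0 y1]; split; last by move=> [w [/andP[_ +] _ _] [wz]]; rewrite wz x0 ltxx.
    have y0 : 0 < Im z by apply: lt_le_trans y1; rewrite divr_gt0.
    apply/T0_fin; split=> //; first by rewrite x0 lexx h01.
    rewrite normc_ge1 x0; move: y1; clear -s0 ss; move: (Im z) (Num.sqrt _) s0 ss => y s; nra.
  + by move=> _; split; [exact: T0_infty|case].
- by left; left.
have [/andP[x0 x1] y0 n1] := Kz.
have [r1|r1] := eqVneq (Re z) 0.
  left; left; split=> //; move: n1; rewrite normc_ge1 r1 expr0n add0r expr_ge1 // ltW //.
have [r2|r2] := eqVneq (Re z) 2^-1; first by right; split=> //; have [] := K0_Im Kz.
have [n2|n2] := eqVneq (normc z) 1.
  by left; right; exists z => //; split; rewrite ?x0 ?mul1r.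
by case: nK; exists z => //; split=> //; [rewrite !lt_neqAle x0 x1 r2 eq_sym r1|rewrite lt_neqAle eq_sym n2].
Qed.

Lemma boundary_T1E : boundary T1 = ray 0 (-1) `|` unit_arc (-1) `|` ray 2^-1 (-1 * (s3 / 2)).
Proof.
have [-> _] := @T1_boundary R; have s0 := @s3_gt0 R; have ss := @sqr_s3 R.
have h01 : (0 : R) <= 2^-1 by rewrite invr_ge0.
rewrite mulN1r; apply/seteqP; split=> [[z [/T1_fin Kz nK]|_]|P]; last first.
- move=> [[]|]; case: P => [z|] //.
  + move=> [x0 y1]; split; last by move=> [w [/andP[+ _] _] [wz]]; rewrite wz x0 ltxx.
    apply/T1_fin; split; first by rewrite x0 lexx h01.
    have [|y0] := lerP 0 (Im z); first by left.
    right; rewrite normc_le1 x0; move: y1 y0; clear; move: (Im z) => y; nra.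
  + by move=> _; split; [exact: T1_infty|case].
  + move=> [w [w01]]; rewrite mulN1r oppr_gt0 => w0 w1 [<-]; split.
      by apply/T1_fin; split=> //; right; rewrite w1.
    by move=> [v [_ +] [vw]]; rewrite vw w1 ltxx leNgt w0 => -[].
  + by case.
  + move=> [x0 y1]; split; last by move=> [w [/andP[_ +] _] [wz]]; rewrite wz x0 ltxx.
    apply/T1_fin; split; first by rewrite x0 lexx h01.
    have [|y0] := lerP 0 (Im z); first by left.
    right; rewrite normc_le1 x0; move: y1 y0; clear -s0 ss; move: (Im z) (Num.sqrt _) s0 ss => y s; nra.
  + by move=> _; split; [exact: T1_infty|case].
- by left; left.
have [/andP[x0 x1] yn] := Kz.
have [r1|r1] := eqVneq (Re z) 0.
  left; left; split=> //; case: yn => [y0|]; first by apply: le_trans y0; rewrite oppr_le0.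
  rewrite normc_le1 r1; clear; move: (Im z) => y; nra.
have [r2|r2] := eqVneq (Re z) 2^-1.
  right; split=> //; case: yn => [y0|]; first by apply: le_trans y0; rewrite oppr_le0 divr_ge0 // ltW.
  by rewrite normc_le1 r2; clear -s0 ss; move: (Im z) (Num.sqrt _) s0 ss => y s; nra.
have xi : 0 < Re z < 2^-1 by rewrite !lt_neqAle x0 x1 r2 eq_sym r1.
have [y0|y0] := lerP 0 (Im z); first by case: nK; exists z => //; split=> //; left.
have [n2|n2] := eqVneq (normc z) 1.
  by left; right; exists z => //; split; rewrite ?x0 ?mulN1r ?oppr_gt0.
case: nK; exists z => //; split=> //; right; rewrite lt_neqAle n2 /=.
by case: yn => //; rewrite leNgt y0.
Qed.

Lemma T0_triangle : circular_arc_triangle T0 (@vertices_T0 R).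
Proof.
have := circular_arc_triangle_of_sign (expr1n _ 2) (@T0_Jordan R) boundary_T0E.
rewrite /vertices_T0 (_ : rho R = 2^-1 +i* (1 * (s3 / 2))) //.
by rewrite rhoE mul1r.
Qed.

Lemma T1_triangle : circular_arc_triangle T1 (@vertices_T1 R).
Proof.
have s1 : (-1 : R) ^+ 2 = 1 by rewrite sqrrN expr1n.
have := circular_arc_triangle_of_sign s1 T1_Jordan boundary_T1E.
rewrite /vertices_T1 (_ : rho_conj R = 2^-1 +i* (-1 * (s3 / 2))); last first.
  by rewrite rho_conjE rhoE mulN1r.
by rewrite (_ : - iunit R = 0 +i* -1) // /iunit; simpc.
Qed.

End Triangles.

Theorem theorem1p1 (R : realType) :
  [/\ meromorphic_on (@upper_half_plane R) (@p R),
      conformal_map (@T0 R) (@vertices_T0 R) (@T1 R) (@vertices_T1 R) (@p_ext R),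
      p (iunit R) = fin (- iunit R),
      p (rho R) = fin (rho_conj R) &
      p_ext (infty R) = infty R /\
      p_ext P @[P --> within (@T0 R) (infty R)^'] --> infty R].
Proof.
split.
- exact: p_meromorphic.
- split.
  + exact: T0_triangle.
  + exact: T1_triangle.
  + exact: p_homeomorphism.
  + exact: p_vertices.
  + exact: p_biholomorphism.
- exact: p_i.
- exact: p_rho.
- split=> //.
  move=> A /(@p_ext_cvg_infty R) HA.
  have {}HA : \forall P \near infty R, (@T0 R) P -> A (p_ext P) by exact: HA.
  suff : \forall P \near infty R, P != infty R -> (@T0 R) P -> A (p_ext P) by [].
  by near=> P => _; near: P.
Unshelve. all: by end_near. Qed.
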